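(* Let $L$ be a rectifiable link in $\mathbb{R}^3$. Then $L$ is strongly critical for link-ropelength if and only if $L$ has finite total curvature and there exists a positive Radon measure $\mu$ on $\mathrm{Strut}(L)$ such that $$A_S^*(\mu)=-\mathcal{K}$$ as forces ($\mathbb{R}^3$-valued Radon measures) along $L$.
   Context: A curve is a continuous map $M\to\mathbb{R}^3$ from a compact oriented 1-manifold with boundary (finitely many components), up to orientation-preserving reparametrization; points of the curve are points of $M$, identified with their images when convenient. A link is a closed curve (all components of $M$ are circles) whose different components have disjoint images (a component may intersect itself). A rectifiable curve has finite length and is parametrized by arclength $s$; $T=dL/ds$ is its unit tangent, defined a.e. The link-thickness $\mathrm{LThi}(L)$ is the minimum distance between points on different components. A strut is an unordered pair $\{x,y\}$ of points on different components with $|y-x|=\mathrm{LThi}(L)$; $\mathrm{Strut}(L)$ is the compact space of struts. $\mathrm{VF}(L)$ is the space of continuous $\mathbb{R}^3$-valued vector fields along $L$, $\mathrm{VF}^\infty(L)$ the subspace of those that are smooth in arclength. $\delta_\xi\mathrm{Len}(L)=\int_L\langle T,d\xi/ds\rangle\,ds$ and $\delta^+_\xi\mathrm{LThi}(L)=\frac{d}{dt^+}\big|_{t=0}\mathrm{LThi}(L+t\xi)$. $L$ is strongly critical for link-ropelength if there is $\varepsilon>0$ such that $\delta^+_\xi\mathrm{LThi}(L)\le-\varepsilon$ for all $\xi\in \mathrm{VF}^\infty(L)$ with $\delta_\xi\mathrm{Len}(L)=-1$. The rigidity operator $A_S\colon \mathrm{VF}(L)\to C(\mathrm{Strut}(L))$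 is $(A_S\xi)(\{x,y\})=\langle \xi_y-\xi_x,y-x\rangle/|y-x|$. Its adjoint $A_S^*$ sends a Radon measure $\mu$ on $\mathrm{Strut}(L)$ to the $\mathbb{R}^3$-valued Radon measure (''force'') $A_S^*\mu$ along $L$ with $\int_L\langle\xi,dA_S^*\mu\rangle=\int_{\mathrm{Strut}(L)}A_S\xi\,d\mu$ for all $\xi\in \mathrm{VF}(L)$. The total curvature of a curve is the supremum of the total turning angles of its inscribed polygons; a rectifiable curve has finite total curvature iff $T$ is of bounded variation. In that case, for a closed curve, the curvature force $\mathcal{K}$ is the distributional derivative of $T$ with respect to arclength, an $\mathbb{R}^3$-valued Radon measure along $L$, so that $\delta_\xi\mathrm{Len}(L)=-\int_L\langle\xi,d\mathcal{K}\rangle$. *)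

(* Defs.v *)
From HB Require Import structures.
From mathcomp Require Import all_boot all_order all_algebra.
From mathcomp Require Import all_classical all_reals all_analysis.

Set Implicit Arguments.
Unset Strict Implicit.
Unset Printing Implicit Defensive.

Import Order.TTheory GRing.Theory Num.Theory.
Import numFieldNormedType.Exports.

Local Open Scope classical_set_scope.
Local Open Scope ring_scope.

(* The library norm on 'rV[R]_3 is the sup norm (same topology), hence the
   explicit Euclidean structure. *)
Section euclidean.
Variable R : realType.
Implicit Types u v : 'rV[R]_3.

Definition dot u v : R := \sum_(c < 3) u ord0 c * v ord0 c.

Definition enorm u : R := Num.sqrt (dot u u).

Definition vangle u v : R := acos (dot u v / (enorm u * enorm v)).

End euclidean.

(* Polygons are given by their list of vertices. *)
Section polygons.
Variable R : realType.
Implicit Types v : seq 'rV[R]_3.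

Definition polyline_length v : R :=
  \sum_(e <- zip v (behead v)) enorm (e.2 - e.1).

Definition cyclic_pairs (T : Type) (s : seq T) : seq (T * T) := zip s (rot 1 s).

Definition closed_edges v : seq 'rV[R]_3 :=
  [seq e.2 - e.1 | e <- cyclic_pairs v].

Definition turning v : R :=
  \sum_(e <- cyclic_pairs (closed_edges v)) vangle e.1 e.2.

End polygons.

Section curves.
Variable R : realType.
Implicit Types (g : R -> 'rV[R]_3) (a b l : R).

Definition curve_length g a b : \bar R :=
  ereal_sup [set (polyline_length (map g (a :: s)))%:E | s in itv_partition a b].

(* Turning angles only make sense at vertices whose two edges are nonzero; a
   polygon with repeated consecutive vertices is the same polygon as the one
   where the repetitions are dropped. *)
Definition inscribed l g (v : seq 'rV[R]_3) : Prop :=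
  exists s : seq R, [/\ sorted <%R s, all (fun x => 0 <= x < l) s,
    v = map g s & 0 \notin closed_edges v].

Definition closed_total_curvature l g : \bar R :=
  ereal_sup [set (turning v)%:E | v in inscribed l g].

End curves.

(* A closed curve with k.+1 components: the i-th circle is R / (period i) Z, and
   maps and vector fields on it are periodic maps on R. *)
Record link (R : realType) (k : nat) := Link {
  period : 'I_k.+1 -> R ;
  link_map :> 'I_k.+1 -> R -> 'rV[R]_3 ;
  period_gt0 : forall i, 0 < period i ;
  link_continuous : forall i, continuous (link_map i) ;
  link_periodic : forall i, periodic (link_map i) (period i) ;
  link_disjoint : forall i j, i != j -> forall s t, link_map i s != link_map j t
}.

HB.instance Definition _ (k : nat) := isPointed.Build 'I_k.+1 ord0.

HB.instance Definition _ (k : nat) := @isMeasurable.Build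
  default_measure_display 'I_k.+1 discrete_measurable discrete_measurable0
  discrete_measurableC discrete_measurableU.

(* (i, s) is the point of parameter s on the i-th component. *)
Notation lpoint R k := ('I_k.+1 * measurableTypeR R)%type.

(* Integral against a signed measure. *)
Section charge_integral.
Context d (T : measurableType d) (R : realType).
Variable nu : {charge set T -> \bar R}.

Let P := cid (Hahn_decomposition nu).
Let N := cid (projT2 P).

Definition charge_integral (D : set T) (f : T -> R) : R :=
  \int[jordan_pos (projT2 N)]_(x in D) f x -
  \int[jordan_neg (projT2 N)]_(x in D) f x.

End charge_integral.

Section criticality.
Variables (R : realType) (k : nat).

Notation vfield := ('I_k.+1 -> R -> 'rV[R]_3).

Definition LThi (g : vfield) : R :=
  inf [set r | exists i j s t, i != j /\ r = enorm (g j t - g i s)].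

Variable L : link R k.

Definition arclength_parametrized : Prop := forall i a b, a <= b ->
  curve_length (L i) a b = (b - a)%:E.

Definition finite_total_curvature : Prop :=
  (\sum_(i < k.+1) closed_total_curvature (period L i) (L i) < +oo)%E.

Definition VF (xi : vfield) : Prop :=
  forall i, continuous (xi i) /\ periodic (xi i) (period L i).

Definition VFsmooth (xi : vfield) : Prop :=
  VF xi /\ forall i n s, derivable (derive1n n (xi i)) s 1.

Definition tangent (i : 'I_k.+1) (s : R) : 'rV[R]_3 := (derive1 (L i)) s.

Definition dLen (xi : vfield) : R :=
  \sum_(i < k.+1) \int[lebesgue_measure]_(s in `[0, period L i])
    dot (tangent i s) (derive1 (xi i) s).

Definition dLThi (xi : vfield) : R :=
  lim ((fun t : R =>
    t^-1 * (LThi (fun i s => L i s + t *: xi i s) - LThi L)) @ 0^'+).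

Definition strongly_critical : Prop :=
  exists2 eps : R, 0 < eps &
    forall xi, VFsmooth xi -> dLen xi = -1 -> dLThi xi <= - eps.

(* The points of the link, one representative for each. The Borel sets of the
   disjoint union of circles correspond to the Borel subsets of this set. *)
Definition points : set (lpoint R k) := [set x | 0 <= x.2 < period L x.1].

(* The two ends of a strut are on different components, so the unordered pair
   is represented by its ordering along increasing component indices. *)
Definition Strut : set (lpoint R k * lpoint R k) :=
  [set p | [/\ points p.1, points p.2, (p.1.1 < p.2.1)%N &
    enorm (L p.2.1 p.2.2 - L p.1.1 p.1.2) = LThi L]].

Definition rigidity (xi : vfield) (p : lpoint R k * lpoint R k) : R :=
  let x := L p.1.1 p.1.2 in let y := L p.2.1 p.2.2 in
  dot (xi p.2.1 p.2.2 - xi p.1.1 p.1.2) (y - x) / enorm (y - x).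

(* R^3-valued Radon measures along L, by components. On the compact spaces at
   hand, Radon measures are the finite Borel measures. Measures on [points] and
   [Strut] are represented by measures on the ambient type, of which only the
   values on subsets of these sets matter. *)
Definition force := 'I_3 -> {charge set (lpoint R k) -> \bar R}.

Definition force_integral (xi : vfield) (F : force) : R :=
  \sum_(c < 3) charge_integral (F c) points (fun x => xi x.1 x.2 ord0 c).

Definition is_rigidity_adjoint
    (mu : {finite_measure set (lpoint R k * lpoint R k)%type -> \bar R})
    (F : force) : Prop :=
  forall xi, VF xi ->
    force_integral xi F = \int[mu]_(p in Strut) rigidity xi p.

(* K is the distributional derivative of the tangent. *)
Definition is_curvature_force (K : force) : Prop :=
  forall xi, VFsmooth xi -> dLen xi = - force_integral xi K.

Definition opposite_forces (F K : force) : Prop :=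
  forall c B, measurable B -> B `<=` points -> F c B = (- K c B)%E.

End criticality.

(* Main.v *)
(* By Danskin's formula the one-sided derivative of the thickness in the direction
   xi is the minimum of A_S xi over the struts. Hence L is strongly critical iff
   dLen xi <= M * max (0, sup A_S xi) for some M and all smooth xi. If there is a
   balancing measure mu, then dLen xi is the integral of A_S xi, and the bound is
   clear. Conversely, the bound makes A_S xi |-> dLen xi a functional dominated by a
   sublinear one; a Hahn-Banach extension is positive, hence an integral.

   This needs neither weak limits nor the Riesz theorem on compact spaces: a
   positive functional composed with an injective code c into [0, 1] is represented
   by the quantile function of x |-> Lam 1_(c <= x), and the interleaving of binary
   digits is a code of the square with a continuous inverse. The bound |A_S xi| <=
   2 sup |xi| turns the estimate into |dLen xi| <= 2 M sup |xi|, which, tested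
   against trigonometric fields approximating differences of mean values, bounds the
   variation of the slopes of the chords and so the turning of inscribed polygons. *)

From HB Require Import structures.
Require Import Defs.
From mathcomp Require Import all_boot all_order all_algebra.
From mathcomp Require Import all_classical all_reals all_analysis.
From mathcomp Require Import measurable_realfun ring lra.

Set Implicit Arguments.
Unset Strict Implicit.
Unset Printing Implicit Defensive.

Import Order.TTheory GRing.Theory Num.Theory.
Import numFieldNormedType.Exports HBNNSimple.

Local Open Scope classical_set_scope.
Local Open Scope ring_scope.

(** * Lipschitz and periodic functions *)

(** The link is only Lipschitz, so its tangent exists merely almost everywhere. Integrating by parts
    writes [dLen] as minus the integral of [L] against the second derivative of the field: the
    integrands become continuous, linearity is visible, and a bound on [dLen] controls the second
    distributional derivative of each coordinate. The test fields are accordingly second primitives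
    of a kernel.

    The functional is extended to all functions bounded on the struts, not only to continuous ones,
    so that it can be evaluated on indicators of sublevel sets of a discontinuous code. Only the
    inverse of the code has to be continuous, since the quantile formula recovers the functional on
    continuous functions of the code. A decoded quantile need not be a strut; the measure is
    therefore built on all ordered pairs of points of different components and shown afterwards to
    be carried by the struts.

    The curvature force is not constructed from the tangent: it is the negative of the adjoint force
    of [mu], and the balance identity shows that it is the derivative of the tangent. *)

Section null_integral.
Local Open Scope ereal_scope.
Context d (T : measurableType d) (R : realType).
Variable mu : {measure set T -> \bar R}.

Lemma ge0_le_integral_off_null (N : set T) (f g : T -> \bar R) :
  measurable N -> mu N = 0 ->
  (forall x, 0 <= f x) -> (forall x, 0 <= g x) ->
  (forall x, ~ N x -> f x = g x) ->
  \int[mu]_x f x <= \int[mu]_x g x.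
Proof.
move=> mN N0 f0 g0 fg.
rewrite ge0_integralTE//; apply: ge_ereal_sup => _ /= [h hf <-].
rewrite -integralT_nnsfun.
rewrite (ge0_negligible_integral mN measurableT)//; last 2 first.
- by apply/measurable_EFinP.
- by move=> x _; rewrite lee_fin.
have mNC : measurable (~` N) by exact: measurableC.
rewrite setTD integral_mkcond.
rewrite restrict_EFin (mrestrict h mNC).
rewrite integralT_nnsfun ge0_integralTE//; apply: ereal_sup_ubound => /=.
exists (proj_nnsfun h mNC) => //= x.
rewrite mindicE; case: (boolP (x \in _)); rewrite ?inE/= => Nx; last by rewrite mulr0.
by rewrite mulr1 -fg.
Qed.

(* No measurability is needed: the integral only looks at simple minorants,
   and these can be truncated to [0] on [N]. *)
Lemma integral_off_null (N D : set T) (f g : T -> \bar R) :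
  measurable N -> mu N = 0 ->
  (forall x, D x -> ~ N x -> f x = g x) ->
  \int[mu]_(x in D) f x = \int[mu]_(x in D) g x.
Proof.
move=> mN N0 fg.
have fgD x : ~ N x -> (f \_ D) x = (g \_ D) x.
  by move=> Nx; rewrite !patchE; case: ifPn => //; rewrite inE => Dx; exact: fg.
rewrite integral_mkcond [RHS]integral_mkcond integralE [RHS]integralE.
congr (_ - _); apply/eqP; rewrite eq_le; apply/andP; split;
  apply: (ge0_le_integral_off_null mN N0) => // x Nx;
  by rewrite ?funeposE ?funenegE fgD.
Qed.

End null_integral.

Section lipschitz_ftc.
Context {R : realType}.
Notation mu := (@lebesgue_measure R).

Lemma cumulative_of (f : R -> R) (ndf : {homo f : x y / x <= y}) (cf : continuous f) :
  {F : cumulative R R | F = f :> (R -> R)}.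
Proof.
pose m := isCumulative.Build R _ R f ndf (right_continuousW cf).
pose F : cumulative R R := HB.pack f m.
by exists F.
Qed.

Lemma klipschitz_continuous (K : R) (f : R -> R) :
  (forall x y, `|f x - f y| <= K * `|x - y|) -> continuous f.
Proof.
move=> lf x; apply/cvgrPdist_lt => e e0.
near=> y.
apply: (le_lt_trans (lf _ _)).
have K1 : 0 < `|K| + 1 by rewrite ltr_wpDl.
rewrite (@le_lt_trans _ _ ((`|K| + 1) * `|x - y|))//.
  by rewrite ler_wpM2r// (le_trans (ler_norm K))// lerDl.
rewrite -ltr_pdivlMl//; near: y.
by apply: cvgr_dist_lt; rewrite ?mulr_gt0 ?invr_gt0.
Unshelve. all: end_near. Qed.

(* The Stieltjes measures of [K x + f x] and [K x - f x] add up to [2 K] times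
   the Lebesgue measure, so both are absolutely continuous. *)
Lemma lipschitz_stieltjes (K : R) (f : R -> R) :
  (forall x y, `|f x - f y| <= K * `|x - y|) ->
  exists F : cumulative R R, (forall x, F x = K * x + f x) /\
    lebesgue_stieltjes_measure F `<< mu.
Proof.
move=> lf.
have lf1 x y : x <= y -> `|f y - f x| <= K * (y - x).
  by move=> xy; rewrite (le_trans (lf _ _))// ger0_norm ?subr_ge0.
have cf := klipschitz_continuous lf.
have K0 : 0 <= K.
  by have := lf 1 0; rewrite subr0 normr1 mulr1; apply: le_trans.
have nd1 : {homo (fun x => K * x + f x) : x y / x <= y}.
  move=> x y /lf1; rewrite ler_norml => /andP[+ _]; lra.
have nd2 : {homo (fun x => K * x - f x) : x y / x <= y}.
  move=> x y /lf1; rewrite ler_norml => /andP[_]; lra.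
have nd3 : {homo (fun x : R => 2 * K * x) : x y / x <= y}.
  by move=> x y xy; rewrite ler_wpM2l// mulr_ge0.
have cK (c : R) : continuous (fun x : R => c * x).
  by move=> x; apply: cvgMr; exact: cvg_id.
have c1 : continuous (fun x => K * x + f x).
  by move=> x; apply: cvgD; [exact: cK|exact: cf].
have c2 : continuous (fun x => K * x - f x).
  by move=> x; apply: cvgB; [exact: cK|exact: cf].
have [F FE] := cumulative_of nd1 c1.
have [G GE] := cumulative_of nd2 c2.
have [I IE] := cumulative_of nd3 (cK (2 * K)).
exists F; split; first by move=> x; rewrite FE.
have ocE (H : cumulative R R) a b : a <= b ->
    lebesgue_stieltjes_measure H `]a, b] = (H b - H a)%:E.
  move=> ab; rewrite /lebesgue_stieltjes_measure /measure_extension measurable_mu_extE/= ?wlength_itv_bnd//.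
  exact: is_ocitv.
have IFG A : measurable A -> lebesgue_stieltjes_measure I A =
    measure_add (lebesgue_stieltjes_measure F) (lebesgue_stieltjes_measure G) A.
  apply: lebesgue_stieltjes_measure_unique => X /ocitvP[->|[[a b] ab ->]].
    by rewrite !measure0.
  rewrite /= in ab; rewrite [RHS]measure_addE /= !ocE ?ltW// -EFinD FE GE IE; congr (_%:E); ring.
have Kn : 0 <= 2 * K by rewrite mulr_ge0.
have IL A : measurable A -> lebesgue_stieltjes_measure I A =
    mscale (NngNum Kn) mu A.
  apply: lebesgue_stieltjes_measure_unique => X /ocitvP[->|[[a b] ab ->]].
    by rewrite !measure0.
  rewrite /= in ab; rewrite [RHS](_ : _ = (2 * K)%:E * mu `]a, b])%E//.
  rewrite /lebesgue_measure !ocE ?ltW// -EFinM IE; congr (_%:E).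
  by rewrite mulrBr.
apply/null_content_dominatesP => A mA A0.
have : lebesgue_stieltjes_measure I A = 0%E.
  by rewrite IL// [LHS](_ : _ = (2 * K)%:E * mu A)%E// A0 mule0.
rewrite IFG// measure_addE => /eqP.
by rewrite padde_eq0// => /andP[/eqP].
Qed.

End lipschitz_ftc.

Section lipschitz_derivative.
Context {R : realType}.
Notation mu := (@lebesgue_measure R).

(** Rademacher's theorem on the line: the Stieltjes measure of [K * x + f x] has a Radon-Nikodym
    density, whose primitive is differentiable almost everywhere by Lebesgue's theorem; subtracting
    [K] gives [phi]. The explicit null set [N] allows pointwise work outside it. *)
Lemma lipschitz_density (K : R) (f : R -> R) (a b : R) : a < b ->
  (forall x y, `|f x - f y| <= K * `|x - y|) ->
  exists phi : R -> R, exists N : set R,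
    [/\ measurable N, mu N = 0%E, mu.-integrable `[a, b] (EFin \o phi),
        forall x, a < x < b -> ~ N x -> is_derive x 1 f (phi x) &
        \int[mu]_(x in `[a, b]) phi x = f b - f a].
Proof.
move=> ab lf; have [F [FE Fmu]] := lipschitz_stieltjes lf.
have SE x y : x <= y ->
    lebesgue_stieltjes_measure F `]x, y]%classic = (F y - F x)%:E.
  move=> xy; rewrite /lebesgue_stieltjes_measure /measure_extension.
  by rewrite measurable_mu_extE/= ?wlength_itv_bnd//; exact: is_ocitv.
have mD : measurable (`]a, b]%classic : set (measurableTypeR R)).
  exact: measurable_itv.
have moo : (lebesgue_stieltjes_measure F `]a, b]%classic < +oo)%E.
  by rewrite SE ?ltry// ltW.
(* Cutting the measure down to []a, b]] makes it finite, so that the density is integrable on the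
   whole line. *)
pose nu := mfrestr mD moo.
have numu : nu `<< mu.
  apply/null_content_dominatesP => A mA A0.
  move/null_content_dominatesP : Fmu => /(_ (A `&` `]a, b]%classic)).
  rewrite /nu/= /mfrestr /mrestr; apply; first exact: measurableI.
  by apply: (subset_measure0 _ _ _ A0) => //; exact: measurableI.
have [g [g0 gfin gi gE]] := radon_nikodym_sigma_finite numu.
pose h := fine \o g.
have hg : EFin \o h = g by apply/funext => x /=; rewrite fineK.
have hi : mu.-integrable setT (EFin \o h) by rewrite hg.
have hiS (A : set R) : measurable A -> mu.-integrable A (EFin \o h).
  by move=> mA; apply: integrableS hi.
have hE x : a <= x <= b -> \int[mu]_(t in `]a, x]) h t = F x - F a.
  move=> /andP[ax xb]; rewrite /Rintegral.
  have : nu `]a, x]%classic = (F x - F a)%:E.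
    rewrite /nu/= /mfrestr /mrestr -SE//; congr (_ _).
    by apply: setIidl; apply: subset_itvl; rewrite bnd_simp.
  move=> nuE; have := gE _ (measurable_itv `]a, x]); rewrite -hg => <-.
  by rewrite [X in fine X]nuE.
have hloc : locally_integrable setT h.
  by apply: (@open_integrable_locally R setT h) => //; exact: openT.
have := @FTC1 R h (BRight a) (fun y => hiS _ (measurable_itv _)) hloc.
move=> [N [mN N0 Nsub]].
have Ki : mu.-integrable `[a, b] (EFin \o cst K).
  apply: continuous_compact_integrable; first exact: segment_compact.
  by apply: continuous_subspaceT => x; exact: cst_continuous.
exists (fun x => h x - K), N; split=> //.
- rewrite (_ : EFin \o _ = (EFin \o h) \- (EFin \o cst K))%E; last first.
    by apply/funext => x /=; rewrite EFinB.
  by apply: integrableB => //; exact: hiS.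
- move=> x /andP[ax xb] Nx.
  have [dG G'] : derivable (fun y => \int[mu]_(t in `]a, y]) h t) x 1 /\
      derive1 (fun y => \int[mu]_(t in `]a, y]) h t) x = h x.
    apply: contrapT => H; apply: Nx; apply: Nsub => /= H'.
    by apply: H; apply: H'; rewrite lte_fin.
  have dG0 : is_derive x 1 (fun y => \int[mu]_(t in `]a, y]) h t) (h x).
    by rewrite -G' derive1E; exact: DeriveDef.
  have dG1 : is_derive x 1
      (fun y => \int[mu]_(t in `]a, y]) h t - K * y + F a) (h x - K).
    apply: is_derive_eq.
    by rewrite /GRing.scale/= mulr1 addr0.
  apply: near_eq_is_derive dG1.
  near=> y; rewrite hE ?FE; first ring.
  apply/andP; split; apply/ltW; near: y; [exact: lt_nbhsr|exact: lt_nbhsl].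
- rewrite RintegralB//; last exact: hiS.
  rewrite -Rintegral_itv_obnd_cbnd ?hE ?lexx ?ltW//; last exact: hiS.
  rewrite Rintegral_cst//= lebesgue_measure_itv/= lte_fin ab/= !FE; ring.
Unshelve. all: end_near. Qed.

End lipschitz_derivative.

Section periodic_functions.
Context {R : realType}.
Implicit Types (l x : R).

Definition rmod l x : R := x - l * (Num.floor (x / l))%:~R.

Lemma rmod_itv l x : 0 < l -> 0 <= rmod l x < l.
Proof.
move=> l0; have /andP[h1 h2] := floor_itv (x / l).
rewrite /rmod subr_ge0 mulrC -ler_pdivlMr// h1/= ltrBlDl.
by rewrite -[X in _ + X]mul1r -mulrDl -ltr_pdivrMr//; move: h2; rewrite intrD.
Qed.

Lemma periodicz (U : zmodType) (f : R -> U) l (z : int) x :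
  periodic f l -> f (x + l * z%:~R) = f x.
Proof.
move=> pf; case: z => n.
  by rewrite -pmulrn mulr_natr periodicn.
rewrite NegzE mulrNz mulrN -pmulrn mulr_natr.
by rewrite -[in RHS](subrK (l *+ n.+1) x) periodicn.
Qed.

Lemma periodic_rmod (U : zmodType) (f : R -> U) l x :
  periodic f l -> f (rmod l x) = f x.
Proof. by move=> pf; rewrite /rmod -mulrN -mulrNz periodicz. Qed.

Lemma periodic_bounded l (f : R -> R) : 0 < l -> continuous f -> periodic f l ->
  exists2 B, 0 < B & forall x, `|f x| <= B.
Proof.
move=> l0 cf pf.
have cn : {within `[0, l], continuous (fun x => `|f x|)}.
  apply: continuous_subspaceT => x.
  by apply: continuous_comp; [exact: cf|exact: norm_continuous].
have [c _ cmax] := EVT_max (ltW l0) cn.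
exists (`|f c| + 1); first by rewrite ltr_wpDl.
move=> x; rewrite -(periodic_rmod x pf) (@le_trans _ _ `|f c|) ?lerDl//.
have /andP[h1 h2] := rmod_itv x l0.
by apply: cmax; rewrite in_itv/= h1 ltW.
Qed.

Lemma bounded_derive_lipschitz (B : R) (f df : R -> R) :
  (forall x, is_derive x 1 f (df x)) -> (forall x, `|df x| <= B) ->
  forall x y, `|f x - f y| <= B * `|x - y|.
Proof.
move=> fdf dfB x y; wlog xy : x y / y <= x.
  by move=> H; case: (leP y x) => [/H//|/ltW/H]; rewrite distrC [`|x - y|]distrC.
have cf : continuous f.
  by move=> z; apply: differentiable_continuous; apply/derivable1_diffP; case: (fdf z).
have [c _ ->] := MVT_segment xy (fun z _ => fdf z) (continuous_subspaceT cf).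
by rewrite normrM ler_wpM2r.
Qed.

Lemma continuous_itv_integrable (f : R -> R) (a b : R) : continuous f ->
  (@lebesgue_measure R).-integrable `[a, b] (EFin \o f).
Proof.
move=> cf; apply: continuous_compact_integrable; first exact: segment_compact.
exact: continuous_subspaceT.
Qed.

Lemma integrable_mul_continuous (f g : R -> R) (a b : R) :
  (@lebesgue_measure R).-integrable `[a, b] (EFin \o f) -> continuous g ->
  (@lebesgue_measure R).-integrable `[a, b] (EFin \o (fun x => f x * g x)).
Proof.
move=> fi cg.
have mg : measurable_fun `[a, b] g.
  by apply: measurable_funTS; exact: continuous_measurable_fun.
have bg : [bounded g x | x in `[a, b]].
  have [ab|ba] := leP a b; last first.
    by rewrite set_itv_ge ?bnd_simp -?ltNge//; exists 0; split => // M _ x [].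
  have cn : {within `[a, b], continuous (fun x => `|g x|)}.
    apply: continuous_subspaceT => x.
    by apply: continuous_comp; [exact: cg|exact: norm_continuous].
  have [c _ cmax] := EVT_max ab cn.
  exists `|g c|; split; first exact: num_real.
  by move=> M /ltW cM x /= xab; rewrite (le_trans _ cM)// cmax.
have := @integrableMr _ (measurableTypeR R) R (@lebesgue_measure R) `[a, b] (measurable_itv _) g _ mg bg fi.
by apply: eq_integrable => // x _ /=; rewrite EFinM muleC.
Qed.

End periodic_functions.

Section periodic_parts.
Context {R : realType}.
Notation mu := (@lebesgue_measure R).

(** The product [f * psi] is Lipschitz, so the integral of its derivative over a period is the
    difference of its end values, which vanishes by periodicity. *)
Lemma periodic_lipschitz_parts (l K : R) (f : R -> R) : 0 < l ->
  (forall x y, `|f x - f y| <= K * `|x - y|) -> periodic f l ->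
  exists phi : R -> R, exists N : set R,
    [/\ measurable N, mu N = 0%E, mu.-integrable `[0, l] (EFin \o phi),
        forall x, 0 < x < l -> ~ N x -> is_derive x 1 f (phi x) &
        forall psi dpsi : R -> R, (forall x : R, is_derive x 1 psi (dpsi x)) ->
          continuous dpsi -> periodic psi l -> periodic dpsi l ->
          \int[mu]_(x in `[0, l]) (phi x * psi x) =
          - \int[mu]_(x in `[0, l]) (f x * dpsi x)].
Proof.
move=> l0 lf pf; have [phi [N [mN N0 phii fphi _]]] := lipschitz_density l0 lf.
exists phi, N; split => // psi dpsi psiE cdpsi ppsi pdpsi.
have cf := klipschitz_continuous lf.
have cpsi : continuous psi.
  by move=> z; apply: differentiable_continuous; apply/derivable1_diffP; case: (psiE z).
have [B B0 fB] := periodic_bounded l0 cf pf.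
have [C C0 psiC] := periodic_bounded l0 cpsi ppsi.
have [D D0 dpsiD] := periodic_bounded l0 cdpsi pdpsi.
have lpsi := bounded_derive_lipschitz psiE dpsiD.
have lg x y : `|f x * psi x - f y * psi y| <= (B * D + C * K) * `|x - y|.
  rewrite (_ : _ - _ = f x * (psi x - psi y) + psi y * (f x - f y)); last by ring.
  rewrite (le_trans (ler_normD _ _))// !normrM mulrDl -!mulrA.
  by rewrite lerD// ler_pM.
have [phi2 [N2 [mN2 N20 phi2i gphi2]]] := lipschitz_density l0 lg.
rewrite -[X in f X * psi X - _](add0r l) pf ppsi subrr => int0.
have i1 := integrable_mul_continuous phii cpsi.
have i2 : mu.-integrable `[0, l] (EFin \o (fun x => f x * dpsi x)).
  apply: continuous_itv_integrable => x.
  by apply: cvgM; [exact: cf|exact: cdpsi].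
apply/eqP; rewrite -subr_eq0 opprK -RintegralD//; apply/eqP.
rewrite -[RHS]int0; congr fine.
have m01 : measurable [set 0 : R] by [].
have ml1 : measurable [set l : R] by [].
(* The derivatives are known in the open interval only, hence the two end points in the exceptional
   set. *)
apply: (@integral_off_null _ _ _ mu (N `|` N2 `|` [set 0] `|` [set l])).
- by do 3?apply: measurableU.
- have mU := measurableU _ _ mN mN2.
  rewrite measureU0//; [|exact: measurableU|exact: lebesgue_measure_set1].
  rewrite measureU0//; last exact: lebesgue_measure_set1.
  by rewrite measureU0.
move=> x /=; rewrite in_itv/= => /andP[x0 xl] /not_orP[/not_orP[/not_orP[Nx N2x] x0'] xl'].
have xI : 0 < x < l.
  by rewrite !lt_neqAle x0 xl !andbT; apply/andP; split; apply/eqP => // /esym.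
have d1 := fphi _ xI Nx; have d2 := gphi2 _ xI N2x.
have d3 : is_derive x 1 (fun y => f y * psi y) (f x *: dpsi x + psi x *: phi x).
  exact: is_deriveM.
congr (_%:E); rewrite -(@derive_val _ _ _ _ _ _ _ d2) (@derive_val _ _ _ _ _ _ _ d3).
by rewrite /GRing.scale/= addrC (mulrC (psi x)).
Qed.

End periodic_parts.

(** * Trigonometric kernels *)

Section harmonic_sums.
Context {R : realType}.
Implicit Types (w l x t : R).

(** Triples of amplitude, frequency and phase. Free phases make the class stable under translation
    and differentiation, so that the fields built from it are smooth; periodicity is recorded
    separately. *)
Definition trig_sum (s : seq (R * R * R)) t : R :=
  \sum_(p <- s) p.1.1 * cos (p.1.2 * t + p.2).

Definition harmonic_sum w (s : seq (nat * R)) t : R :=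
  \sum_(p <- s) p.2 * cos (p.1%:R * w * t).

(** Product-to-sum formulas: multiplication by [(1 + cos (w * t)) / 2] keeps half of each harmonic
    and sends a quarter to either neighbour. *)
Lemma harmonic_sum_pow w n : exists s, forall t,
  ((1 + cos (w * t)) / 2) ^+ n = harmonic_sum w s t.
Proof.
elim: n => [|n [s sE]].
  exists [:: (0%N, 1)] => t.
  by rewrite /harmonic_sum big_seq1 expr0 /= !mul0r cos0 mulr1.
(* The lower neighbour of the harmonic 0 is -1, which the evenness of the cosine identifies with
   1. *)
exists (flatten [seq [:: (p.1, p.2 / 2); (p.1.+1, p.2 / 4);
  (if p.1 is k.+1 then k else 1%N, p.2 / 4)] | p <- s]) => t.
rewrite exprS sE /harmonic_sum big_flatten/= big_map mulr_sumr.
apply: eq_bigr => -[k a] _ /=; rewrite !big_cons big_nil /=.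
have -> : cos (k.+1%:R * w * t) = cos (k%:R * w * t + w * t).
  by congr cos; rewrite -natr1; ring.
have -> : cos ((if k is k'.+1 then k' else 1%N)%:R * w * t) =
    cos (k%:R * w * t - w * t).
  case: k => [|k]; first by rewrite !mul0r sub0r cosN mul1r.
  by congr cos; rewrite -natr1; ring.
by rewrite cosD cosB; field.
Qed.

Lemma is_derive1_ext (f g : R -> R) x df df' : (forall t, f t = g t) ->
  df = df' -> is_derive x 1 g df' -> is_derive x 1 f df.
Proof. by move=> /funext -> ->. Qed.

Lemma is_derive_cos_affine (c a b x : R) :
  is_derive x 1 (fun t => c * cos (a * t + b)) (- (c * a) * sin (a * x + b)).
Proof.
have h : is_derive x 1 (fun t => a * t + b) a.
  by apply: is_derive_eq; rewrite /GRing.scale/= mulr1 addr0.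
have := is_derive1_comp (f := cos) (g := fun t => a * t + b) (x := x).
move=> /(_ _ _ (is_derive_cos _) h) h2.
apply: is_derive_eq; rewrite /GRing.scale/=; ring.
Qed.

Lemma is_derive_sin_affine (c a b x : R) :
  is_derive x 1 (fun t => c * sin (a * t + b)) (c * a * cos (a * x + b)).
Proof.
have h : is_derive x 1 (fun t => a * t + b) a.
  by apply: is_derive_eq; rewrite /GRing.scale/= mulr1 addr0.
have := is_derive1_comp (f := sin) (g := fun t => a * t + b) (x := x).
move=> /(_ _ _ (is_derive_sin _) h) h2.
apply: is_derive_eq; rewrite /GRing.scale/=; ring.
Qed.

(** Only the constant harmonics, of total coefficient [a], integrate to something non periodic:
    [a * t], then [a * t ^+ 2 / 2]. The other primitives keep the period [l] because [k * w * l] is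
    a multiple of [2 * pi]. *)
Lemma harmonic_sum_primitives w l (s : seq (nat * R)) : w != 0 -> w * l = pi *+ 2 ->
  exists a : R, exists G : R -> R, exists q,
  [/\ periodic G l, periodic (trig_sum q) l,
      forall x, is_derive x 1 (fun t => a * t + G t) (harmonic_sum w s x) &
      forall x, is_derive x 1 (fun t => a * t ^+ 2 / 2 + trig_sum q t) (a * x + G x)].
Proof.
move=> w0 wl; elim: s => [|[k c] s [a [G [q [pG pq dG dq]]]]].
  exists 0, (fun=> 0), [::]; split => //.
  - by move=> x; rewrite /trig_sum !big_nil.
  - move=> x; apply: (is_derive1_ext (g := cst 0) (df' := 0)).
    + by move=> t; rewrite mul0r addr0.
    + by rewrite /harmonic_sum big_nil.
  - move=> x; apply: (is_derive1_ext (g := cst 0) (df' := 0)).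
    + by move=> t; rewrite !mul0r add0r /trig_sum big_nil.
    + by rewrite mul0r addr0.
have hE x : harmonic_sum w ((k, c) :: s) x = c * cos (k%:R * w * x) + harmonic_sum w s x.
  by rewrite /harmonic_sum big_cons.
have [k0|k0] := eqVneq k 0%N.
  exists (a + c), G, q; split => // x.
  - have dx := dG x.
    apply: (is_derive1_ext (g := fun t => c * t + (a * t + G t))).
    + by move=> t; ring.
    + by rewrite hE k0 !mul0r cos0 mulr1 /GRing.scale/= mulr1.
  - have dx := dq x.
    apply: (is_derive1_ext (g := fun t => c / 2 * (t ^+ 2) +
      (a * t ^+ 2 / 2 + trig_sum q t))).
    + by move=> t; field.
    + by rewrite /GRing.scale/=; field.
have kw : k%:R * w != 0 by rewrite mulf_neq0// pnatr_eq0.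
have kl : k%:R * w * l = pi *+ 2 *+ k by rewrite -mulrA wl mulr_natl.
exists a, (fun t => c / (k%:R * w) * sin (k%:R * w * t + 0) + G t),
  ((- c / (k%:R * w) ^+ 2, k%:R * w, 0) :: q); split => [x|x|x|x].
- by rewrite pG !addr0 mulrDr kl (periodicn (@sinD2pi R)).
- move: (pq x); rewrite /trig_sum !big_cons/= => ->.
  by rewrite !addr0 mulrDr kl (periodicn (@cosD2pi R)).
- have dx := dG x; have ds := is_derive_sin_affine (c / (k%:R * w)) (k%:R * w) 0 x.
  apply: (is_derive1_ext (g := fun t => c / (k%:R * w) *
    sin (k%:R * w * t + 0) + (a * t + G t))).
  + by move=> t; ring.
  + by rewrite hE addr0 divfK.
- have dx := dq x.
  have ds := is_derive_cos_affine (- c / (k%:R * w) ^+ 2) (k%:R * w) 0 x.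
  apply: (is_derive1_ext (g := fun t => - c / (k%:R * w) ^+ 2 *
    cos (k%:R * w * t + 0) + (a * t ^+ 2 / 2 + trig_sum q t))).
  + by move=> t; rewrite /trig_sum big_cons/=; ring.
  + by field; rewrite pnatr_eq0 k0 w0.
Qed.

End harmonic_sums.

Section approximate_identity.
Context {R : realType}.
Implicit Types (l x t : R).

(* [K] is the normalised power [((1 + cos (2 pi x / l)) / 2) ^+ n], [G] and [P]
   are its first two primitives; the non periodic part of [P] is explicit. *)
Lemma periodic_kernel l (d e : R) : 0 < l -> 0 < d -> d <= l / 2 -> 0 < e ->
  exists K G : R -> R, exists s : seq (R * R * R),
  [/\ [/\ forall x, 0 <= K x, continuous K & periodic K l],
      forall x, G (x + l) = G x + 1, periodic (trig_sum s) l,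
      (forall x, is_derive x 1 G (K x)) /\
      (forall x, is_derive x 1 (fun t => t ^+ 2 / (2 * l) + trig_sum s t) (G x)) &
      forall x, d <= `|x| <= l / 2 -> K x <= e].
Proof.
move=> l0 d0 dl e0; have ln0 : l != 0 by rewrite gt_eqF.
pose w : R := pi *+ 2 / l.
have pi0 := pi_gt0 R.
have w0 : 0 < w by rewrite divr_gt0// mulrn_wgt0.
have wl : w * l = pi *+ 2 by rewrite divfK.
pose b x : R := (1 + cos (w * x)) / 2.
have b0 x : 0 <= b x by rewrite divr_ge0// -lerBlDl sub0r cos_geN1.
have b1 x : b x <= 1 by have := cos_le1 (w * x); rewrite /b; lra.
have bnd x y : 0 <= x -> x < y -> y <= l / 2 -> b y < b x.
  move=> x0 xy yl; rewrite ltr_pM2r ?invr_gt0// ltrD2l.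
  have wI z : 0 <= z <= l / 2 -> w * z \in `[0, pi].
    move=> /andP[z0 zl]; rewrite in_itv/= mulr_ge0 ?(ltW w0)//=.
    by rewrite (le_trans (ler_wpM2l (ltW w0) zl))// mulrA wl; lra.
  by rewrite ltr_cos ?ltr_pM2l// wI//; lra.
have bN x : b (- x) = b x by rewrite /b mulrN cosN.
(* The power [n] separates the values at [d] and [d / 2]: since the mass is at least
   [b (d / 2) ^+ n * (d / 2)], the normalized kernel is at most [r ^+ n / (d / 2)] beyond [d]. *)
pose r := b d / b (d / 2).
have bd2 : 0 < b (d / 2).
  by rewrite (le_lt_trans (b0 d))// bnd//; lra.
have r01 : 0 <= r < 1.
  by rewrite divr_ge0//= ltr_pdivrMr// mul1r bnd//; lra.
have [n rn] : exists n, r ^+ n <= e * (d / 2).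
  have : r ^+ n @[n --> \oo] --> 0 by apply: cvg_expr; rewrite ger0_norm; case/andP: r01.
  move=> /cvgrPdist_le /(_ (e * (d / 2))) H.
  have [|N _ /(_ N (leqnn N))] := H; first by rewrite !mulr_gt0 ?invr_gt0.
  by rewrite /= sub0r normrN => h; exists N; rewrite (le_trans (ler_norm _)).
have [s sE] := harmonic_sum_pow w n.
have [a [G [q [pG pq dG dq]]]] := harmonic_sum_primitives s (lt0r_neq0 w0) wl.
have bc : continuous b.
  move=> x; apply: cvgMl; apply: cvgD; first exact: cvg_cst.
  by apply: continuous_comp; [apply: cvgMr; exact: cvg_id|exact: continuous_cos].
have bnc : continuous (fun x => b x ^+ n).
  by move=> x; exact: (continuous_comp (bc x) (@exprn_continuous R n (b x))).
have dH x : is_derive x 1 (fun t => a * t + G t) (b x ^+ n) by rewrite /b sE.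
have cH : continuous (fun t => a * t + G t).
  move=> z; apply: differentiable_continuous; apply/derivable1_diffP.
  by case: (dH z).
have H0l : (a * l + G l) - (a * 0 + G 0) = a * l.
  by rewrite -[in G l](add0r l) pG; ring.
have Hnd x y : x <= y -> a * x + G x <= a * y + G y.
  move=> xy; rewrite -subr_ge0.
  have [c _ ->] := MVT_segment xy (fun z _ => dH z) (continuous_subspaceT cH).
  by rewrite mulr_ge0 ?exprn_ge0 ?subr_ge0.
(* [a * l] is the integral of the power over a period; the part over [[0, d / 2]] bounds it from
   below. *)
have al : b (d / 2) ^+ n * (d / 2) <= a * l.
  have d20 : 0 <= d / 2 by lra.
  have [c cI cE] := MVT_segment d20 (fun z _ => dH z) (continuous_subspaceT cH).
  have c2 : b (d / 2) ^+ n <= b c ^+ n.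
    rewrite lerXn2r ?nnegrE//; move: cI; rewrite in_itv/= => /andP[c0].
    by rewrite le_eqVlt => /predU1P[->//|cd]; rewrite ltW// bnd//; lra.
  rewrite -H0l (@le_trans _ _ (b c ^+ n * (d / 2)))//.
    by rewrite ler_wpM2r.
  rewrite -[in leLHS](subr0 (d / 2)) -cE lerD2r Hnd//; lra.
have al0 : 0 < a * l.
  by rewrite (lt_le_trans _ al)// mulr_gt0 ?exprn_gt0// divr_gt0.
have a0 : a != 0 by apply: contraTneq al0 => ->; rewrite mul0r ltxx.
exists (fun x => b x ^+ n / (a * l)), (fun x => (a * x + G x) / (a * l)),
  [seq (p.1.1 / (a * l), p.1.2, p.2) | p <- q].
have tE t : trig_sum [seq (p.1.1 / (a * l), p.1.2, p.2) | p <- q] t =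
    trig_sum q t / (a * l).
  by rewrite /trig_sum big_map mulr_suml; apply: eq_bigr => p _ /=; ring.
split.
- split => [x|x|x].
  + by rewrite divr_ge0 ?exprn_ge0// ltW.
  + by apply: cvgMl; exact: bnc.
  + by rewrite /b mulrDr wl cosD2pi.
- by move=> x; rewrite pG; field; rewrite ln0 a0.
- by move=> x; rewrite !tE pq.
- split => x.
  + have dx := dH x.
    apply: (is_derive1_ext (g := fun t => (a * l)^-1 * (a * t + G t))).
      by move=> t; rewrite mulrC.
    by rewrite /GRing.scale/= mulrC.
  + have dx := dq x.
    apply: (is_derive1_ext (g := fun t => (a * l)^-1 * (a * t ^+ 2 / 2 + trig_sum q t))).
      by move=> t; rewrite tE; field; rewrite ln0 a0.
    by rewrite /GRing.scale/= mulrC.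
- move=> x /andP[dx xl].
  have bx : b x <= b d.
    have -> : b x = b `|x| by case: (ger0P x) => // _; rewrite bN.
    by move: dx; rewrite le_eqVlt => /predU1P[->//|dx]; rewrite ltW// bnd// ltW.
  rewrite ler_pdivrMr// (le_trans _ (ler_wpM2l (ltW e0) al))//.
  rewrite (@le_trans _ _ (b d ^+ n))// ?lerXn2r ?nnegrE//.
  rewrite mulrCA -ler_pdivrMl ?exprn_gt0// mulrC -exprVn -exprMn.
  exact: rn.
Qed.

End approximate_identity.

(** * Slopes of chords *)

Section discrete_variation.
Context {R : realType}.
Notation mu := (@lebesgue_measure R).
Implicit Types (l x y t : R).

Definition is_trig (f : R -> R) := exists s, forall t, f t = trig_sum s t.

Lemma is_trig_cst (c : R) : is_trig (fun=> c).
Proof.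
exists [:: (c, 0, 0)] => t.
by rewrite /trig_sum big_seq1/= mul0r addr0 cos0 mulr1.
Qed.

Lemma is_trigD (f g : R -> R) : is_trig f -> is_trig g -> is_trig (fun t => f t + g t).
Proof. by move=> [s sE] [q qE]; exists (s ++ q) => t; rewrite /trig_sum big_cat/= sE qE. Qed.

Lemma is_trigZ (c : R) (f : R -> R) : is_trig f -> is_trig (fun t => c * f t).
Proof.
move=> [s sE]; exists [seq (c * p.1.1, p.1.2, p.2) | p <- s] => t.
by rewrite sE /trig_sum big_map mulr_sumr; apply: eq_bigr => p _; rewrite mulrA.
Qed.

Lemma is_trig_shift x (f : R -> R) : is_trig f -> is_trig (fun t => f (t - x)).
Proof.
move=> [s sE]; exists [seq (p.1.1, p.1.2, p.2 - p.1.2 * x) | p <- s] => t.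
rewrite sE /trig_sum big_map; apply: eq_bigr => p _ /=.
by congr (_ * cos _); ring.
Qed.

Lemma is_trig_sum (I : Type) (r : seq I) (f : I -> R -> R) :
  (forall i, is_trig (f i)) -> is_trig (fun t => \sum_(i <- r) f i t).
Proof.
move=> fT; elim: r => [|i r ih].
  by have [s sE] := is_trig_cst 0; exists s => t; rewrite big_nil -sE.
by have [s sE] := is_trigD (fT i) ih; exists s => t; rewrite big_cons -sE.
Qed.

Lemma is_derive_shift (f : R -> R) df x t :
  is_derive (t - x) 1 f df -> is_derive t 1 (fun t => f (t - x)) df.
Proof.
move=> dfx.
have h : is_derive t 1 (fun t => t - x) 1.
  by apply: is_derive_eq; rewrite subr0.
have := is_derive1_comp (f := f) (g := fun t => t - x) (x := t).
move=> /(_ _ _ dfx h) h2.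
by rewrite mulr1 in h2.
Qed.

Lemma is_derive_bigsum (I : Type) (r : seq I) (f : I -> R -> R) (df : I -> R) x :
  (forall i, is_derive x 1 (f i) (df i)) ->
  is_derive x 1 (fun t => \sum_(i <- r) f i t) (\sum_(i <- r) df i).
Proof.
move=> fd; elim: r => [|i r ih].
  rewrite big_nil; apply: (is_derive1_ext (g := cst 0)) => // t.
  by rewrite big_nil.
rewrite big_cons; have di := fd i.
apply: (is_derive1_ext (g := fun t => f i t + \sum_(i <- r) f i t)) => // t.
by rewrite big_cons.
Qed.

(** Within distance [d] the Lipschitz bound applies and the kernel has mass 1, which gives [d];
    farther away [f] varies by at most [l / 2] and the kernel is at most [e], which over a period
    contributes at most [l ^+ 2 * e]. *)
Lemma periodic_kernel_approx l (d e : R) (K G f : R -> R) : 0 < l -> 0 < d -> 0 < e ->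
  (forall x, 0 <= K x) -> continuous K -> periodic K l ->
  (forall x, G (x + l) = G x + 1) -> (forall x, is_derive x 1 G (K x)) ->
  (forall x, d <= `|x| <= l / 2 -> K x <= e) ->
  (forall x y, `|f x - f y| <= `|x - y|) -> periodic f l ->
  forall x, `|\int[mu]_(t in `[0, l]) (f t * K (t - x)) - f x| <= d + l ^+ 2 * e.
Proof.
move=> l0 d0 e0 K0 cK pK Gl dG Ke lf pf x.
have cf : continuous f.
  by apply: (klipschitz_continuous (K := 1)) => ? ?; rewrite mul1r.
have cKx : continuous (fun t => K (t - x)).
  move=> t; apply: continuous_comp; last exact: cK.
  by apply: cvgB; [exact: cvg_id|exact: cvg_cst].
have dGx t : is_derive t 1 (fun t => G (t - x)) (K (t - x)) by exact: is_derive_shift.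
have cGx : continuous (fun t => G (t - x)).
  move=> z; apply: differentiable_continuous; apply/derivable1_diffP.
  by case: (dGx z).
have iK := continuous_itv_integrable 0 l cKx.
have intK : \int[mu]_(t in `[0, l]) K (t - x) = 1.
  rewrite /Rintegral (@continuous_FTC2 _ _ (fun t => G (t - x)) _ _ l0).
  - by rewrite -EFinB/= -[l - x](addrC) Gl sub0r addrC addKr.
  - exact: continuous_subspaceT.
  - split.
    + by move=> t _; case: (dGx t).
    + exact: cvg_at_right_filter (cGx 0).
    + exact: cvg_at_left_filter (cGx l).
  - by move=> t _; rewrite derive1E; exact: (@derive_val _ _ _ _ _ _ _ (dGx t)).
have cfK : continuous (fun t => f t * K (t - x)).
  by move=> t; apply: cvgM; [exact: cf|exact: cKx].
have iK2 (c : R) : mu.-integrable `[0, l] (EFin \o (fun t => c * K (t - x))).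
  by apply: continuous_itv_integrable => t; apply: cvgM; [exact: cvg_cst|exact: cKx].
have -> : \int[mu]_(t in `[0, l]) (f t * K (t - x)) - f x =
    \int[mu]_(t in `[0, l]) (f t * K (t - x) - f x * K (t - x)).
  rewrite RintegralB//; last exact: continuous_itv_integrable.
  by rewrite RintegralZl// intK mulr1.
have ib : mu.-integrable `[0, l] (EFin \o (fun t => d * K (t - x) + l * e)).
  apply: continuous_itv_integrable => t.
  by apply: cvgD; [apply: cvgM; [exact: cvg_cst|exact: cKx]|exact: cvg_cst].
have id : mu.-integrable `[0, l] (EFin \o (fun t => f t * K (t - x) - f x * K (t - x))).
  apply: continuous_itv_integrable => t.
  by apply: cvgB; [exact: cfK|apply: cvgM; [exact: cvg_cst|exact: cKx]].
rewrite (le_trans (le_normr_Rintegral _ id))//.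
rewrite (@le_trans _ _ (\int[mu]_(t in `[0, l]) (d * K (t - x) + l * e)))//; last first.
  rewrite RintegralD//; last first.
    by apply: continuous_itv_integrable => t; exact: cvg_cst.
  rewrite RintegralZl// intK mulr1 Rintegral_cst//= lebesgue_measure_itv/=.
  by rewrite lte_fin l0/= subr0 lerD2l; rewrite expr2 mulrAC.
apply: le_Rintegral => //; first exact: (integrable_norm id).
move=> t _; rewrite -mulrBl normrM (ger0_norm (K0 _)).
(* The representative of [t - x] in [[-l / 2, l / 2[], where the distance on the circle is the
   absolute value. *)
pose y := rmod l (t - x + l / 2) - l / 2.
have yl : `|y| <= l / 2.
  have /andP[h1 h2] := rmod_itv (t - x + l / 2) l0.
  rewrite ler_norml /y; lra.
have yE : y = t - x + l * (- Num.floor ((t - x + l / 2) / l))%:~R.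
  by rewrite /y /rmod mulrNz; ring.
have -> : K (t - x) = K y by rewrite yE periodicz.
have -> : f t = f (x + y).
  by rewrite (_ : x + y = t + l * (- Num.floor ((t - x + l / 2) / l))%:~R) ?periodicz// yE; ring.
have fy : `|f (x + y) - f x| <= `|y| by rewrite (le_trans (lf _ _))// addrAC subrr add0r.
have [yd|dy] := ltP `|y| d.
  rewrite (@le_trans _ _ (d * K y))//; last by rewrite lerDl mulr_ge0// ltW.
  by rewrite ler_wpM2r// (le_trans fy)// ltW.
rewrite (@le_trans _ _ (l * e))//; last by rewrite lerDr mulr_ge0// ltW.
rewrite ler_pM// ?Ke ?dy//.
by rewrite (le_trans fy)// (le_trans yl)//; lra.
Qed.

End discrete_variation.

Section discrete_variation_bound.
Context {R : realType}.
Notation mu := (@lebesgue_measure R).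
Implicit Types (l x y t : R).

Lemma continuous_bigsum (I : Type) (r : seq I) (h : I -> R -> R) :
  (forall i, continuous (h i)) -> continuous (fun t => \sum_(i <- r) h i t).
Proof.
move=> ch; elim: r => [|i r ih] t.
  rewrite (_ : (fun _ => _) = cst 0); first exact: cvg_cst.
  by apply/funext => z; rewrite big_nil.
rewrite (_ : (fun _ => _) = (fun t => h i t + \sum_(i <- r) h i t)).
  by apply: cvgD; [exact: ch|exact: ih].
by apply/funext => z; rewrite big_cons.
Qed.

Lemma Rintegral_itv_bigsum (I : Type) (r : seq I) (h : I -> R -> R) (a b : R) :
  (forall i, continuous (h i)) ->
  \int[mu]_(t in `[a, b]) (\sum_(i <- r) h i t) =
  \sum_(i <- r) \int[mu]_(t in `[a, b]) h i t.
Proof.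
move=> ch; elim: r => [|i r ih].
  rewrite big_nil (@eq_Rintegral _ _ _ mu _ (cst 0)).
    by rewrite Rintegral_cst//= mul0r.
  by move=> t _; rewrite big_nil.
rewrite big_cons -ih -RintegralD//.
- by apply: eq_Rintegral => t _; rewrite big_cons.
- exact: continuous_itv_integrable.
- by apply: continuous_itv_integrable; exact: continuous_bigsum.
Qed.

(** Steps of two occur because the two edges at a vertex span the window from [u j] to [u j.+2]. *)
Lemma telescope_sum2 (g : nat -> R) n :
  \sum_(j < n) (g j - g j.+2) = g 0%N + g 1%N - g n - g n.+1.
Proof.
elim: n => [|n ih]; first by rewrite big_ord0; ring.
by rewrite big_ord_recr/= ih; ring.
Qed.

Definition chord_slope (f : R -> R) x y := (f y - f x) / (y - x).

(* The test function is [\sum_j sigma_j (psi_j - psi'_j)], [psi_j t] being the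
   mean of [u |-> G (t - u)] over [x_j, y_j]; both means lie between
   [G (t - u_(j+2))] and [G (t - u_j)], so that the sum of the oscillations
   telescopes to two turns. *)
Lemma chord_slope_variation l (M : R) (f : R -> R) (n : nat)
    (u x y x' y' : nat -> R) : 0 < l ->
  (forall x y, `|f x - f y| <= `|x - y|) -> periodic f l ->
  (forall (psi g h : R -> R) (B : R), is_trig psi -> periodic psi l ->
    (forall t, is_derive t 1 psi (g t)) -> (forall t, is_derive t 1 g (h t)) ->
    continuous h -> (forall t, `|psi t| <= B) ->
    `|\int[mu]_(t in `[0, l]) (f t * h t)| <= M * B) ->
  u n = u 0%N + l -> u n.+1 = u 1%N + l ->
  (forall j, (j < n)%N -> [/\ u j <= x j, x j < y j & y j <= u j.+2]) ->
  (forall j, (j < n)%N -> [/\ u j <= x' j, x' j < y' j & y' j <= u j.+2]) ->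
  \sum_(j < n) `|chord_slope f (x j) (y j) - chord_slope f (x' j) (y' j)| <= M * 2.
Proof.
move=> l0 lf pf H un un1 xyu xyu'.
have cf : continuous f.
  by apply: (klipschitz_continuous (K := 1)) => ? ?; rewrite mul1r.
apply/ler_addgt0Pr => eps eps0.
(* [C * eta] will bound the cost of replacing [f] by its smoothing [fh], within [eta], in all the
   slopes; [d] and [e] below each account for half of [eta]. *)
pose C := \sum_(j < n) (2 / (y j - x j) + 2 / (y' j - x' j)).
have C0 : 0 <= C.
  apply: sumr_ge0 => j _; have [_ h1 _] := xyu j (ltn_ord j).
  have [_ h2 _] := xyu' j (ltn_ord j).
  by rewrite addr_ge0// divr_ge0// subr_ge0 ltW.
pose eta := eps / (C + 1).
have C1 : 0 < C + 1 by rewrite ltr_wpDl.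
have eta0 : 0 < eta by rewrite divr_gt0.
pose d := Num.min (eta / 2) (l / 2).
have d0 : 0 < d by rewrite lt_min !divr_gt0.
have dl : d <= l / 2 by rewrite ge_min lexx orbT.
have l2 : 0 < 2 * l ^+ 2 by rewrite mulr_gt0// exprn_gt0.
pose e := eta / (2 * l ^+ 2).
have e0 : 0 < e by rewrite divr_gt0.
have [K [G [s [[K0 cK pK] Gl ps [dG dP] Ke]]]] := periodic_kernel l0 d0 dl e0.
have approx := periodic_kernel_approx l0 d0 e0 K0 cK pK Gl dG Ke lf pf.
pose fh z := \int[mu]_(t in `[0, l]) (f t * K (t - z)).
have fhE z : `|fh z - f z| <= eta.
  rewrite (le_trans (approx z))// /e [leRHS](splitr eta) lerD//.
    by rewrite ge_min lexx.
  by rewrite le_eqVlt; apply/orP; left; apply/eqP; field; rewrite gt_eqF.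
have cG : continuous G.
  move=> z; apply: differentiable_continuous; apply/derivable1_diffP.
  by case: (dG z).
have Gnd a b : a <= b -> G a <= G b.
  move=> ab; rewrite -subr_ge0.
  have [c _ ->] := MVT_segment ab (fun z _ => dG z) (continuous_subspaceT cG).
  by rewrite mulr_ge0// subr_ge0.
pose P t := t ^+ 2 / (2 * l) + trig_sum s t.
have cP : continuous P.
  move=> z; apply: differentiable_continuous; apply/derivable1_diffP.
  by case: (dP z).
(* Differentiation in [t] turns [Q P] into [Q G] and then into [Q K]; integrating [f] against
   [Q K a b] gives minus the slope of the chord of [fh] over [[a, b]]. *)
pose Q (F : R -> R) a b t := (F (t - a) - F (t - b)) / (b - a).
have dQ (F dF : R -> R) a b t : (forall x, is_derive x 1 F (dF x)) ->
    is_derive t 1 (Q F a b) (Q dF a b t).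
  move=> dFx; have h1 := is_derive_shift (dFx (t - a)).
  have h2 := is_derive_shift (dFx (t - b)).
  apply: (is_derive1_ext (g := fun t => (b - a)^-1 * (F (t - a) - F (t - b)))).
    by move=> z; rewrite mulrC.
  by rewrite /GRing.scale/= mulrC.
have QP a b lo hi t : lo <= a -> a < b -> b <= hi ->
    G (t - hi) <= Q P a b t <= G (t - lo).
  move=> la ab bh; have tab : t - b <= t - a by lra.
  have [c + cE] := MVT_segment tab (fun z _ => dP z) (continuous_subspaceT cP).
  rewrite in_itv/= => /andP[c1 c2].
  have -> : Q P a b t = G c.
    rewrite /Q -/(P (t - a)) cE (_ : t - a - (t - b) = b - a); last by ring.
    by rewrite mulfK// subr_eq0 gt_eqF.
  by rewrite !Gnd//; lra.
pose D j := chord_slope f (x j) (y j) - chord_slope f (x' j) (y' j).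
(* The sign makes each term contribute the absolute value of its slope difference, up to the
   smoothing error. *)
pose W (F : R -> R) j t := Num.sg (D j) * (Q F (x j) (y j) t - Q F (x' j) (y' j) t).
have dW (F dF : R -> R) j t : (forall x, is_derive x 1 F (dF x)) ->
    is_derive t 1 (W F j) (W dF j t).
  move=> dFx; have h1 := dQ _ _ (x j) (y j) t dFx.
  have h2 := dQ _ _ (x' j) (y' j) t dFx.
  exact: (is_derive1_ext (g := fun t => Num.sg (D j) *
    (Q F (x j) (y j) t - Q F (x' j) (y' j) t))).
have cQ a b : continuous (Q K a b).
  have cs c : continuous (fun t => K (t - c)).
    move=> t; apply: continuous_comp; last exact: cK.
    by apply: cvgB; [exact: cvg_id|exact: cvg_cst].
  by move=> t; apply: cvgMl; apply: cvgB; exact: cs.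
have cW j : continuous (W K j).
  by move=> t; apply: cvgMr; apply: cvgB; exact: cQ.
pose psi t := \sum_(j < n) W P j t.
(* The quadratic part of [P] contributes [(2 * t - x j - y j) / (2 * l)] to the first quotient. Its
   dependence on [t] is the same for every chord, so it cancels in the difference, and a
   trigonometric function remains. *)
have WE j t : (j < n)%N -> W P j t =
    Num.sg (D j) * (((trig_sum s (t - x j) - trig_sum s (t - y j)) / (y j - x j)
    - (trig_sum s (t - x' j) - trig_sum s (t - y' j)) / (y' j - x' j))
    + ((x' j + y' j - x j - y j) / (2 * l))).
  move=> jn; have [_ h1 _] := xyu j jn; have [_ h2 _] := xyu' j jn.
  congr (_ * _); rewrite /Q /P; field.
  by rewrite gt_eqF//= !subr_eq0 !gt_eqF.
have psiT : is_trig psi.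
  have tS : is_trig (trig_sum s) by exists s.
  have tA c a b : is_trig (fun t =>
      c * (trig_sum s (t - a) + (-1) * trig_sum s (t - b))).
    have h1 := is_trig_shift a tS.
    have h2 := is_trigZ (-1) (is_trig_shift b tS).
    exact: (is_trigZ c (is_trigD h1 h2)).
  have [q qE] : is_trig (fun t => \sum_(j < n) (Num.sg (D j) *
     (((y j - x j)^-1 * (trig_sum s (t - x j) + (-1) * trig_sum s (t - y j))
    + (- (y' j - x' j)^-1) * (trig_sum s (t - x' j) + (-1) * trig_sum s (t - y' j)))
    + ((x' j + y' j - x j - y j) / (2 * l))))).
    apply: is_trig_sum => j; apply: is_trigZ; apply: is_trigD; last exact: is_trig_cst.
    have h1 := tA (y j - x j)^-1 (x j) (y j).
    have h2 := tA (- (y' j - x' j)^-1) (x' j) (y' j).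
    exact: (is_trigD h1 h2).
  exists q => t; rewrite -qE; apply: eq_bigr => j _; rewrite WE//.
  by congr (_ * _); ring.
have psip : periodic psi l.
  move=> t; apply: eq_bigr => j _; rewrite !WE//.
  by rewrite !(addrAC t l) !ps.
have psiB t : `|psi t| <= 2.
  rewrite (le_trans (ler_norm_sum _ _ _))//.
  apply: (@le_trans _ _ (\sum_(j < n) (G (t - u j) - G (t - u j.+2)))).
    apply: ler_sum => j _; rewrite normrM.
    have [h1 h2 h3] := xyu j (ltn_ord j); have [h1' h2' h3'] := xyu' j (ltn_ord j).
    have /andP[a1 a2] := QP _ _ _ _ t h1 h2 h3.
    have /andP[b1 b2] := QP _ _ _ _ t h1' h2' h3'.
    rewrite (@le_trans _ _ (1 * `|Q P (x j) (y j) t - Q P (x' j) (y' j) t|))//.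
      by rewrite ler_wpM2r// normr_sg; case: (_ != _).
    rewrite mul1r ler_norml; lra.
  (* [G] grows by 1 over a period, so each of the two telescoped differences equals 1. *)
  rewrite (telescope_sum2 (fun j => G (t - u j))) un un1.
  have E0 z : G (t - (z + l)) = G (t - z) - 1.
    by rewrite -[in RHS](subrK l (t - z)) Gl addrK opprD addrA.
  by rewrite !E0; lra.
have dpsi t : is_derive t 1 psi (\sum_(j < n) W G j t).
  by apply: is_derive_bigsum => j; apply: dW.
have dpsi2 t : is_derive t 1 (fun t => \sum_(j < n) W G j t) (\sum_(j < n) W K j t).
  by apply: is_derive_bigsum => j; apply: dW.
have cd2 : continuous (fun t => \sum_(j < n) W K j t).
  by apply: continuous_bigsum => j; exact: cW.
have := H _ _ _ 2 psiT psip dpsi dpsi2 cd2 psiB.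
have cfK z : continuous (fun t => f t * K (t - z)).
  move=> t; apply: cvgM; first exact: cf.
  apply: continuous_comp; last exact: cK.
  by apply: cvgB; [exact: cvg_id|exact: cvg_cst].
have intE : \int[mu]_(t in `[0, l]) (f t * \sum_(j < n) W K j t) =
   - \sum_(j < n) Num.sg (D j) *
      (chord_slope fh (x j) (y j) - chord_slope fh (x' j) (y' j)).
  under eq_Rintegral do rewrite mulr_sumr.
  rewrite Rintegral_itv_bigsum; last first.
    by move=> j t; apply: cvgM; [exact: cf|exact: cW].
  rewrite -sumrN; apply: eq_bigr => j _.
  pose c1 := Num.sg (D j) / (y j - x j); pose c2 := Num.sg (D j) / (y' j - x' j).
  have iz z := continuous_itv_integrable 0 l (cfK z).
  have izZ c z : mu.-integrable `[0, l] (EFin \o (fun t => c * (f t * K (t - z)))).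
    by apply: continuous_itv_integrable => t; apply: cvgMr; exact: cfK.
  rewrite (@eq_Rintegral _ _ _ mu _ (fun t => c1 * (f t * K (t - x j)) - c1 * (f t * K (t - y j))
     - c2 * (f t * K (t - x' j)) + c2 * (f t * K (t - y' j)))); last first.
    by move=> t _; rewrite /W /Q /c1 /c2; ring.
  have iB c z c' z' : mu.-integrable `[0, l] (EFin \o
      (fun t => c * (f t * K (t - z)) - c' * (f t * K (t - z')))).
    by apply: continuous_itv_integrable => t; apply: cvgB; apply: cvgMr; exact: cfK.
  rewrite RintegralD//; last first.
    by apply: continuous_itv_integrable => t; apply: cvgB; [apply: cvgB|]; apply: cvgMr; exact: cfK.
  rewrite RintegralB// RintegralB// !RintegralZl// -!/(fh _) /c1 /c2 /chord_slope.
  by ring.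
rewrite intE normrN ler_norml => /andP[_ le2].
rewrite (@le_trans _ _ (\sum_(j < n) Num.sg (D j) *
      (chord_slope fh (x j) (y j) - chord_slope fh (x' j) (y' j)) + C * eta))//; last first.
  rewrite lerD// /eta mulrCA -[leRHS]mulr1 ler_wpM2l ?(ltW eps0)//.
  by rewrite ler_pdivrMr// mul1r lerDl.
rewrite /C mulr_suml -big_split/=; apply: ler_sum => j _.
have -> : `|chord_slope f (x j) (y j) - chord_slope f (x' j) (y' j)| = Num.sg (D j) * D j.
  exact: normrEsg.
rewrite -lerBlDl -mulrBr.
have [_ h1 _] := xyu j (ltn_ord j); have [_ h2 _] := xyu' j (ltn_ord j).
have key a b : a < b -> `|chord_slope f a b - chord_slope fh a b| <= 2 / (b - a) * eta.
  move=> ab; rewrite /chord_slope -mulrBl normrM normfV.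
  rewrite [`|b - a|]gtr0_norm ?subr_gt0// mulrAC ler_wpM2r ?invr_ge0 ?subr_ge0 ?(ltW ab)//.
  rewrite (_ : _ - _ = (fh a - f a) - (fh b - f b)); last by ring.
  by rewrite (le_trans (ler_normB _ _))// mulrDl mul1r lerD.
rewrite (le_trans (ler_norm _))// normrM.
rewrite (@le_trans _ _ (1 * `|D j -
    (chord_slope fh (x j) (y j) - chord_slope fh (x' j) (y' j))|))//.
  by rewrite ler_wpM2r// normr_sg; case: (_ != _).
rewrite mul1r /D (_ : _ - _ =
   (chord_slope f (x j) (y j) - chord_slope fh (x j) (y j)) -
   (chord_slope f (x' j) (y' j) - chord_slope fh (x' j) (y' j))); last by ring.
by rewrite (le_trans (ler_normB _ _))// mulrDl lerD// key.
Qed.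

End discrete_variation_bound.

(** * Angles and polygons *)

Section euclidean_lemmas.
Context {R : realType}.
Implicit Types (u v w : 'rV[R]_3) (a b : R).

Let c0 : 'I_3 := ord0.
Let c1 : 'I_3 := lift ord0 ord0.
Let c2 : 'I_3 := lift ord0 (lift ord0 ord0).

Lemma sum3E (F : 'I_3 -> R) : \sum_(c < 3) F c = F c0 + F c1 + F c2.
Proof. by rewrite !big_ord_recl big_ord0 addr0 addrA. Qed.

Lemma dotC u v : dot u v = dot v u.
Proof. by apply: eq_bigr => c _; rewrite mulrC. Qed.

Lemma dotDl u v w : dot (u + v) w = dot u w + dot v w.
Proof. by rewrite -big_split; apply: eq_bigr => c _ /=; rewrite mxE mulrDl. Qed.

Lemma dotZl a u v : dot (a *: u) v = a * dot u v.
Proof. by rewrite mulr_sumr; apply: eq_bigr => c _ /=; rewrite mxE mulrA. Qed.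

Lemma dotDr u v w : dot w (u + v) = dot w u + dot w v.
Proof. by rewrite dotC dotDl !(dotC w). Qed.

Lemma dotZr a u v : dot u (a *: v) = a * dot u v.
Proof. by rewrite dotC dotZl dotC. Qed.

Lemma dotBl u v w : dot (u - v) w = dot u w - dot v w.
Proof. by rewrite dotDl -scaleN1r dotZl mulN1r. Qed.

Lemma dotBr u v w : dot w (u - v) = dot w u - dot w v.
Proof. by rewrite !(dotC w) dotBl. Qed.

Lemma dot_ge0 u : 0 <= dot u u.
Proof. by apply: sumr_ge0 => c _; rewrite -expr2 sqr_ge0. Qed.

Lemma dot_eq0 u : (dot u u == 0) = (u == 0).
Proof.
apply/eqP/eqP => [/eqP|->]; last by rewrite /dot big1// => c _; rewrite mxE mul0r.
rewrite psumr_eq0 => [/allP u0|c _]; last by rewrite -expr2 sqr_ge0.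
apply/rowP => c; rewrite mxE; apply/eqP.
by have := u0 c (mem_index_enum _); rewrite -expr2 expf_eq0.
Qed.

Lemma enorm_ge0 u : 0 <= enorm u. Proof. exact: sqrtr_ge0. Qed.

Lemma sqr_enorm u : enorm u ^+ 2 = dot u u.
Proof. by rewrite sqr_sqrtr// dot_ge0. Qed.

Lemma enorm_eq0 u : (enorm u == 0) = (u == 0).
Proof. by rewrite -dot_eq0 -sqr_enorm sqrf_eq0. Qed.

Lemma enorm_gt0 u : (0 < enorm u) = (u != 0).
Proof. by rewrite lt_neqAle enorm_ge0 andbT eq_sym enorm_eq0. Qed.

Lemma enormZ a u : enorm (a *: u) = `|a| * enorm u.
Proof. by rewrite /enorm dotZl dotZr mulrA -expr2 sqrtrM ?sqr_ge0// sqrtr_sqr. Qed.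

Lemma enormN u : enorm (- u) = enorm u.
Proof. by rewrite -scaleN1r enormZ normrN normr1 mul1r. Qed.

Lemma enormB u v : enorm (u - v) = enorm (v - u).
Proof. by rewrite -enormN opprB. Qed.

Lemma ler_sqr_dot u v : dot u v ^+ 2 <= dot u u * dot v v.
Proof.
rewrite -subr_ge0 /dot !sum3E.
set a0 := u _ _; set a1 := u _ _; set a2 := u _ _.
set b0 := v _ _; set b1 := v _ _; set b2 := v _ _.
rewrite (_ : _ - _ = (a0 * b1 - a1 * b0) ^+ 2 + (a0 * b2 - a2 * b0) ^+ 2 +
  (a1 * b2 - a2 * b1) ^+ 2); last by ring.
by rewrite !addr_ge0// sqr_ge0.
Qed.

Lemma ler_norm_dot u v : `|dot u v| <= enorm u * enorm v.
Proof.
rewrite -(@ler_pXn2r _ 2)// ?nnegrE ?mulr_ge0 ?enorm_ge0//.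
by rewrite real_normK ?num_real// exprMn !sqr_enorm ler_sqr_dot.
Qed.

Lemma ler_enormD u v : enorm (u + v) <= enorm u + enorm v.
Proof.
rewrite -(@ler_pXn2r _ 2)// ?nnegrE ?addr_ge0 ?enorm_ge0//.
rewrite sqrrD !sqr_enorm dotDl !dotDr (dotC v u).
have := le_trans (ler_norm _) (ler_norm_dot u v); lra.
Qed.

Lemma ler_coord_enorm u (c : 'I_3) : `|u ord0 c| <= enorm u.
Proof.
rewrite -(@ler_pXn2r _ 2)// ?nnegrE ?enorm_ge0//.
rewrite real_normK ?num_real// sqr_enorm /dot (bigD1 c)//= expr2 lerDl.
by apply: sumr_ge0 => d _; rewrite -expr2 sqr_ge0.
Qed.

Lemma ler_enorm_sum u : enorm u <= \sum_(c < 3) `|u ord0 c|.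
Proof.
rewrite -(@ler_pXn2r _ 2)// ?nnegrE ?enorm_ge0 ?sumr_ge0//.
rewrite sqr_enorm /dot !sum3E.
rewrite -!expr2 -(real_normK (num_real (u _ c0))) -(real_normK (num_real (u _ c1))).
rewrite -(real_normK (num_real (u _ c2))).
have := normr_ge0 (u ord0 c0); have := normr_ge0 (u ord0 c1).
have := normr_ge0 (u ord0 c2).
move: `|_| `|_| `|_| => x y z; nra.
Qed.

Lemma cos_angle_itv u v : -1 <= dot u v / (enorm u * enorm v) <= 1.
Proof.
have [uv0|uv0] := eqVneq (enorm u * enorm v) 0.
  by rewrite uv0 invr0 mulr0 lerN10 ler01.
have uvp : 0 < enorm u * enorm v by rewrite lt_neqAle eq_sym uv0 mulr_ge0 ?enorm_ge0.
by rewrite -ler_norml normrM normfV (gtr0_norm uvp) ler_pdivrMr// mul1r ler_norm_dot.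
Qed.

Lemma vangle_ge0 u v : 0 <= vangle u v.
Proof. by rewrite acos_ge0// cos_angle_itv. Qed.

Lemma vangle_lepi u v : vangle u v <= pi.
Proof. by rewrite acos_lepi// cos_angle_itv. Qed.

Lemma vangleZ a b u v : 0 < a -> 0 < b -> vangle (a *: u) (b *: v) = vangle u v.
Proof.
move=> a0 b0; rewrite /vangle dotZl dotZr !enormZ !gtr0_norm//; congr acos.
rewrite (_ : a * enorm u * (b * enorm v) = a * b * (enorm u * enorm v)); last by ring.
by rewrite mulrA -mulf_div divff ?mul1r// mulf_neq0// gt_eqF.
Qed.

(** Here [1 - cos t = 2 * sin (t / 2) ^+ 2] and [sin (t / 2) >= t / 8]: the cosine is at least 1/2
    on [[0, pi / 4]], so the mean value theorem gives [sin (t / 4) >= t / 8], and the duplication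
    formula passes to [t / 2]. *)
Lemma cos_quadratic (t : R) : 0 <= t <= pi -> t ^+ 2 <= 32 * (1 - cos t).
Proof.
move=> /andP[t0 tpi]; have pi0 := pi_gt0 R.
have half (z : R) : 0 <= z <= pi / 4 -> 1 / 2 <= cos z.
  move=> /andP[z0 zpi].
  have cz : 0 <= cos z by rewrite cos_ge0_pihalf//; apply/andP; split; lra.
  have : 0 <= cos (z + z) by rewrite cos_ge0_pihalf//; apply/andP; split; lra.
  rewrite -(mulr2n z) cos_mulr2n -(mulr_natl (cos z ^+ 2)); nra.
have csin : {within `[0, t / 4], continuous (@sin R)}.
  by apply: continuous_subspaceT; exact: continuous_sin.
have t4 : 0 <= t / 4 by lra.
have [c cI] := MVT_segment t4 (fun z _ => is_derive_sin z) csin.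
rewrite sin0 !subr0 => sE.
have cosc : 1 / 2 <= cos c.
  by apply: half; move: cI; rewrite in_itv/= => /andP[-> h]; lra.
have ct : 1 / 2 <= cos (t / 4) by apply: half; apply/andP; split; lra.
have st : t / 8 <= sin (t / 4) by rewrite sE; nra.
have s2 : sin (t / 2) = 2 * cos (t / 4) * sin (t / 4).
  rewrite (_ : t / 2 = t / 4 + t / 4); last by field.
  by rewrite sinD; ring.
have s2t : t / 8 <= sin (t / 2) by rewrite s2; nra.
have -> : cos t = 1 - 2 * sin (t / 2) ^+ 2.
  rewrite [in LHS](_ : t = t / 2 + t / 2); last by field.
  by rewrite cosD -!expr2 cos2sin2; ring.
nra.
Qed.

(** By the law of cosines, [enorm (u - v) ^+ 2] is at least [2 * enorm u * enorm v * (1 - cos t)],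
    hence at least [(1 - cos t) / 8]; with [cos_quadratic], the constant is the square root of
    [32 * 8]. *)
Lemma vangle_le_enormB u v : 1 / 4 <= enorm u -> 1 / 4 <= enorm v ->
  vangle u v <= 16 * enorm (u - v).
Proof.
move=> u4 v4; set t := vangle u v.
have tI : 0 <= t <= pi by rewrite vangle_ge0 vangle_lepi.
have ct : cos t = dot u v / (enorm u * enorm v).
  by rewrite /t /vangle acosK// in_itv/= cos_angle_itv.
have uv : 0 < enorm u * enorm v by rewrite mulr_gt0//; lra.
rewrite -(@ler_pXn2r _ 2)// ?nnegrE ?mulr_ge0 ?enorm_ge0 ?vangle_ge0//.
rewrite (le_trans (cos_quadratic tI))// exprMn sqr_enorm.
have -> : dot (u - v) (u - v) =
    (enorm u - enorm v) ^+ 2 + 2 * (enorm u * enorm v) * (1 - cos t).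
  rewrite dotBl !dotBr -!sqr_enorm (dotC v u) ct; field.
  by apply/andP; split; rewrite gt_eqF//; lra.
have : 0 <= 1 - cos t by rewrite subr_ge0 cos_le1.
have : 1 / 16 <= enorm u * enorm v by nra.
have := sqr_ge0 (enorm u - enorm v).
move: (enorm u * enorm v) (cos t) ((enorm u - enorm v) ^+ 2) => p q r; nra.
Qed.

End euclidean_lemmas.

(** * Turning of inscribed polygons *)

Section inscribed_polygons.
Context {R : realType}.
Variable g : R -> 'rV[R]_3.
Hypothesis arc : forall a b, a <= b -> curve_length g a b = (b - a)%:E.

Lemma polyline_length_cons2 (p q : 'rV[R]_3) v :
  polyline_length (p :: q :: v) = enorm (q - p) + polyline_length (q :: v).
Proof. by rewrite /polyline_length /= big_cons. Qed.

Lemma polyline_length1 (p : 'rV[R]_3) : polyline_length [:: p] = 0.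
Proof. by rewrite /polyline_length /= big_nil. Qed.

Lemma enorm_chord_le a b : a <= b -> enorm (g b - g a) <= b - a.
Proof.
rewrite le_eqVlt => /predU1P[->|ab].
  by rewrite !subrr /enorm /dot big1 ?sqrtr0// => c _; rewrite mxE mul0r.
rewrite -lee_fin -(arc (ltW ab)); apply: ereal_sup_ubound => /=.
exists [:: b]; first by split; rewrite /= ?andbT.
by rewrite polyline_length_cons2 polyline_length1 addr0.
Qed.

Lemma coord_lipschitz (c : 'I_3) x y :
  `|(fun t => g t ord0 c) x - g y ord0 c| <= `|x - y|.
Proof.
wlog xy : x y / y <= x.
  by move=> H; case: (leP y x) => [/H//|/ltW/H]; rewrite distrC [`|x - y|]distrC.
rewrite [leRHS]ger0_norm ?subr_ge0// (le_trans _ (enorm_chord_le xy))//.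
by have := ler_coord_enorm (g x - g y) c; rewrite !mxE.
Qed.

(** Otherwise every polyline inscribed in the arc would be at most half as long as the parameter
    interval, against the arclength parametrization. *)
Lemma exists_long_chord a b : a < b ->
  exists x y, [/\ a <= x, x < y, y <= b & (y - x) / 2 <= enorm (g y - g x)].
Proof.
move=> ab; apply: contrapT => H.
have small x y : a <= x -> x < y -> y <= b -> enorm (g y - g x) <= (y - x) / 2.
  move=> ax xy yb; rewrite leNgt; apply/negP => lt; apply: H.
  by exists x, y; split => //; exact: ltW.
have len (s : seq R) x : a <= x -> path <%R x s -> last x s = b ->
    polyline_length (map g (x :: s)) <= (b - x) / 2.
  elim: s x => [|y s ih] x ax /=.
    by move=> _ ->; rewrite polyline_length1 subrr mul0r.
  move=> /andP[xy ys] sb; rewrite polyline_length_cons2.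
  have yb : y <= b.
    have := ys; rewrite -sb (path_sortedE lt_trans) => /andP[/allP ally _].
    case: s {ih sb ys} ally => [//|z s'] ally.
    by apply/ltW/ally; rewrite /= mem_last.
  have ay : a <= y by rewrite (le_trans ax)// ltW.
  have := ih y ay ys sb; have := small x y ax xy yb; rewrite /=; lra.
have : curve_length g a b = (b - a)%:E by apply: arc; exact: ltW.
apply/eqP; rewrite lt_eqF//.
apply: (@le_lt_trans _ _ ((b - a) / 2)%:E); last by rewrite lte_fin; lra.
apply: ge_ereal_sup => _ /= [s [ps /eqP ls] <-].
by rewrite lee_fin len.
Qed.

Let slope_diff c x y x' y' :=
  `|chord_slope (fun t => g t ord0 c) x y - chord_slope (fun t => g t ord0 c) x' y'|.

Lemma enorm_slope_diff x y x' y' :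
  enorm ((y - x)^-1 *: (g y - g x) - (y' - x')^-1 *: (g y' - g x')) <=
  \sum_(c < 3) slope_diff c x y x' y'.
Proof.
rewrite (le_trans (ler_enorm_sum _))//; apply: ler_sum => c _.
by rewrite !mxE /slope_diff /chord_slope !(mulrC (_^-1)).
Qed.

(* If one of the two chords is short, then a long chord inside its arc differs
   from it by a definite amount, which pays for the trivial bound [pi]. *)
Lemma vangle_slope_diff a b c : a < b -> b < c ->
  exists p : R * R * R * R, let: (x, y, x', y') := p in
    [/\ [/\ a <= x, x < y & y <= c], [/\ a <= x', x' < y' & y' <= c] &
      vangle (g b - g a) (g c - g b) <=
      16 * \sum_(i < 3) slope_diff i x y x' y'].
Proof.
move=> ab bc.
(* A chord whose slope vector is shorter than 1/4 is compared with a chord of slope at least 1/2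
   inside its arc: the slopes differ by at least 1/4, and [16 / 4] exceeds [pi]. *)
have short x1 y1 : a <= x1 -> x1 < y1 -> y1 <= c ->
    enorm ((y1 - x1)^-1 *: (g y1 - g x1)) < 1 / 4 ->
    exists p : R * R * R * R, let: (x, y, x', y') := p in
    [/\ [/\ a <= x, x < y & y <= c], [/\ a <= x', x' < y' & y' <= c] &
      vangle (g b - g a) (g c - g b) <=
      16 * \sum_(i < 3) slope_diff i x y x' y'].
  move=> ax xy yc sh; have [x [y [x1x xy' yy1 long]]] := exists_long_chord xy.
  exists (x, y, x1, y1); split; first by split => //; lra.
    by split.
  rewrite (le_trans (vangle_lepi _ _))//.
  have pi4 : pi <= 4 :> R by have := @pihalf_02 R; lra.
  have := enorm_slope_diff x y x1 y1.
  have : 1 / 2 <= enorm ((y - x)^-1 *: (g y - g x)).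
    have yx0 : 0 < y - x by rewrite subr_gt0.
    rewrite enormZ ger0_norm ?invr_ge0 ?(ltW yx0)// ler_pdivlMl//; lra.
  set p := _ *: _; set q := (y1 - x1)^-1 *: _ in sh *.
  have := ler_enormD (p - q) q; rewrite subrK; lra.
have [sh|lo1] := ltP (enorm ((b - a)^-1 *: (g b - g a))) (1 / 4).
  by apply: (short a b) => //; exact: ltW.
have [sh|lo2] := ltP (enorm ((c - b)^-1 *: (g c - g b))) (1 / 4).
  by apply: (short b c) => //; exact: ltW.
exists (a, b, b, c); split; [by split => //; exact: ltW|by split => //; exact: ltW|].
rewrite -(@vangleZ _ (b - a)^-1 (c - b)^-1) ?invr_gt0 ?subr_gt0//.
rewrite (le_trans (vangle_le_enormB lo1 lo2))// ler_wpM2l//.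
exact: enorm_slope_diff.
Qed.

Lemma nth_rot1 (T : Type) (x0 : T) (s : seq T) i : (i < size s)%N ->
  nth x0 (rot 1 s) i = nth x0 s (i.+1 %% size s).
Proof.
case: s => [//|x s] /= i_s; rewrite rot1_cons nth_rcons.
move: i_s; rewrite ltnS leq_eqVlt => /predU1P[->|i_s].
  by rewrite ltnn eqxx modnn.
by rewrite i_s modn_small.
Qed.

Lemma nth_cyclic_pairs (T : Type) (x0 : T) (s : seq T) i : (i < size s)%N ->
  nth (x0, x0) (cyclic_pairs s) i = (nth x0 s i, nth x0 s (i.+1 %% size s)).
Proof. by move=> i_s; rewrite nth_zip ?size_rot// nth_rot1. Qed.

Lemma size_cyclic_pairs (T : Type) (s : seq T) : size (cyclic_pairs s) = size s.
Proof. by rewrite size_zip size_rot minnn. Qed.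

(** The turning angle at a vertex is charged to the window made of its two adjacent arcs; the chords
    chosen there by [vangle_slope_diff] form a family of the kind bounded by the hypothesis. *)
Lemma closed_total_curvature_le (l C : R) : 0 < l -> periodic g l ->
  (forall n (u x y x' y' : nat -> R), u n = u 0%N + l -> u n.+1 = u 1%N + l ->
    (forall j, (j < n)%N -> [/\ u j <= x j, x j < y j & y j <= u j.+2]) ->
    (forall j, (j < n)%N -> [/\ u j <= x' j, x' j < y' j & y' j <= u j.+2]) ->
    \sum_(j < n) \sum_(c < 3) slope_diff c (x j) (y j) (x' j) (y' j) <= C) ->
  0 <= C ->
  (closed_total_curvature l g <= (16 * C)%:E)%E.
Proof.
move=> l0 pg H C0; apply: ge_ereal_sup => _ /= [v [s [ss sl -> _]] <-].
rewrite lee_fin; set n := size s.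
have [s0|n0] := posnP n.
  by rewrite (size0nil s0) /turning /= big_nil mulr_ge0.
(* The vertex parameters are continued past one turn by adding [l], so that the windows at the
   closing vertices need no separate treatment. *)
pose u j := nth 0 s (j %% n) + l * (j %/ n)%:R.
have sI j : (j < n)%N -> 0 <= nth 0 s j < l by move=> jn; exact: (all_nthP 0 sl).
have uS j : u j < u j.+1.
  rewrite /u modnS divnS//; have jn : (j %% n < n)%N by rewrite ltn_mod.
  have [dj|ndj] /= := boolP (n %| j.+1)%N.
    rewrite add1n -natr1 mulrDr mulr1.
    have /andP[h0 _] := sI 0%N n0; have /andP[_ h1] := sI _ jn; lra.
  rewrite add0n ltrD2r (sorted_ltn_nth lt_trans)// ?inE//.
  rewrite ltn_neqAle jn andbT; apply: contra ndj => /eqP jn1.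
  by rewrite /dvdn -addn1 -modnDml addn1 jn1 modnn.
have uD j : u (j + n)%N = u j + l.
  by rewrite /u modnDr divnDr ?dvdnn// divnn n0 addn1 -natr1 mulrDr mulr1 addrA.
have un : u n = u 0%N + l by rewrite -uD add0n.
have un1 : u n.+1 = u 1%N + l by rewrite -uD add1n.
have gu j : g (u j) = nth 0 (map g s) (j %% n).
  rewrite (nth_map 0) ?ltn_mod// /u.
  by rewrite mulr_natr periodicn.
have /choice[p pP] : forall j, exists p : R * R * R * R, let: (x, y, x', y') := p in
    [/\ [/\ u j <= x, x < y & y <= u j.+2], [/\ u j <= x', x' < y' & y' <= u j.+2] &
      vangle (g (u j.+1) - g (u j)) (g (u j.+2) - g (u j.+1)) <=
      16 * \sum_(i < 3) slope_diff i x y x' y'].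
  by move=> j; exact: vangle_slope_diff.
pose x j := (p j).1.1.1; pose y j := (p j).1.1.2; pose x' j := (p j).1.2; pose y' j := (p j).2.
have pP' j : [/\ [/\ u j <= x j, x j < y j & y j <= u j.+2],
      [/\ u j <= x' j, x' j < y' j & y' j <= u j.+2] &
      vangle (g (u j.+1) - g (u j)) (g (u j.+2) - g (u j.+1)) <=
      16 * \sum_(i < 3) slope_diff i (x j) (y j) (x' j) (y' j)].
  by have := pP j; rewrite /x /y /x' /y'; case: (p j) => [[[? ?] ?] ?].
apply: (@le_trans _ _ (16 * \sum_(j < n) \sum_(c < 3)
    slope_diff c (x j) (y j) (x' j) (y' j))); last first.
  by rewrite ler_wpM2l// (H n u)// => j _; have [] := pP' j.
have szE : size (closed_edges (map g s)) = n.
  by rewrite size_map size_cyclic_pairs size_map.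
have nthE j : (j < n)%N ->
    nth 0 (closed_edges (map g s)) j = g (u j.+1) - g (u j).
  move=> jn; rewrite (nth_map (0, 0)) ?size_cyclic_pairs ?size_map//.
  by rewrite nth_cyclic_pairs ?size_map//= !gu (modn_small jn).
rewrite /turning (big_nth (0, 0)) size_cyclic_pairs szE big_mkord mulr_sumr.
apply: ler_sum => j _; rewrite nth_cyclic_pairs ?szE//= nthE// nthE ?ltn_mod//.
have [_ _] := pP' j; rewrite !gu.
by rewrite -[in (j.+1 %% n).+1]addn1 modnDml addn1 modn_mod.
Qed.

End inscribed_polygons.

(** * The first variation of length *)

Section length_variation.
Context {R : realType}.
Notation mu := (@lebesgue_measure R).
Notation rV3 := 'rV[R]_3.

Lemma integrable_fun_add (f g : R -> R) (a b : R) :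
  mu.-integrable `[a, b] (EFin \o f) -> mu.-integrable `[a, b] (EFin \o g) ->
  mu.-integrable `[a, b] (EFin \o (fun x => f x + g x)).
Proof.
move=> fi gi; have := @integrableD _ (measurableTypeR R) R mu _ (measurable_itv `[a, b]) _ _ fi gi.
by apply: eq_integrable => // x _ /=; rewrite EFinD.
Qed.

Lemma is_derive_coord (f : R -> rV3) s (c : 'I_3) : derivable f s 1 ->
  is_derive s 1 (fun t => f t ord0 c) (derive1 f s ord0 c).
Proof.
move=> df; have dc := (derivable_mxP f s 1).1 df ord0 c.
by rewrite derive1E derive_mx// mxE; exact: DeriveDef.
Qed.

Lemma continuous_coord (f : R -> rV3) (c : 'I_3) : continuous f ->
  continuous (fun t => f t ord0 c).
Proof.
move=> cf x.
exact: (continuous_comp (cf x) (@coord_continuous R 1 3 ord0 c (f x))).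
Qed.

Lemma periodic_derive1 (f : R -> rV3) l : periodic f l -> periodic (derive1 f) l.
Proof.
move=> pf s; rewrite !derive1E /derive pf.
by under eq_fun do rewrite /= addrA pf.
Qed.

Lemma derive1n_lin (V : normedModType R) (a : R) (f g : R -> V) n :
  (forall n s, derivable (derive1n n f) s 1) ->
  (forall n s, derivable (derive1n n g) s 1) ->
  derive1n n (fun s => a *: f s + g s) =
  (fun s => a *: derive1n n f s + derive1n n g s).
Proof.
move=> df dg; elim: n => [//|n ih]; rewrite !derive1nS ih; apply/funext => s.
have hf : is_derive s 1 (derive1n n f) (derive1 (derive1n n f) s).
  by rewrite derive1E; exact: DeriveDef.
have hg : is_derive s 1 (derive1n n g) (derive1 (derive1n n g) s).
  by rewrite derive1E; exact: DeriveDef.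
by rewrite derive1E; apply: derive_val.
Qed.

Lemma smooth_continuous_coord (f : R -> rV3) n (c : 'I_3) :
  (forall n s, derivable (derive1n n f) s 1) ->
  continuous (fun t : R => derive1n n f t ord0 c).
Proof.
move=> df; have cf : continuous (derive1n n f).
  by move=> s; apply: differentiable_continuous; apply/derivable1_diffP; exact: df.
by move=> s; exact: (continuous_comp (cf s) (@coord_continuous R 1 3 ord0 c _)).
Qed.

Variables (k : nat) (L : link R k).
Hypothesis hL : arclength_parametrized L.

Definition vf_lin (a : R) (xi eta : 'I_k.+1 -> R -> rV3) :=
  fun i s => a *: xi i s + eta i s.

Lemma VF_lin a xi eta : VF L xi -> VF L eta -> VF L (vf_lin a xi eta).
Proof.
move=> xiV etaV i; have [cx px] := xiV i; have [ce pe] := etaV i.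
split=> [s|s]; last by rewrite /vf_lin px pe.
by apply: cvgD; [apply: cvgZr; exact: cx|exact: ce].
Qed.

Lemma VFsmooth_lin a xi eta : VFsmooth L xi -> VFsmooth L eta ->
  VFsmooth L (vf_lin a xi eta).
Proof.
move=> [xiV dx] [etaV de]; split; first exact: VF_lin.
move=> i n s; rewrite derive1n_lin//.
by apply: derivableD => //; apply: derivableZ.
Qed.

(** The derivative is moved from [L], which has a tangent only almost everywhere, to the smooth
    field. Linearity of [dLen] is read off this form. *)
Lemma dLenE xi : VFsmooth L xi -> dLen L xi = - \sum_(i < k.+1) \sum_(c < 3)
  \int[mu]_(s in `[0, period L i]) (L i s ord0 c * derive1n 2 (xi i) s ord0 c).
Proof.
move=> [xiV dxi]; rewrite /dLen -sumrN; apply: eq_bigr => i _.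
set l := period L i; have l0 : 0 < l := period_gt0 L i.
have coordL (c : 'I_3) x y : `|(fun t => L i t ord0 c) x - L i y ord0 c| <= 1 * `|x - y|.
  rewrite mul1r; apply: coord_lipschitz => a b ab; exact: hL.
have coordp c : periodic (fun t => L i t ord0 c) l.
  by move=> t /=; rewrite link_periodic.
pose P c := periodic_lipschitz_parts l0 (coordL c) (coordp c).
have /choice[phi /choice[N phiP]] := P.
have [_ pxi] := xiV i.
have dxi1 (c : 'I_3) (s : R) : is_derive s 1 (fun t => derive1n 1 (xi i) t ord0 c)
    (derive1n 2 (xi i) s ord0 c).
  exact: (is_derive_coord c (dxi i 1%N s)).
have cxi n (c : 'I_3) : continuous (fun t : R => derive1n n (xi i) t ord0 c).
  exact: smooth_continuous_coord (dxi i).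
have pxi1 : periodic (derive1n 1 (xi i)) l.
  exact: (periodic_derive1 pxi).
have pxi2 : periodic (derive1n 2 (xi i)) l := periodic_derive1 pxi1.
have parts c : \int[mu]_(s in `[0, l]) (phi c s * derive1n 1 (xi i) s ord0 c) =
    - \int[mu]_(s in `[0, l]) (L i s ord0 c * derive1n 2 (xi i) s ord0 c).
  have [_ _ _ _ pp] := phiP c.
  apply: (pp (fun t => derive1n 1 (xi i) t ord0 c)
             (fun t => derive1n 2 (xi i) t ord0 c) (dxi1 c) (cxi 2%N c)) => s.
    by rewrite pxi1.
  by rewrite pxi2.
rewrite -sumrN -(eq_bigr _ (fun c _ => parts c)).
have phii c : mu.-integrable `[0, l]
    (EFin \o (fun s => phi c s * derive1n 1 (xi i) s ord0 c)).
  have [_ _ pii _ _] := phiP c; exact: (integrable_mul_continuous pii (cxi 1%N c)).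
rewrite sum3E -!RintegralD//; last first.
  exact: integrable_fun_add.
(* Outside the null set [NN] all three coordinates are differentiable, so [L i] is, and [tangent] is
   the vector of the densities [phi]. *)
congr fine; pose NN := \big[setU/set0]_(c < 3) N c `|` [set 0] `|` [set l].
have [mNN NN0] : measurable (\big[setU/set0]_(c < 3) N c) /\
    mu (\big[setU/set0]_(c < 3) N c) = 0%E.
  apply: (big_ind (fun A => measurable A /\ mu A = 0%E)) => [|A B [mA A0] [mB B0]|c _].
  - by rewrite measure0.
  - by split; [exact: measurableU|rewrite measureU0].
  - by have [] := phiP c.
apply: (@integral_off_null _ _ _ mu NN).
- by do 2?apply: measurableU.
- rewrite measureU0//; [|exact: measurableU|exact: lebesgue_measure_set1].
  by rewrite measureU0//; exact: lebesgue_measure_set1.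
move=> s /=; rewrite in_itv/= => /andP[s0 sl] /not_orP[/not_orP[Ns s0'] sl'].
have sI : 0 < s < l.
  by rewrite !lt_neqAle s0 sl !andbT; apply/andP; split; apply/eqP => // /esym.
have dphi c : is_derive s 1 (fun t => L i t ord0 c) (phi c s).
  have [_ _ _ + _] := phiP c; apply => // Ncs; apply: Ns.
  by rewrite (bigD1 c)//=; left.
have dL : derivable (L i) s 1.
  by apply/derivable_mxP => a c; rewrite (ord1 a); case: (dphi c).
have TE c : tangent L i s ord0 c = phi c s.
  by rewrite /tangent derive1E derive_mx// mxE; apply: derive_val.
by rewrite /dot sum3E !TE.
Qed.

Let coord_term (i : 'I_k.+1) (c : 'I_3) (f : R -> rV3) :=
  \int[mu]_(s in `[0, period L i]) (L i s ord0 c * derive1n 2 f s ord0 c).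

Let coord_term_lin i c a (f g : R -> rV3) :
  (forall n s, derivable (derive1n n f) s 1) ->
  (forall n s, derivable (derive1n n g) s 1) ->
  coord_term i c (fun s => a *: f s + g s) = a * coord_term i c f + coord_term i c g.
Proof.
move=> df dg; rewrite /coord_term derive1n_lin//.
have cL : continuous (fun s => L i s ord0 c).
  by apply: continuous_coord; exact: link_continuous.
have cf := @smooth_continuous_coord f 2 c df.
have cg := @smooth_continuous_coord g 2 c dg.
move: (derive1n 2 f) (derive1n 2 g) cf cg => F G cf cg.
have cLF : continuous (fun s => L i s ord0 c * F s ord0 c).
  by move=> s; apply: cvgM; [exact: cL|exact: cf].
have cLG : continuous (fun s => L i s ord0 c * G s ord0 c).
  by move=> s; apply: cvgM; [exact: cL|exact: cg].
rewrite -RintegralZl//; last exact: continuous_itv_integrable.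
rewrite -RintegralD//; first last.
- exact: continuous_itv_integrable.
- by apply: continuous_itv_integrable => s; apply: cvgMr; exact: cLF.
by apply: eq_Rintegral => s _; rewrite !mxE; ring.
Qed.

Lemma dLen_lin a xi eta : VFsmooth L xi -> VFsmooth L eta ->
  dLen L (vf_lin a xi eta) = a * dLen L xi + dLen L eta.
Proof.
move=> sx se; have [xV dx] := sx; have [eV de] := se.
have dLenE' z : VFsmooth L z ->
    dLen L z = - \sum_(i < k.+1) \sum_(c < 3) coord_term i c (z i) by exact: dLenE.
rewrite (dLenE' _ (VFsmooth_lin a sx se)) (dLenE' _ sx) (dLenE' _ se).
rewrite mulrN -opprD mulr_sumr -big_split; congr (- _).
apply: eq_bigr => i _; rewrite mulr_sumr -big_split.
by apply: eq_bigr => c _; exact: (coord_term_lin i c a (dx i) (de i)).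
Qed.

End length_variation.

Section trigonometric_fields.
Context {R : realType}.
Notation mu := (@lebesgue_measure R).
Notation rV3 := 'rV[R]_3.

Lemma is_trig_derive (f : R -> R) : is_trig f ->
  exists g : R -> R, is_trig g /\ forall x : R, is_derive x 1 f (g x).
Proof.
move=> [s sE]; exists (trig_sum [seq (p.1.1 * p.1.2, p.1.2, p.2 + pi / 2) | p <- s]).
split; first by eexists.
move=> x; apply: (is_derive1_ext (g := trig_sum s)) => //.
rewrite /trig_sum big_map; apply: is_derive_bigsum => p.
have h := is_derive_cos_affine p.1.1 p.1.2 p.2 x.
by apply: is_derive_eq; rewrite /= addrA cosDpihalf mulrN mulNr.
Qed.

Lemma is_derive_scalev (f : R -> R) (df x : R) (v : rV3) :
  is_derive x 1 f df -> is_derive x 1 (fun s => f s *: v) (df *: v).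
Proof.
move=> fx.
have dc (a : 'I_1) (c : 'I_3) : is_derive x 1 (fun s => (f s *: v) a c) (df * v a c).
  apply: (is_derive1_ext (g := fun s => v a c * f s)).
    by move=> t; rewrite mxE mulrC.
  by rewrite /GRing.scale/= mulrC.
have dv : derivable (fun s => f s *: v) x 1.
  by apply/derivable_mxP => a c; case: (dc a c).
apply: DeriveDef => //; rewrite derive_mx//; apply/matrixP => a c.
by rewrite !mxE; have := dc a c => h; apply: derive_val.
Qed.

Lemma derive1n_trigv (f : R -> R) (v : rV3) n : is_trig f ->
  exists g : R -> R, [/\ is_trig g, derive1n n f = g &
    derive1n n (fun s => f s *: v) = (fun s => g s *: v)].
Proof.
move=> fT; elim: n => [|n [g [gT fg fvg]]]; first by exists f.
have [h [hT gh]] := is_trig_derive gT.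
exists h; split => //.
  by rewrite derive1nS fg; apply/funext => x; rewrite derive1E; apply: derive_val.
rewrite derive1nS fvg; apply/funext => x; rewrite derive1E.
by have hh := is_derive_scalev v (gh x); apply: derive_val.
Qed.

Lemma derivable_trigv (f : R -> R) (v : rV3) (x : R) : is_trig f ->
  derivable (fun s => f s *: v) x 1.
Proof.
by move=> /is_trig_derive[g [_ gh]]; case: (is_derive_scalev v (gh x)).
Qed.

Variables (k : nat) (L : link R k).
Hypothesis hL : arclength_parametrized L.

Definition coord_field (i : 'I_k.+1) (c : 'I_3) (psi : R -> R) : 'I_k.+1 -> R -> rV3 :=
  fun j s => (if j == i then psi s else 0) *: delta_mx ord0 c.

Lemma is_trig_if (b : bool) (psi : R -> R) : is_trig psi ->
  is_trig (fun s => if b then psi s else 0).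
Proof. by case: b => // _; exact: is_trig_cst. Qed.

Lemma VFsmooth_coord_field i c psi : is_trig psi -> periodic psi (period L i) ->
  VFsmooth L (coord_field i c psi).
Proof.
move=> psiT pp; split => [j|j n s].
  split; last first.
    by move=> s; rewrite /coord_field; case: eqP => // ->; rewrite pp.
  move=> s; apply: differentiable_continuous; apply/derivable1_diffP.
  by apply: derivable_trigv; exact: is_trig_if.
have [g [gT _ ->]] := derive1n_trigv (delta_mx ord0 c) n (is_trig_if (j == i) psiT).
exact: derivable_trigv.
Qed.

Lemma dLen_coord_field i c (psi g h : R -> R) :
  is_trig psi -> periodic psi (period L i) ->
  (forall t : R, is_derive t 1 psi (g t)) -> (forall t : R, is_derive t 1 g (h t)) ->
  dLen L (coord_field i c psi) =
  - \int[mu]_(s in `[0, period L i]) (L i s ord0 c * h s).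
Proof.
move=> psiT pp pg gh; rewrite (dLenE hL (VFsmooth_coord_field c psiT pp)); congr (- _).
have d2 j : derive1n 2 (coord_field i c psi j) =
    (fun s => (if j == i then h s else 0) *: delta_mx ord0 c).
  have [u [uT fu ->]] := derive1n_trigv (delta_mx ord0 c) 2 (is_trig_if (j == i) psiT).
  rewrite -fu; case: (j == i).
    have -> : derive1n 2 psi = h; last by [].
    rewrite derive1nS derive1n1.
    have -> : derive1 psi = g.
      by apply/funext => x; rewrite derive1E; apply: derive_val.
    by apply/funext => x; rewrite derive1E; apply: derive_val.
  apply/funext => s; congr (_ *: _).
  rewrite derive1nS derive1n1.
  have d0 : derive1 (fun=> 0 : R) = (fun=> 0) :> (R -> R).
    by apply/funext => x; rewrite derive1E; exact: derive_cst.
  by rewrite !d0.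
rewrite (bigD1 i)//= [X in _ + X]big1 ?addr0; last first.
  move=> j ji; apply: big1 => d _.
  transitivity (\int[mu]_(s in `[0, period L j]) (cst 0 s)).
    apply: eq_Rintegral => s _.
    by have := d2 j; rewrite /= => ->; rewrite (negbTE ji) scale0r mxE mulr0.
  by rewrite Rintegral_cst//= mul0r.
rewrite (bigD1 c)//= [X in _ + X]big1 ?addr0; last first.
  move=> d dc.
  transitivity (\int[mu]_(s in `[0, period L i]) (cst 0 s)).
    apply: eq_Rintegral => s _.
    by have := d2 i; rewrite /= => ->; rewrite !mxE (negbTE dc) andbF !mulr0.
  by rewrite Rintegral_cst//= mul0r.
apply: eq_Rintegral => s _.
by have := d2 i; rewrite /= => ->; rewrite !mxE !eqxx mulr1.
Qed.

(** Fields equal to [psi] times a basis vector on one component turn the bound on [dLen] into the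
    hypothesis of [chord_slope_variation] for each coordinate of [L i]. *)
Lemma finite_total_curvature_of_bound (M : R) : 0 <= M ->
  (forall xi B, VFsmooth L xi -> (forall i s, enorm (xi i s) <= B) ->
    `|dLen L xi| <= M * B) ->
  finite_total_curvature L.
Proof.
move=> M0 H; rewrite /finite_total_curvature.
(* Each of the three coordinates contributes [M * 2], and 16 converts slope differences into
   angles. *)
apply: (@le_lt_trans _ _ (\sum_(i < k.+1) (16 * (M * 2 * 3))%:E)%E); last first.
  by rewrite sumEFin ltry.
apply: lee_sum => i _.
have arc a b : a <= b -> curve_length (L i) a b = (b - a)%:E by exact: hL.
apply: (closed_total_curvature_le arc) => //.
- exact: period_gt0.
- exact: link_periodic.
- move=> n u x y x' y' un un1 xyu xyu'; rewrite exchange_big/=.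
  have := @chord_slope_variation R (period L i) M _ n u x y x' y' (period_gt0 L i).
  move=> key; rewrite (_ : M * 2 * 3 = \sum_(c < 3) (M * 2)); last first.
    by rewrite sumr_const card_ord mulr_natr.
  apply: ler_sum => c _; apply: key => //.
  + exact: (coord_lipschitz arc).
  + by move=> t; rewrite link_periodic.
  move=> psi g h B psiT pp pg gh ch psiB.
  rewrite -normrN -(dLen_coord_field c psiT pp pg gh).
  apply: H; first exact: VFsmooth_coord_field.
  move=> j s; rewrite /coord_field enormZ.
  have -> : enorm (delta_mx ord0 c : rV3) = 1.
    rewrite /enorm /dot (bigD1 c)//= big1 ?addr0; last first.
      by move=> d dc; rewrite !mxE (negbTE dc) mul0r.
    by rewrite !mxE !eqxx mulr1 sqrtr1.
  rewrite mulr1; case: ifP => // _; rewrite normr0.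
  exact: le_trans (normr_ge0 _) (psiB 0).
- by rewrite !mulr_ge0.
Qed.

End trigonometric_fields.

(** * The first variation of thickness *)

Section thickness_variation.
Context {R : realType}.
Notation rV3 := 'rV[R]_3.

Lemma continuous_dot (T : topologicalType) (f g : T -> rV3) :
  (forall c, continuous (fun x => f x ord0 c)) ->
  (forall c, continuous (fun x => g x ord0 c)) ->
  continuous (fun x => dot (f x) (g x)).
Proof.
move=> cf cg x; rewrite /dot.
under eq_fun do rewrite sum3E.
by rewrite /=; apply: cvgD; [apply: cvgD|]; apply: cvgM; (exact: cf || exact: cg).
Qed.

Lemma continuous_enorm (T : topologicalType) (f : T -> rV3) :
  (forall c, continuous (fun x => f x ord0 c)) ->
  continuous (fun x => enorm (f x)).
Proof.
move=> cf x; have cd := continuous_dot cf cf.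
exact: (continuous_comp (cd x) (@sqrt_continuous R _)).
Qed.

(** The square root lies below its tangent at [enorm D ^+ 2]; equivalently,
    [(enorm (D + t *: E) - enorm D) ^+ 2] is nonnegative. *)
Lemma enorm_add_le (D E : rV3) (t : R) : 0 < enorm D ->
  enorm (D + t *: E) <=
  enorm D + t * (dot E D / enorm D) + t ^+ 2 * dot E E / (2 * enorm D).
Proof.
move=> D0; have sq : enorm (D + t *: E) ^+ 2 =
    enorm D ^+ 2 + 2 * t * dot E D + t ^+ 2 * dot E E.
  by rewrite !sqr_enorm dotDl !dotDr !dotZl !dotZr (dotC D E); ring.
have D2 : 0 < 2 * enorm D by rewrite mulr_gt0.
rewrite -(ler_pM2r D2) [leRHS](_ : _ =
    enorm (D + t *: E) ^+ 2 + enorm D ^+ 2); last first.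
  by rewrite sq; field; rewrite gt_eqF.
by have := sqr_ge0 (enorm (D + t *: E) - enorm D); rewrite sqrrB; lra.
Qed.

(** Cauchy-Schwarz for [D + t *: E] and [D]: the norm lies above its supporting linear function at
    [D]. *)
Lemma enorm_add_ge (D E : rV3) (t : R) : 0 < enorm D ->
  enorm D + t * (dot E D / enorm D) <= enorm (D + t *: E).
Proof.
move=> D0; rewrite -(ler_pM2r D0) mulrDl -expr2 -mulrA divfK ?gt_eqF//.
rewrite sqr_enorm -dotZl -dotDl.
exact: le_trans (ler_norm _) (ler_norm_dot _ _).
Qed.

Variables (k : nat) (L : link R k).
Let l := period L.

Let box (i j : 'I_k.+1) : set (R * R) := `[0, l i]%classic `*` `[0, l j]%classic.

(** Compactness of finitely many closed boxes, which repeat one point of each circle; [rmod] leads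
    back to [points]. The constraint [C] is [setT] for the existence of struts, a sublevel set of
    the distance for the least rigidity on the struts, and a sublevel set of the slope in Danskin's
    formula. *)
Lemma pairs_min (F : 'I_k.+1 -> 'I_k.+1 -> R * R -> R)
    (C : 'I_k.+1 -> 'I_k.+1 -> set (R * R)) :
  (forall i j : 'I_k.+1, (i < j)%N -> closed (C i j)) ->
  (forall i j : 'I_k.+1, (i < j)%N -> continuous (F i j)) ->
  (exists i j : 'I_k.+1, (i < j)%N /\ exists p, box i j p /\ C i j p) ->
  exists i j : 'I_k.+1, [/\ (i < j)%N & exists p, [/\ box i j p, C i j p &
    forall (i' j' : 'I_k.+1) p', (i' < j')%N -> box i' j' p' -> C i' j' p' ->
      F i j p <= F i' j' p']].
Proof.
move=> clC cF [i0 [j0 [ij0 [p0 [p0b p0C]]]]].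
pose P (a : 'I_k.+1 * 'I_k.+1) := (a.1 < a.2)%N && `[< exists p, box a.1 a.2 p /\ C a.1 a.2 p >].
have minP a : exists p, P a -> [/\ box a.1 a.2 p, C a.1 a.2 p &
    forall p', box a.1 a.2 p' -> C a.1 a.2 p' -> F a.1 a.2 p <= F a.1 a.2 p'].
  have [/andP[a12 /asboolP[q [qb qC]]]|] := boolP (P a); last by exists (0, 0).
  have cb : compact (box a.1 a.2 `&` C a.1 a.2).
    apply: compact_closedI; last exact: clC.
    by apply: compact_setX; exact: segment_compact.
  have [||c + cmin] := @compact_EVT_min (R * R)%type R (F a.1 a.2) _ _ cb.
  - by exists q.
  - by apply: continuous_subspaceT; exact: cF.
  rewrite inE => -[cbx cC].
  by exists c => _; split => // p' p'b p'C; apply: cmin; rewrite inE.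
have /choice[m mP] := minP.
have Pa0 : P (i0, j0) by rewrite /P/= ij0; apply/asboolP; exists p0.
have [[i j] Pij ijmin] := arg_minP (fun a => F a.1 a.2 (m a)) Pa0.
have [ijb ijC ijm] := mP _ Pij.
exists i, j; split; first by case/andP: Pij.
exists (m (i, j)); split => // i' j' p' ij' p'b p'C.
have Pij' : P (i', j') by rewrite /P/= ij'; apply/asboolP; exists p'.
have [_ _ m'] := mP _ Pij'.
exact: le_trans (ijmin _ Pij') (m' _ p'b p'C).
Qed.

Lemma rmod_box (i j : 'I_k.+1) (s t : R) : box i j (rmod (l i) s, rmod (l j) t).
Proof.
have /andP[s0 sl] := rmod_itv s (period_gt0 L i).
have /andP[t0 tl] := rmod_itv t (period_gt0 L j).
by split => /=; rewrite in_itv/= ?s0 ?t0 ltW.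
Qed.

Definition gap (g : 'I_k.+1 -> R -> rV3) (i j : 'I_k.+1) (p : R * R) : rV3 :=
  g j p.2 - g i p.1.

Lemma gap_rmod g i j s t : VF L g ->
  gap g i j (rmod (l i) s, rmod (l j) t) = gap g i j (s, t).
Proof.
move=> gV; have [_ pi] := gV i; have [_ pj] := gV j.
by rewrite /gap/= !periodic_rmod.
Qed.

Lemma continuous_gap_coord g i j c : VF L g ->
  continuous (fun p : R * R => gap g i j p ord0 c).
Proof.
move=> gV p; have [ci _] := gV i; have [cj _] := gV j.
rewrite /gap; under eq_fun do rewrite !mxE.
rewrite /=; apply: cvgB.
- apply: (@cvg_comp _ _ _ snd (fun t => g j t ord0 c) (nbhs p) (nbhs p.2)).
    exact: cvg_snd.
  exact: (@continuous_coord R (g j) c cj p.2).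
- apply: (@cvg_comp _ _ _ fst (fun t => g i t ord0 c) (nbhs p) (nbhs p.1)).
    exact: cvg_fst.
  exact: (@continuous_coord R (g i) c ci p.1).
Qed.

Lemma VF_link : VF L (link_map L).
Proof. by move=> i; split; [exact: link_continuous|exact: link_periodic]. Qed.

Lemma gap_gt0 (i j : 'I_k.+1) p : (i < j)%N -> 0 < enorm (gap L i j p).
Proof.
move=> ij; rewrite enorm_gt0 subr_eq0 link_disjoint//.
by rewrite eq_sym -(inj_eq val_inj) ltn_eqF.
Qed.

Lemma LThi_le g (i j : 'I_k.+1) p : (i < j)%N -> LThi g <= enorm (gap g i j p).
Proof.
move=> ij; apply: ge_inf; first by exists 0 => _ /= [? [? [? [? [_ ->]]]]]; exact: enorm_ge0.
exists i, j, p.1, p.2; split => //.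
by rewrite -(inj_eq val_inj) ltn_eqF.
Qed.

(** [0 < k] provides two components; for a single one the infimum is taken over the empty set. *)
Lemma le_LThi g r : (0 < k)%N ->
  (forall (i j : 'I_k.+1) p, (i < j)%N -> r <= enorm (gap g i j p)) -> r <= LThi g.
Proof.
move=> k0 H; apply: lb_le_inf.
  exists (enorm (g (inord 1) 0 - g ord0 0)), ord0, (inord 1), 0, 0; split => //.
  by rewrite -(inj_eq val_inj)/= inordK.
move=> _ /= [i [j [s [t [ij ->]]]]].
have [ij'|ji] := ltnP i j; first exact: (H i j (s, t)).
rewrite enormB; apply: (H j i (t, s)).
by rewrite ltn_neqAle ji andbT (inj_eq val_inj) eq_sym.
Qed.

Lemma VF_bounded g : VF L g ->
  exists2 B, 0 < B & forall i s, enorm (g i s) <= B.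
Proof.
move=> gV.
have bnd (a : 'I_k.+1 * 'I_3) : exists B, 0 < B /\ forall s, `|g a.1 s ord0 a.2| <= B.
  have [cg pg] := gV a.1.
  have pc : periodic (fun s => g a.1 s ord0 a.2) (l a.1) by move=> s; rewrite pg.
  have [B B0 HB] := periodic_bounded (period_gt0 L a.1) (@continuous_coord R _ a.2 cg) pc.
  by exists B.
have /choice[B BP] := bnd.
exists (\sum_a B a + 1).
  by rewrite ltr_wpDl// sumr_ge0// => a _; have [/ltW] := BP a.
move=> i s; rewrite (le_trans (ler_enorm_sum _))//.
rewrite (@le_trans _ _ (\sum_(c < 3) B (i, c)))//.
  by apply: ler_sum => c _; have [_] := BP (i, c); apply.
rewrite (@le_trans _ _ (\sum_a B a)) ?lerDl//.
rewrite [leRHS](eq_bigr (fun a => B (a.1, a.2))); last by case.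
rewrite -(pair_bigA _ (fun j c => B (j, c)))/= (bigD1 i)//= lerDl.
by apply: sumr_ge0 => j _; apply: sumr_ge0 => c _; have [/ltW] := BP (j, c).
Qed.

(** This is [rigidity] with the components fixed, as a function of real parameters, so that its
    continuity can be used. *)
Definition slope xi (i j : 'I_k.+1) (p : R * R) : R :=
  dot (gap xi i j p) (gap L i j p) / enorm (gap L i j p).

Lemma continuous_slope xi (i j : 'I_k.+1) : VF L xi -> (i < j)%N ->
  continuous (slope xi i j).
Proof.
move=> xiV ij p; apply: cvgM.
  by apply: continuous_dot => c; apply: continuous_gap_coord => //; exact: VF_link.
apply: cvgV; first by rewrite gt_eqF// gap_gt0.
by apply: continuous_enorm => c; apply: continuous_gap_coord; exact: VF_link.
Qed.

Lemma StrutP (i j : 'I_k.+1) (p : R * R) : (i < j)%N ->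
  enorm (gap L i j p) <= LThi L ->
  Strut L ((i, rmod (l i) p.1), (j, rmod (l j) p.2)).
Proof.
move=> ij le; split => //=; rewrite /points/=.
- exact: rmod_itv (period_gt0 L i).
- exact: rmod_itv (period_gt0 L j).
- have := gap_rmod i j p.1 p.2 VF_link; rewrite /gap/= => ->.
  by apply/eqP; rewrite eq_le (LThi_le L p ij) andbT; case: p le.
Qed.

Lemma Strut_nonempty : (0 < k)%N -> Strut L !=set0.
Proof.
move=> k0.
have [//|||i [j [ij [p [_ _ pmin]]]]] := @pairs_min (fun i j p => enorm (gap L i j p))
  (fun _ _ => setT).
- move=> i j ij; apply: continuous_enorm => c.
  by apply: continuous_gap_coord; exact: VF_link.
- exists ord0, (inord 1); rewrite inordK//; split => //.
  by exists (rmod (l ord0) 0, rmod (l (inord 1)) 0); split => //; exact: rmod_box.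
eexists; apply: (StrutP (p := p) ij).
apply: le_LThi => // i' j' [s t] ij'.
by rewrite -(gap_rmod i' j' s t VF_link); apply: pmin => //; exact: rmod_box.
Qed.

Lemma rigidity_slope xi (i j : 'I_k.+1) s t :
  rigidity L xi ((i, s), (j, t)) = slope xi i j (s, t).
Proof. by []. Qed.

Lemma slope_rmod xi i j s t : VF L xi ->
  slope xi i j (rmod (l i) s, rmod (l j) t) = slope xi i j (s, t).
Proof. by move=> xiV; rewrite /slope !gap_rmod//; exact: VF_link. Qed.

Lemma rigidity_min xi : (0 < k)%N -> VF L xi ->
  exists2 p, Strut L p & forall q, Strut L q -> rigidity L xi p <= rigidity L xi q.
Proof.
move=> k0 xiV.
have StrutC (q : 'I_k.+1 * R * ('I_k.+1 * R)) : Strut L q ->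
    [/\ (q.1.1 < q.2.1)%N, box q.1.1 q.2.1 (q.1.2, q.2.2) &
     enorm (gap L q.1.1 q.2.1 (q.1.2, q.2.2)) <= LThi L].
  move=> [/andP[a0 al] /andP[b0 bl] ij e]; split => //; last by rewrite -e.
  by split; rewrite /= in_itv/= ?a0 ?b0 ltW.
have [|||i [j [ij [p [_ pC pmin]]]]] := @pairs_min (slope xi)
  (fun i j => [set p | enorm (gap L i j p) <= LThi L]).
- move=> i j ij; apply: (@closed_comp _ _ (fun p => enorm (gap L i j p)) [set x | x <= LThi L]).
    by move=> p _; apply: continuous_enorm => c; apply: continuous_gap_coord; exact: VF_link.
  exact: closed_le.
- by move=> i j ij; exact: continuous_slope.
- have [q /StrutC[ij qb qC]] := Strut_nonempty k0.
  by exists q.1.1, q.2.1; split => //; exists (q.1.2, q.2.2).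
exists ((i, rmod (l i) p.1), (j, rmod (l j) p.2)); first exact: StrutP.
move=> q /StrutC[ij' qb qC].
rewrite rigidity_slope slope_rmod//; case: q qb qC ij' => -[i' s'] [j' t']/= qb qC ij'.
by rewrite rigidity_slope; case: p pC pmin => s t pC pmin; exact: pmin.
Qed.

End thickness_variation.

(** * One-sided derivative of the thickness *)

Section danskin.
Context {R : realType}.
Notation rV3 := 'rV[R]_3.
Variables (k : nat) (L : link R k).

Let flow (xi : 'I_k.+1 -> R -> rV3) (t : R) := fun i s => L i s + t *: xi i s.

Lemma gap_flow xi t i j p : gap (flow xi t) i j p = gap L i j p + t *: gap xi i j p.
Proof. by rewrite /gap /flow scalerBr opprD addrACA. Qed.

(* Danskin's formula. The pairs where the slope is at most [m - e] stay away from
   the struts, by compactness; elsewhere the lower bound comes from the convexity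
   of the Euclidean norm. *)
Lemma cvg_dLThi xi p : (0 < k)%N -> VF L xi -> Strut L p ->
  (forall q, Strut L q -> rigidity L xi p <= rigidity L xi q) ->
  t^-1 * (LThi (flow xi t) - LThi L) @[t --> 0^'+] --> rigidity L xi p.
Proof.
move=> k0 xiV pS pmin; set m := rigidity L xi p.
have [[[i s] [j t0]] /= pE] : exists q, p = q by exists p.
have [_ _ ij pL] := pS; rewrite pE/= in ij pL.
pose z := (s, t0); have D0 : 0 < enorm (gap L i j z) by exact: gap_gt0.
have mE : m = dot (gap xi i j z) (gap L i j z) / enorm (gap L i j z) by rewrite /m pE.
have [B B0 xiB] := VF_bounded xiV.
have gapB i' j' q : enorm (gap xi i' j' q) <= 2 * B.
  rewrite /gap (le_trans (ler_enormD _ _))// enormN.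
  by rewrite mulr2n mulrDl mul1r lerD.
apply/cvgrPdist_le => e e0.
have [eta eta0 far] : exists2 eta, 0 < eta & forall (i' j' : 'I_k.+1) q, (i' < j')%N ->
    slope L xi i' j' q <= m - e -> LThi L + eta <= enorm (gap L i' j' q).
  pose C i' j' := [set q | slope L xi i' j' q <= m - e].
  have rmodC i' j' q : C i' j' q ->
      C i' j' (rmod (period L i') q.1, rmod (period L j') q.2).
    by rewrite /C/= slope_rmod//; case: q.
  have [H|H] := pselect (exists i' j' : 'I_k.+1, (i' < j')%N /\ exists q,
      (`[0, period L i']%classic `*` `[0, period L j']%classic) q /\ C i' j' q); last first.
    exists 1 => // i' j' q ij' qC; exfalso; apply: H; exists i', j'; split => //.
    exists (rmod (period L i') q.1, rmod (period L j') q.2); split.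
      exact: rmod_box.
    exact: rmodC.
  have [|||i1 [j1 [ij1 [q [_ qC qmin]]]]] :=
      @pairs_min R k L (fun i j p => enorm (gap L i j p)) C.
  - move=> i' j' ij'.
    apply: (@closed_comp _ _ (slope L xi i' j') [set x | x <= m - e]).
      by move=> q _; exact: continuous_slope.
    exact: closed_le.
  - move=> i' j' ij'; apply: continuous_enorm => c.
    by apply: continuous_gap_coord; exact: VF_link.
  - exact: H.
  exists (enorm (gap L i1 j1 q) - LThi L).
    rewrite subr_gt0 lt_neqAle LThi_le// andbT; apply/negP => /eqP qL.
    have qS : enorm (gap L i1 j1 q) <= LThi L by rewrite qL.
    have := pmin _ (StrutP ij1 qS); rewrite rigidity_slope slope_rmod//.
    have {}qC : slope L xi i1 j1 (q.1, q.2) <= m - e by case: q qC {qmin qL qS}.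
    by rewrite -/m => /le_trans /(_ qC); rewrite lerBrDr gerDl leNgt e0.
  move=> i' j' q' ij' q'C; rewrite addrC subrK.
  have := qmin i' j' (rmod (period L i') q'.1, rmod (period L j') q'.2) ij'
    (rmod_box _ _ _ _ _) (rmodC _ _ _ q'C).
  rewrite gap_rmod; last exact: VF_link.
  by case: q' {q'C}.
pose EE := dot (gap xi i j z) (gap xi i j z).
have EE0 : 0 <= EE by exact: dot_ge0.
near=> t.
have t_gt0 : 0 < t by near: t; exact: nbhs_right_gt.
(* The strut [z] alone bounds the thickness from above; the second-order term is at most [t * e] for
   small [t]. *)
have up : LThi (flow xi t) - LThi L <= t * (m + e).
  rewrite lerBlDr (le_trans (LThi_le (flow xi t) z ij))//.
  rewrite gap_flow (le_trans (enorm_add_le _ _ D0))// -mE pL.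
  rewrite [X in X + _ <= _]addrC addrAC lerD2r mulrDr lerD2l expr2 -!mulrA.
  rewrite ler_pM2l// mulrA ler_pdivrMr ?mulr_gt0 -?pL//.
  have tE : t * (EE + 1) <= e * (2 * enorm (gap L i j z)).
    rewrite -ler_pdivlMr ?ltr_wpDl//; near: t; apply: nbhs_right_le.
    by rewrite divr_gt0 ?mulr_gt0 ?ltr_wpDl.
  by rewrite (le_trans _ tE)// ler_pM2l// -/EE lerDl.
have lo : t * (m - e) <= LThi (flow xi t) - LThi L.
  rewrite lerBrDr; apply: le_LThi => // i' j' q ij'.
  have D'0 : 0 < enorm (gap L i' j' q) by exact: gap_gt0.
  rewrite gap_flow.
  have [sle|sgt] := leP (slope L xi i' j' q) (m - e).
    have h1 := far _ _ _ ij' sle.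
    have h2 := ler_enormD (gap L i' j' q + t *: gap xi i' j' q) (- (t *: gap xi i' j' q)).
    rewrite addrK enormN enormZ (gtr0_norm t_gt0) in h2.
    have h3 : t * enorm (gap xi i' j' q) <= t * (2 * B) by rewrite ler_pM2l.
    (* For pairs of small slope, the excess [eta] absorbs both the displacement, at most
       [t * (2 * B)], and the target [t * (m - e)]. *)
    have h4 : t * (2 * B + `|m - e|) <= eta.
      rewrite -ler_pdivlMr ?ltr_wpDr ?mulr_gt0//; near: t; apply: nbhs_right_le.
      by rewrite divr_gt0// ltr_wpDr ?mulr_gt0.
    have h5 : t * (m - e) <= t * `|m - e| by rewrite ler_pM2l// ler_norm.
    rewrite mulrDr in h4; lra.
  rewrite (le_trans _ (enorm_add_ge _ _ D'0))// addrC lerD ?LThi_le//.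
  by rewrite ler_pM2l// ltW.
rewrite ler_distlC; apply/andP; split.
  by rewrite ler_pdivlMl.
by rewrite ler_pdivrMl.
Unshelve. all: end_near. Qed.

Lemma dLThi_min xi p : (0 < k)%N -> VF L xi -> Strut L p ->
  (forall q, Strut L q -> rigidity L xi p <= rigidity L xi q) ->
  dLThi L xi = rigidity L xi p.
Proof. by move=> k0 xiV pS pmin; apply/cvg_lim => //; exact: cvg_dLThi. Qed.

Lemma LThi0 g : k = 0%N -> LThi (k := k) (R := R) g = 0.
Proof.
move=> k0; rewrite /LThi [X in inf X](_ : _ = set0) ?inf0//.
apply/seteqP; split => // r [i [j [s [t [+ _]]]]].
have i0 (a : 'I_k.+1) : a = ord0.
  by apply: val_inj; case: a => -[|m] /=; rewrite k0.
by rewrite (i0 i) (i0 j) eqxx.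
Qed.

Lemma dLThi0 xi : k = 0%N -> dLThi L xi = 0.
Proof.
move=> k0; apply/cvg_lim => //; under eq_fun do rewrite !LThi0// subrr mulr0.
exact: cvg_cst.
Qed.

Lemma VFsmooth0 : VFsmooth L (fun _ _ => 0).
Proof.
split=> [i|i n s].
  by split => [s|s //]; exact: cvg_cst.
have -> : derive1n n (fun=> 0) = (fun=> 0) :> (R -> rV3).
  elim: n => // n; rewrite derive1nS => ->.
  by apply/funext => x; rewrite derive1E; exact: derive_cst.
exact: derivable_cst.
Qed.

Hypothesis hL : arclength_parametrized L.

Lemma VFsmooth_dLenZ a xi : VFsmooth L xi -> VFsmooth L (fun i s => a *: xi i s) /\
  dLen L (fun i s => a *: xi i s) = a * dLen L xi.
Proof.
move=> sx; have s0 := VFsmooth0.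
have e : (fun i s => a *: xi i s) = vf_lin a xi (fun _ _ => 0).
  by apply/funext => i; apply/funext => s; rewrite /vf_lin addr0.
have e0 : dLen L (fun _ _ => 0) = 0.
  have := dLen_lin hL 1 s0 s0; rewrite mul1r.
  have -> : vf_lin 1 (fun _ _ => 0) (fun _ _ => 0) = (fun _ _ => 0) :> ('I_k.+1 -> R -> rV3).
    by apply/funext => i; apply/funext => s; rewrite /vf_lin scaler0 addr0.
  by move/eqP; rewrite -subr_eq0 opprD addrA subrr sub0r oppr_eq0 => /eqP.
by rewrite e; split; [exact: VFsmooth_lin|rewrite (dLen_lin hL a sx s0) e0 addr0].
Qed.

Lemma rigidityZ a xi p : rigidity L (fun i s => a *: xi i s) p = a * rigidity L xi p.
Proof. by rewrite /rigidity/= -scalerBr dotZl mulrA. Qed.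

(** Scaled by [- (dLen L xi)^-1], a field with positive [dLen] is admissible, and its thickness
    derivative is the rigidity at some strut [p]; scaling back,
    [eps * dLen L xi <= rigidity L xi p]. *)
Lemma strongly_critical_bound : strongly_critical L ->
  exists2 M : R, 0 <= M & forall xi b, VFsmooth L xi -> 0 <= b ->
    (forall p, Strut L p -> rigidity L xi p <= b) -> dLen L xi <= M * b.
Proof.
move=> [eps eps0 H]; exists eps^-1; first by rewrite invr_ge0 ltW.
move=> xi b sx b0 bS; have [le0|gt0] := leP (dLen L xi) 0.
  by rewrite (le_trans le0)// mulr_ge0// invr_ge0 ltW.
have [sx' dx'] := VFsmooth_dLenZ (- (dLen L xi)^-1) sx.
have /(H _ sx') : dLen L (fun i s => - (dLen L xi)^-1 *: xi i s) = -1.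
  by rewrite dx' mulNr mulVf// gt_eqF.
(* For a single component the thickness is constantly 0, so strong criticality excludes this
   field. *)
have [k0|k0] := posnP k.
  by rewrite dLThi0// oppr_ge0 leNgt eps0.
have [p pS pmin] := rigidity_min k0 (proj1 sx').
rewrite (dLThi_min k0 (proj1 sx') pS pmin) rigidityZ mulNr lerN2 => le.
rewrite ler_pdivlMl//.
rewrite mulrC ler_pdivlMr// in le.
rewrite (le_trans le)//; exact: bS.
Qed.

End danskin.

(** * Representation of positive functionals *)

Section hahn_banach.
Context {R : realType} {V : lmodType R}.
Variables (D : set V) (p : V -> R).
Hypothesis D0 : D 0.
Hypothesis D_lin : forall (a : R) x y, D x -> D y -> D (a *: x + y).
Hypothesis p_sub : forall x y, D x -> D y -> p (x + y) <= p x + p y.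
Hypothesis p_hom : forall (a : R) x, 0 <= a -> D x -> p (a *: x) = a * p x.

(** Graphs of partial linear functionals below [p]. That they are single-valued follows from
    domination at the zero vector. *)
Let dominated (A : set (V * R)) := [/\ A (0, 0),
  forall (a : R) x r y s, A (x, r) -> A (y, s) -> A (a *: x + y, a * r + s) &
  forall x r, A (x, r) -> D x /\ r <= p x].

Let p0 : p 0 = 0. Proof. by rewrite -(scale0r 0) p_hom// mul0r. Qed.

Let DZ (a : R) x : D x -> D (a *: x).
Proof. by move=> Dx; rewrite -[_ *: _]addr0; exact: D_lin. Qed.

Let dominated_fun A : dominated A -> forall x r s, A (x, r) -> A (x, s) -> r = s.
Proof.
move=> [_ linA domA] x r s Ar As.
have sub u v : A (x, u) -> A (x, v) -> v <= u.
  move=> Au Av; have := linA (-1) _ _ _ _ Au Av.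
  by rewrite scaleN1r addNr => /domA[_]; rewrite p0 mulN1r addrC subr_le0.
by apply/eqP; rewrite eq_le !sub.
Qed.

(** The new value must lie above every [r - p (x - x0)] and below every [p (y + x0) - s];
    subadditivity makes these compatible, and the supremum of the lower bounds is taken. Other
    multiples of [x0] reduce to these by homogeneity. *)
Let dominated_extend A x0 : dominated A -> D x0 ->
  exists r0 : R, dominated [set z | exists x r (t : R), A (x, r) /\ z = (x + t *: x0, r + t * r0)].
Proof.
move=> [A0 linA domA] Dx0.
pose E := [set u | exists x r, A (x, r) /\ u = r - p (x - x0)].
have AD x r : A (x, r) -> D x by move=> /domA[].
have DB x y : D x -> D y -> D (x - y).
  by move=> Dx Dy; rewrite addrC -scaleN1r; exact: D_lin.
have DA x y : D x -> D y -> D (x + y).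
  by move=> Dx Dy; rewrite -[x]scale1r; exact: D_lin.
have Eub y s : A (y, s) -> ubound E (p (y + x0) - s).
  move=> Ays _ [x [r [Axr ->]]]; rewrite lerBrDr addrAC lerBlDr.
  have := linA 1 _ _ _ _ Axr Ays; rewrite scale1r mul1r => /domA[_ le].
  rewrite (le_trans le)// (_ : x + y = (y + x0) + (x - x0)); last first.
    by rewrite addrACA subrr addr0 addrC.
  by apply: p_sub; [exact: DA (AD _ _ Ays) Dx0|exact: DB (AD _ _ Axr) Dx0].
have E0 : E !=set0 by exists (0 - p (0 - x0)), 0, 0.
have supE : has_sup E by split => //; exists (p (0 + x0) - 0); exact: Eub.
have r0ge x r : A (x, r) -> r - p (x - x0) <= sup E.
  by move=> Axr; apply: ub_le_sup; [exact: supE.2|exists x, r].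
have r0le y s : A (y, s) -> sup E <= p (y + x0) - s.
  by move=> Ays; apply: ge_sup => //; exact: Eub.
exists (sup E); split.
- by exists 0, 0, 0; rewrite scale0r mul0r !addr0.
- move=> a _ _ _ _ [x [r [t [Axr [-> ->]]]]] [y [s [u [Ays [-> ->]]]]].
  exists (a *: x + y), (a * r + s), (a * t + u); split; first exact: linA.
  congr pair; last by ring.
  by rewrite scalerDr scalerDl scalerA addrACA.
move=> _ _ [x [r [t [Axr [-> ->]]]]]; have Dx := AD _ _ Axr.
split; first by rewrite addrC; exact: D_lin.
have scaleA (c : R) : A (c *: x, c * r).
  by have := linA c _ _ _ _ Axr A0; rewrite !addr0.
have [t0|t0|->] := ltgtP t 0; last by rewrite scale0r mul0r !addr0; case: (domA _ _ Axr).
- have u0 : 0 < - t by rewrite oppr_gt0.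
  have := r0ge _ _ (scaleA (- t)^-1).
  rewrite -(ler_pM2l u0) mulrBr mulrA divff ?gt_eqF// mul1r.
  rewrite -p_hom ?(ltW u0)//; last by apply: DB => //; exact: DZ.
  rewrite scalerBr scalerA divff ?gt_eqF// scale1r scaleNr opprK.
  by rewrite mulNr; lra.
- have := r0le _ _ (scaleA t^-1).
  rewrite -(ler_pM2l t0) mulrBr mulrA divff ?gt_eqF// mul1r.
  rewrite -p_hom ?(ltW t0)//; last by apply: DA => //; exact: DZ.
  by rewrite scalerDr scalerA divff ?gt_eqF// scale1r; lra.
Qed.

(* The functional to be extended is given by its graph [G]. *)
Theorem hahn_banach (G : set (V * R)) : G (0, 0) ->
  (forall (a : R) x r y s, G (x, r) -> G (y, s) -> G (a *: x + y, a * r + s)) ->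
  (forall x r, G (x, r) -> D x /\ r <= p x) ->
  exists Lambda : V -> R, [/\
    forall (a : R) x y, D x -> D y -> Lambda (a *: x + y) = a * Lambda x + Lambda y,
    forall x, D x -> Lambda x <= p x & forall x r, G (x, r) -> Lambda x = r].
Proof.
move=> G0 linG domG.
(* Zorn's lemma is applied to what is added to [G], so that the empty chain also has an admissible
   union. *)
have [|A [domA maxA]] := @Zorn_bigcup _ (fun A => dominated (G `|` A)).
  move=> F FP tot; split.
  - by left.
  - move=> a x r y s.
    have two X : F X -> (G `|` X) (x, r) -> (G `|` X) (y, s) ->
        (G `|` \bigcup_(X in F) X) (a *: x + y, a * r + s).
      move=> FX hx hy; have [_ lin _] := FP X FX.
      by have [?|?] := lin a _ _ _ _ hx hy; [left|right; exists X].
    move=> [Gx|[X FX Xx]] [Gy|[Y FY Yy]].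
    + by left; exact: linG.
    + by apply: (two Y) => //; [left|right].
    + by apply: (two X) => //; [right|left].
    + have [XY|YX] := tot X Y FX FY.
        by apply: (two Y) => //; right => //; exact: XY.
      by apply: (two X) => //; right => //; exact: YX.
  - move=> x r [/domG//|[X FX Xx]].
    by have [_ _] := FP X FX; apply; right.
pose M := G `|` A.
have tot x : D x -> exists r, M (x, r).
  move=> Dx; apply: contrapT => H.
  have [r0 domB] := dominated_extend domA Dx.
  set B := [set z | _] in domB.
  have MB : M `<=` B.
    by move=> [y r] My; exists y, r, 0; rewrite scale0r mul0r !addr0.
  apply: (maxA B).
    split; first by move=> z Az; apply: MB; right.
    move=> BA; apply: H; exists r0; right; apply: BA.
    exists 0, 0, 1; rewrite scale1r mul1r !add0r; split => //.
    by case: domA.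
  by rewrite (_ : G `|` B = B)//; apply/seteqP; split => [z [Gz|//]|z Bz];
    [apply: MB; left|right].
have /choice[Lam LamP] : forall x, exists r, D x -> M (x, r).
  by move=> x; have [/tot[r Mr]|nD] := pselect (D x); [exists r|exists 0].
have funM := dominated_fun domA; have [_ linM domM] := domA.
exists Lam; split.
- move=> a x y Dx Dy; apply: (funM (a *: x + y)).
    by apply: LamP; exact: D_lin.
  by apply: linM; exact: LamP.
- by move=> x Dx; have [] := domM _ _ (LamP x Dx).
- move=> x r Gxr; apply: (funM x); last by left.
  by apply: LamP; have [] := domG _ _ Gxr.
Qed.

End hahn_banach.

(** * Positive functionals and quantile functions *)

Section one_dimensional_riesz.
Context {R : realType}.
Notation mu := (@lebesgue_measure R).

Lemma segment_unif_continuous (g : R -> R) (a b e : R) : continuous g -> 0 < e ->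
  exists2 d, 0 < d & forall x y, a <= x <= b -> `|x - y| <= d -> `|g x - g y| <= e.
Proof.
move=> cg e0.
have /compact_near_coveringP := @segment_compact R a b.
move=> /(_ R 0^'+ (fun d x => forall y, `|x - y| <= d -> `|g x - g y| <= e) _) [].
  move=> x _; have /cvgrPdist_lt /(_ (e / 2)) := cg x.
  rewrite divr_gt0// => /(_ isT) [r /= r0 gr].
  exists (ball x (r / 2), [set d | d < r / 2]).
    split=> /=; first by exists (r / 2) => //=; rewrite divr_gt0.
    by apply: nbhs_right_lt; rewrite divr_gt0.
  move=> [x' d] /= [xx' dr] y x'y.
  have h1 := gr x' _; have h2 := gr y _.
  rewrite (_ : g x' - g y = (g x - g y) - (g x - g x')); last by ring.
  rewrite (le_trans (ler_normB _ _))// (splitr e) lerD// ltW//.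
    apply: h2; rewrite /= (_ : x - y = (x - x') + (x' - y)); last by ring.
    rewrite (le_lt_trans (ler_normD _ _))// (splitr r) ltrD//.
    exact: le_lt_trans x'y dr.
  apply: h1; rewrite /= (lt_trans xx')// gtr_pMr// ; lra.
move=> r /= r0 H.
exists (r / 2); first by rewrite divr_gt0.
move=> x y xab xy; apply: (H (r / 2)) => //=.
- by rewrite sub0r normrN gtr0_norm ?divr_gt0// gtr_pMr//; lra.
- by rewrite divr_gt0.
Qed.

Variables (T : Type) (S : set T) (Lam : (T -> R) -> R).

Definition bounded_on (f : T -> R) := exists B, forall x, S x -> `|f x| <= B.

Hypothesis Lam_lin : forall a f g, bounded_on f -> bounded_on g ->
  Lam (fun x => a * f x + g x) = a * Lam f + Lam g.
Hypothesis Lam_pos : forall f, bounded_on f -> (forall x, S x -> 0 <= f x) ->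
  0 <= Lam f.

Lemma bounded_on_cst c : bounded_on (fun=> c).
Proof. by exists `|c|. Qed.

Lemma bounded_on_lin a f g : bounded_on f -> bounded_on g ->
  bounded_on (fun x => a * f x + g x).
Proof.
move=> [B fB] [C gC]; exists (`|a| * B + C) => x Sx.
rewrite (le_trans (ler_normD _ _))// normrM lerD ?gC//.
by rewrite ler_wpM2l// fB.
Qed.

Lemma bounded_onB f g : bounded_on f -> bounded_on g ->
  bounded_on (fun x => f x - g x).
Proof.
move=> [B fB] [C gC]; exists (B + C) => x Sx.
by rewrite (le_trans (ler_normB _ _))// lerD ?fB ?gC.
Qed.

Lemma bounded_onM f g : bounded_on f -> bounded_on g ->
  bounded_on (fun x => f x * g x).
Proof.
move=> [B fB] [C gC]; exists (B * C) => x Sx.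
by rewrite normrM ler_pM// ?fB ?gC.
Qed.

Lemma LamB f g : bounded_on f -> bounded_on g ->
  Lam (fun x => f x - g x) = Lam f - Lam g.
Proof.
move=> bf bg; have := Lam_lin (-1) bg bf; rewrite mulN1r addrC => <-.
by congr Lam; apply/funext => x; rewrite mulN1r addrC.
Qed.

Lemma LamZ a f : bounded_on f -> Lam (fun x => a * f x) = a * Lam f.
Proof.
move=> bf; have z0 : Lam (fun=> 0) = 0.
  have := LamB (bounded_on_cst 0) (bounded_on_cst 0); rewrite subrr.
  by move=> ->; rewrite subrr.
have := Lam_lin a bf (bounded_on_cst 0); rewrite z0 addr0 => <-.
by congr Lam; apply/funext => x; rewrite addr0.
Qed.

Lemma le_Lam f g : bounded_on f -> bounded_on g ->
  (forall x, S x -> f x <= g x) -> Lam f <= Lam g.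
Proof.
move=> bf bg fg; rewrite -subr_ge0 -LamB//; apply: Lam_pos.
  exact: bounded_onB.
by move=> x Sx; rewrite subr_ge0 fg.
Qed.

Lemma eq_Lam f g : bounded_on f -> bounded_on g ->
  (forall x, S x -> f x = g x) -> Lam f = Lam g.
Proof.
move=> bf bg fg; apply/eqP; rewrite eq_le !le_Lam// => x Sx; by rewrite fg.
Qed.

Lemma ler_norm_Lam f h : bounded_on f -> bounded_on h ->
  (forall x, S x -> `|f x| <= h x) -> `|Lam f| <= Lam h.
Proof.
move=> bf bh fh; rewrite ler_norml -mulN1r -LamZ//; apply/andP; split.
  apply: le_Lam => //; last by move=> x /fh; rewrite ler_norml mulN1r => /andP[].
  by apply: bounded_onM => //; exact: bounded_on_cst.
by apply: le_Lam => // x Sx; rewrite (le_trans (ler_norm _))// fh.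
Qed.

(* [Q] is the quantile function of [x |-> Lam 1_(c <= x)]. *)
Theorem riesz_quantile (c : T -> R) : (forall x, S x -> 0 < c x <= 1) ->
  exists Q : R -> R, [/\ {homo Q : u v / u <= v}, forall u, 0 <= Q u <= 1 &
    forall g : R -> R, continuous g ->
      \int[mu]_(u in `]0, Lam (fun=> 1)]) g (Q u) = Lam (fun x => g (c x))].
Proof.
move=> c01.
pose h (x : R) (p : T) : R := (c p <= x)%R%:R.
have bh x : bounded_on (h x).
  by exists 1 => p _; rewrite /h; case: (c p <= x); rewrite ?normr1 ?normr0.
pose F x := Lam (h x).
have Fnd x y : x <= y -> F x <= F y.
  move=> xy; apply: le_Lam => // p _; rewrite /h ler_nat.
  by case: (boolP (c p <= x)) => // /le_trans /(_ xy) ->.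
have F0 : F 0 = 0.
  rewrite /F (@eq_Lam _ (fun=> 0 * 1)) ?LamZ ?mul0r//; try exact: bounded_on_cst.
  by move=> p /c01 /andP[c0 _]; rewrite /h leNgt c0.
have F1 : F 1 = Lam (fun=> 1).
  apply: eq_Lam => //; first exact: bounded_on_cst.
  by move=> p /c01 /andP[_ c1]; rewrite /h c1.
(* The alternative [x = 1] keeps the set nonempty for [u > F 1], beyond the range of integration. *)
pose E u := [set x | 0 <= x <= 1 /\ (u <= F x \/ x = 1)].
have E1 u : E u 1 by split; [rewrite ler01 lexx|right].
have lbE u : has_lbound (E u) by exists 0 => x [/andP[]].
pose Q u := inf (E u).
have Q01 u : 0 <= Q u <= 1.
  apply/andP; split.
    by apply: lb_le_inf; [exists 1; exact: E1|move=> x [/andP[]]].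
  by apply: ge_inf; [exact: lbE|exact: E1].
have Qnd : {homo Q : u v / u <= v}.
  move=> u v uv; apply: lb_le_inf; first by exists 1; exact: E1.
  move=> x [x01 [vx|->]]; apply: ge_inf => //.
  by split => //; left; exact: le_trans vx.
have QF x y u : 0 <= x -> x <= y -> y <= 1 -> F x < u -> u <= F y -> x <= Q u <= y.
  move=> x0 xy y1 xu uy; apply/andP; split; last first.
    apply: ge_inf; first exact: lbE.
    by split; [rewrite (le_trans x0)|left].
  apply: lb_le_inf; first by exists 1; exact: E1.
  move=> z [/andP[z0 z1] [uz|->]]; last exact: le_trans y1.
  by rewrite leNgt; apply/negP => /ltW/Fnd; rewrite leNgt (lt_le_trans xu uz).
exists Q; split => // g cg.
have mQ (D : set R) : measurable D -> measurable_fun D (g \o Q).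
  move=> mD; apply: measurableT_comp; first exact: continuous_measurable_fun.
  exact: nondecreasing_measurable.
have [B gB] : exists B, forall x, 0 <= x <= 1 -> `|g x| <= B.
  have cn : {within `[0, 1], continuous (fun x => `|g x|)}.
    apply: continuous_subspaceT => x.
    by apply: continuous_comp; [exact: cg|exact: norm_continuous].
  have [d _ dmax] := EVT_max (@ler01 R) cn.
  by exists `|g d| => x x01; apply: dmax; rewrite in_itv.
have iQ a b : mu.-integrable `]a, b] (EFin \o (fun u => g (Q u))).
  apply: measurable_bounded_integrable => //.
  - have : (mu (`]a, b]%classic : set R) < +oo)%E; last by [].
    rewrite lebesgue_measure_itv/=; case: ifP => _; last by rewrite ltry.
    by rewrite -EFinD ltry.
  - exact: mQ.
  - by exists B; split; [exact: num_real|move=> M /ltW BM x _; exact: le_trans (gB _ _) BM].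
have bgc : bounded_on (fun p => g (c p)).
  by exists B => p /c01 /andP[/ltW c0 c1]; rewrite gB// c0 c1.
have V0 : 0 <= Lam (fun=> 1).
  by apply: Lam_pos => //; exact: bounded_on_cst.
set V := Lam (fun=> 1) in V0 F1 *.
suff key e : 0 < e ->
    `|\int[mu]_(u in `]0, V]) g (Q u) - Lam (fun p => g (c p))| <= e * 2 * V.
  apply/eqP; rewrite -subr_eq0 -normr_le0; apply/ler_addgt0Pr => e e0; rewrite add0r.
  have e'0 : 0 < e / (2 * V + 1) by rewrite divr_gt0// ltr_wpDl// mulr_ge0.
  rewrite (le_trans (key _ e'0))// -mulrA mulrAC ler_pdivrMr ?ltr_wpDl ?mulr_ge0//.
  by rewrite ler_pM2l// lerDl.
move=> e0; have [d d0 gd] := segment_unif_continuous 0 1 cg e0.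
pose N := (Num.bound d^-1).+1.
have N0 : 0 < N%:R :> R by rewrite ltr0n.
have Nd : N%:R^-1 <= d.
  rewrite -[leRHS]invrK lef_pV2 ?posrE ?invr_gt0//.
  rewrite (le_trans (ltW (archi_boundP _)))// ?invr_ge0 ?(ltW d0)//.
  by rewrite ler_nat.
pose x i : R := i%:R / N%:R.
have x01 i : (i <= N)%N -> 0 <= x i <= 1.
  by move=> iN; rewrite divr_ge0//= ler_pdivrMr// mul1r ler_nat.
have xS i : x i.+1 = x i + N%:R^-1 by rewrite /x -natr1 mulrDl mul1r.
have bgh y : bounded_on (fun p => g (c p) * h y p) by exact: bounded_onM.
(* Each step of the partition costs [e * (F b - F a)] twice: in the integral, where [Q u] lies
   between [a] and [b] for [u] in []F a, F b]], and in the functional, where [h b - h a] selects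
   [a < c p <= b]. *)
suff claim i : (i <= N)%N ->
    `|\int[mu]_(u in `]0, F (x i)]) g (Q u) - Lam (fun p => g (c p) * h (x i) p)|
    <= e * 2 * F (x i).
  have := claim N (leqnn N); rewrite /x divff ?gt_eqF// F1 -/V.
  rewrite (@eq_Lam (fun p => g (c p) * h 1 p) (fun p => g (c p)))//.
  by move=> p /c01 /andP[_ c1]; rewrite /h c1 mulr1.
elim: i => [_|i ih iN].
  rewrite /x mul0r F0 mulr0 set_itv_ge ?bnd_simp// Rintegral_set0 sub0r normrN.
  rewrite (@eq_Lam _ (fun=> 0 * 1)) ?LamZ ?mul0r ?normr0//; try exact: bounded_on_cst.
  by move=> p /c01 /andP[c0 _]; rewrite /h leNgt c0 mulr0.
have {}ih := ih (ltnW iN).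
have /andP[a0 a1] := x01 i (ltnW iN); have /andP[b0 b1] := x01 i.+1 iN.
set a := x i in ih a0 a1 *; set b := x i.+1 in b0 b1 *.
have ab : a <= b by rewrite /b xS lerDl invr_ge0 ltW.
have bad : b - a <= d by rewrite /b xS -/a addrC addKr.
have Fab := Fnd _ _ ab.
have F_ge0 y : 0 <= F y.
  by apply: Lam_pos => // p _; rewrite /h ler0n.
have gb y : a <= y <= b -> `|g y - g b| <= e.
  move=> /andP[ay yb]; apply: gd; first by rewrite (le_trans a0 ay) (le_trans yb b1).
  by rewrite distrC ger0_norm ?subr_ge0//; lra.
have A1 : \int[mu]_(u in `]0, F b]) g (Q u) = \int[mu]_(u in `]0, F a]) g (Q u) +
    \int[mu]_(u in `]F a, F b]) g (Q u).
  by rewrite -(@Rintegral_itvB _ _ (BRight 0) (BRight (F b)) (F a)) ?bnd_simp// addrCA subrr addr0.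
have mFab : mu `]F a, F b] = (F b - F a)%:E.
  rewrite lebesgue_measure_itv/= lte_fin; case: ltP => // FbFa.
  by rewrite (_ : F b = F a) ?subrr//; apply/eqP; rewrite eq_le Fab FbFa.
have ic (z y1 y2 : R) : mu.-integrable `]y1, y2] (EFin \o cst z).
  apply: (@integrableS _ _ _ mu `[y1, y2]) => //; first exact: subset_itv_oc_cc.
  by apply: continuous_itv_integrable => y; exact: cvg_cst.
have A2 : `|\int[mu]_(u in `]F a, F b]) g (Q u) - g b * (F b - F a)| <= e * (F b - F a).
  have intc (z : R) : \int[mu]_(u in `]F a, F b]) (cst z u) = z * (F b - F a).
    by rewrite Rintegral_cst//= mFab.
  rewrite -(intc (g b)) -RintegralB//.
  have iB : mu.-integrable `]F a, F b] (EFin \o (fun u => g (Q u) - g b)).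
    have := @integrableB _ (measurableTypeR R) R mu _ (measurable_itv `]F a, F b]) _ _ (iQ _ _) (ic (g b) _ _).
    by apply: eq_integrable => // u _ /=; rewrite EFinB.
  rewrite (le_trans (le_normr_Rintegral _ iB))// -(intc e).
  apply: le_Rintegral => //; first exact: (integrable_norm iB).
  move=> u /=; rewrite in_itv/= => /andP[Fau uFb].
  by apply: gb; apply: QF.
have A3 : `|Lam (fun p => g (c p) * h b p) - Lam (fun p => g (c p) * h a p)
    - g b * (F b - F a)| <= e * (F b - F a).
  have bd z : bounded_on (fun p => z * h b p - z * h a p).
    by apply: bounded_onB; apply: bounded_onM => //; exact: bounded_on_cst.
  have Fz z : Lam (fun p => z * h b p - z * h a p) = z * (F b - F a).
    have bz y : bounded_on (fun p => z * h y p).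
      by apply: bounded_onM => //; exact: bounded_on_cst.
    by rewrite LamB// !LamZ// mulrBr.
  have bBg : bounded_on (fun p => g (c p) * h b p - g (c p) * h a p).
    exact: bounded_onB.
  rewrite -LamB// -Fz -LamB// -Fz; apply: ler_norm_Lam => //.
    exact: bounded_onB.
  move=> p Sp; rewrite -!mulrBr -mulrBl normrM.
  have [cb|bc] := leP (c p) b; last first.
    have ca : (c p <= a) = false by apply/negbTE; rewrite -ltNge (le_lt_trans ab).
    have cb : (c p <= b) = false by apply/negbTE; rewrite -ltNge.
    by rewrite /h cb ca/= subrr normr0 !mulr0.
  have [ca|ac] := leP (c p) a.
    by rewrite /h ca (le_trans ca ab)/= subrr normr0 !mulr0.
  have ca : (c p <= a) = false by apply/negbTE; rewrite -ltNge.
  rewrite /h cb ca/= subr0 normr1 !mulr1.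
  by apply: gb; rewrite cb ltW.
rewrite A1 (_ : _ - _ = (\int[mu]_(u in `]0, F a]) g (Q u) - Lam (fun p => g (c p) * h a p))
  + ((\int[mu]_(u in `]F a, F b]) g (Q u) - g b * (F b - F a)) -
  (Lam (fun p => g (c p) * h b p) - Lam (fun p => g (c p) * h a p)
    - g b * (F b - F a)))); last by ring.
rewrite (le_trans (ler_normD _ _))//.
rewrite (_ : e * 2 * F b = e * 2 * F a + (e * (F b - F a) + e * (F b - F a))); last by ring.
by rewrite lerD// (le_trans (ler_normB _ _))// lerD.
Qed.

End one_dimensional_riesz.

(** * A code of the unit square with a Hoelder continuous inverse *)

Section mcshane_extension.
Context {R : realType}.

(** The exponent 1/4 compares base 16 with base 2: agreement of [m] digits means a distance of order
    [16^-1 ^+ m] between codes and [2^-1 ^+ m] between points. *)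
Let w (z : R) := Num.sqrt (Num.sqrt `|z|).

Let w_ge0 z : 0 <= w z. Proof. exact: sqrtr_ge0. Qed.

Let le_w z z' : `|z| <= `|z'| -> w z <= w z'.
Proof. by move=> zz; rewrite ler_wsqrtr// ler_wsqrtr. Qed.

Let sqrtrD_le (x y : R) : 0 <= x -> 0 <= y ->
  Num.sqrt (x + y) <= Num.sqrt x + Num.sqrt y.
Proof.
move=> x0 y0; rewrite -(@ler_pXn2r _ 2)// ?nnegrE ?addr_ge0 ?sqrtr_ge0//.
rewrite sqr_sqrtr ?addr_ge0// sqrrD !sqr_sqrtr// addrAC lerDl.
by rewrite mulrn_wge0// mulr_ge0// sqrtr_ge0.
Qed.

Let wD z z' : w (z + z') <= w z + w z'.
Proof.
rewrite /w (le_trans _ (sqrtrD_le (sqrtr_ge0 _) (sqrtr_ge0 _)))//.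
rewrite ler_wsqrtr// (le_trans _ (sqrtrD_le (normr_ge0 _) (normr_ge0 _)))//.
by rewrite ler_wsqrtr// ler_normD.
Qed.

(* McShane's extension for the modulus of continuity [4 * w]. *)
Lemma hoelder_extension (P : Type) (S : set P) (c f : P -> R) : S !=set0 ->
  (forall p, S p -> 0 <= f p) ->
  (forall p q, S p -> S q -> `|f p - f q| <= 4 * w (c p - c q)) ->
  exists2 d : R -> R, continuous d & forall p, S p -> d (c p) = f p.
Proof.
move=> [p0 Sp0] f0 cf.
pose E x := [set y | exists2 p, S p & y = f p + 4 * w (x - c p)].
have E0 x : E x !=set0 by exists (f p0 + 4 * w (x - c p0)), p0.
have lbE x : has_lbound (E x).
  by exists 0 => _ [p Sp ->]; rewrite addr_ge0 ?f0// mulr_ge0.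
have dd x y : inf (E x) <= inf (E y) + 4 * w (x - y).
  rewrite -lerBlDr; apply: lb_le_inf => // _ [p Sp ->].
  rewrite lerBlDr (@le_trans _ _ (f p + 4 * w (x - c p)))//.
    by apply: ge_inf => //; exists p.
  rewrite -addrA lerD2l -mulrDr ler_wpM2l//.
  by rewrite (_ : x - c p = (y - c p) + (x - y)) ?wD//; ring.
exists (fun x => inf (E x)); last first.
  move=> p Sp; apply/eqP; rewrite eq_le; apply/andP; split.
    apply: ge_inf => //; exists p => //.
    by rewrite subrr /w normr0 sqrtr0 sqrtr0 mulr0 addr0.
  apply: lb_le_inf => // _ [q Sq ->].
  by rewrite -lerBlDl (le_trans (ler_norm _))// cf.
move=> x; apply/cvgrPdist_le => e e0.
near=> y.
have wxy : 4 * w (x - y) <= e.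
  have e4 : 0 <= e / 4 by rewrite divr_ge0// ltW.
  rewrite mulrC -ler_pdivlMr//.
  rewrite (_ : e / 4 = Num.sqrt (Num.sqrt ((e / 4) ^+ 2 ^+ 2))); last first.
    by rewrite sqrtr_sqr ger0_norm ?sqr_ge0// sqrtr_sqr ger0_norm.
  rewrite ler_wsqrtr// ler_wsqrtr//; near: y.
  by apply: cvgr_dist_le => //; rewrite !exprn_gt0// divr_gt0.
have := dd x y; have := dd y x.
have -> : w (y - x) = w (x - y) by rewrite /w distrC.
by rewrite ler_distl; lra.
Unshelve. all: end_near. Qed.

End mcshane_extension.

Section interleaved_digits.
Context {R : realType}.

Section digits.
Variables (P : Type) (e : P -> nat -> nat).
Hypothesis e3 : forall p n, (e p n <= 3)%N.

Let psum (p : P) N : R := \sum_(n < N) (e p n)%:R * 16^-1 ^+ n.+1.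

Let psumS p N : psum p N.+1 = psum p N + (e p N)%:R * 16^-1 ^+ N.+1.
Proof. by rewrite /psum big_ord_recr. Qed.

Let q0 n : 0 <= 16^-1 ^+ n :> R.
Proof. by rewrite exprn_ge0// invr_ge0. Qed.

Let psum_le p N m : psum p N <= psum p (N + m).
Proof.
elim: m => [|m ih]; first by rewrite addn0.
by rewrite addnS psumS (le_trans ih)// lerDl mulr_ge0.
Qed.

(** Geometric tail: digits at most 3 in base 16 sum to at most [3 / 15], hence the factor 1/5. *)
Let psum_ub p N m : psum p (N + m) <= psum p N + (16^-1 ^+ N - 16^-1 ^+ (N + m)) / 5.
Proof.
elim: m => [|m ih]; first by rewrite addn0 subrr mul0r addr0.
rewrite addnS psumS exprS.
have : (e p (N + m))%:R <= 3 :> R by rewrite ler_nat.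
have := q0 (N + m); have : 0 <= (e p (N + m))%:R :> R by [].
move: (16^-1 ^+ (N + m)) (16^-1 ^+ N) ((e p (N + m))%:R) ih => x y z ih z0 x0 z3; nra.
Qed.

Let sums p := [set x | exists N, x = psum p N].

(** The digit series, as the supremum of its partial sums; the shift by 1/2 makes the code positive,
    as [riesz_quantile] requires. *)
Definition digit_code (p : P) : R := 1 / 2 + sup (sums p).

Let sums_sup p : has_sup (sums p).
Proof.
split; first by exists (psum p 0), 0%N.
exists (1 / 5) => _ [N ->]; have := psum_ub p 0 N; rewrite add0n /psum big_ord0 expr0.
by have := q0 N; lra.
Qed.

Let code_ge p N : 1 / 2 + psum p N <= digit_code p.
Proof. by rewrite lerD2l; apply: ub_le_sup; [exact: (sums_sup p).2|exists N]. Qed.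

Let code_le p N : digit_code p <= 1 / 2 + psum p N + 16^-1 ^+ N / 5.
Proof.
rewrite -addrA lerD2l; apply: ge_sup; first exact: (sums_sup p).1.
move=> _ [M ->]; have [NM|MN] := leqP N M.
  rewrite -(subnKC NM) (le_trans (psum_ub _ _ _))// lerD2l ler_pM2r ?invr_gt0//.
  by rewrite gerBl.
rewrite -(subnKC (ltnW MN)) (le_trans (psum_le p M (N - M)))// lerDl.
by rewrite divr_ge0.
Qed.

Lemma digit_code_itv p : 0 < digit_code p <= 1.
Proof.
have := code_ge p 0; have := code_le p 0; rewrite /psum big_ord0 expr0.
by move=> h1 h2; apply/andP; split; lra.
Qed.

(** At the first different digit the codes part by at least [16^-1 ^+ m.+1], and the remaining
    digits make up for at most a fifth of that: digits at most 3 leave gaps, which rules out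
    carries. *)
Lemma digit_code_sep p p' m : (forall n, (n < m)%N -> e p n = e p' n) ->
  e p m != e p' m -> 16^-1 ^+ m.+2 <= `|digit_code p - digit_code p'|.
Proof.
wlog lt : p p' / (e p m < e p' m)%N.
  move=> H eqn ne; move: (ne); rewrite neq_ltn => /orP[lt|lt]; first exact: H.
  by rewrite distrC H// 1?eq_sym// => n nm; rewrite eqn.
move=> eqn _.
have eqm : psum p m = psum p' m.
  by apply: eq_bigr => n _; rewrite eqn.
have := code_le p m.+1; have := code_ge p' m.+1; rewrite !psumS eqm.
rewrite distrC => h1 h2; rewrite (le_trans _ (ler_norm _))// exprS.
have : (e p m)%:R + 1 <= (e p' m)%:R :> R by rewrite natr1 ler_nat.
have := q0 m.+1.
move: (16^-1 ^+ m.+1) ((e p m)%:R) ((e p' m)%:R) h1 h2 => x y z h1 h2 x0 yz; nra.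
Qed.

End digits.

(** For [s] in [[0, 1[], the integer formed by the first [n] binary digits of [s]; [bit n] below is
    the digit that follows them. *)
Let quo (n : nat) (s : R) : nat := Num.truncn (2 ^+ n * s).

Let quo_itv n (s : R) : 0 <= s -> (quo n s)%:R <= 2 ^+ n * s < (quo n s).+1%:R.
Proof. by move=> s0; apply: truncn_itv; rewrite mulr_ge0 ?exprn_ge0. Qed.

Let quo_half n (s : R) : 0 <= s -> (quo n.+1 s)./2 = quo n s.
Proof.
move=> s0; have /andP[h1 h2] := quo_itv n.+1 s0.
apply/esym; apply: truncn_def.
have e1 : (quo n.+1 s)%:R = (odd (quo n.+1 s))%:R + 2 * (quo n.+1 s)./2%:R :> R.
  by rewrite -{1}(odd_double_half (quo n.+1 s)) natrD -mul2n natrM.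
rewrite -(natr1 (quo _ _)) e1 exprS -mulrA in h2; rewrite e1 exprS -mulrA in h1.
have : (odd (quo n.+1 s))%:R = 0 :> R \/ (odd (quo n.+1 s))%:R = 1 :> R.
  by case: odd; [right|left].
by rewrite -(natr1 _./2); move: ((odd _)%:R) (2 ^+ n * s) h1 h2 => o x h1 h2 [] o01; lra.
Qed.

Let bit n (s : R) : bool := odd (quo n.+1 s).

Let quo_close n (s s' : R) : 0 <= s -> 0 <= s' -> quo n s = quo n s' ->
  `|s - s'| <= 2^-1 ^+ n.
Proof.
move=> s0 s'0 eq; have /andP[h1 h2] := quo_itv n s0.
have /andP[h1' h2'] := quo_itv n s'0; rewrite eq in h1 h2.
have n0 : 0 < 2 ^+ n :> R by rewrite exprn_gt0.
rewrite -(ler_pM2l n0) -{1}(gtr0_norm n0) -normrM exprVn divff ?gt_eqF//.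
by rewrite -(natr1 (quo _ _)) in h2 h2'; rewrite ler_norml mulrBr; lra.
Qed.

Let quo_bits (s s' : R) m : 0 <= s < 1 -> 0 <= s' < 1 ->
  (forall n, (n < m)%N -> bit n s = bit n s') -> quo m s = quo m s'.
Proof.
move=> /andP[s0 s1] /andP[s'0 s'1]; elim: m => [_|m ih H].
  have q0 z : 0 <= z < 1 -> quo 0 z = 0%N.
    by move=> /andP[z0 z1]; apply: truncn_def; rewrite expr0 mul1r z0 z1.
  by rewrite !q0 ?s0 ?s'0.
rewrite -(odd_double_half (quo m.+1 s)) -(odd_double_half (quo m.+1 s')).
rewrite !quo_half// ih => [|n nm]; last by apply: H; rewrite ltnS ltnW.
by have := H m (ltnSn m); rewrite /bit => ->.
Qed.

(* A space-filling curve: [c] interleaves the binary digits of [s] and [t] into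
   digits [0..3] in base 16, so that its inverse is Hoelder continuous. *)
Lemma square_code : exists c : R -> R -> R, exists d1 d2 : R -> R,
  [/\ continuous d1, continuous d2 & forall s t, 0 <= s < 1 -> 0 <= t < 1 ->
    [/\ 0 < c s t <= 1, d1 (c s t) = s & d2 (c s t) = t]].
Proof.
pose e (p : R * R) n := ((bit n p.1).*2 + bit n p.2)%N.
have e3 p n : (e p n <= 3)%N by rewrite /e; case: bit; case: bit.
pose S := [set p : R * R | 0 <= p.1 < 1 /\ 0 <= p.2 < 1].
have S0 : S !=set0 by exists (0, 0); rewrite /S/= lexx ltr01.
have eE p q n : e p n = e q n -> bit n p.1 = bit n q.1 /\ bit n p.2 = bit n q.2.
  by rewrite /e; case: (bit n p.1); case: (bit n q.1); case: (bit n p.2); case: (bit n q.2).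
have hoelder p q : S p -> S q -> forall f : R * R -> R,
    (forall p, S p -> 0 <= f p < 1) ->
    (forall n, e p n = e q n -> bit n (f p) = bit n (f q)) ->
    `|f p - f q| <= 4 * Num.sqrt (Num.sqrt `|digit_code e p - digit_code e q|).
  move=> Sp Sq f f01 fbit.
  have /andP[fp0 _] := f01 _ Sp; have /andP[fq0 _] := f01 _ Sq.
  (* If no digit differs, the two values agree to every precision and are equal; otherwise the first
     difference decides. *)
  have [[m0 ne0]|allE] := pselect (exists n, e p n != e q n); last first.
    have close n : `|f p - f q| <= 2^-1 ^+ n.
      apply: quo_close => //; apply: quo_bits; [exact: f01|exact: f01|].
      move=> i _; apply: fbit; apply/eqP/negPn/negP => ne.
      by apply: allE; exists i.
    rewrite (_ : `|f p - f q| = 0) ?mulr_ge0 ?sqrtr_ge0//.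
    apply/eqP; rewrite eq_le normr_ge0 andbT leNgt; apply/negP => pos.
    have : 2^-1 ^+ n @[n --> \oo] --> (0 : R).
      by apply: cvg_expr; rewrite ger0_norm ?invr_ge0// invf_lt1// ltr1n.
    move=> /cvgrPdist_lt /(_ _ pos)[N _ /(_ N (leqnn N))] /=.
    by rewrite sub0r normrN ger0_norm ?exprn_ge0 ?invr_ge0// ltNge close.
  have exm : exists n, e p n != e q n by exists m0.
  have [m ne min] := ex_minnP exm.
  have eqn n : (n < m)%N -> e p n = e q n.
    by move=> nm; apply/eqP; apply: contraTT nm => /min; rewrite -leqNgt.
  have sep := digit_code_sep e3 eqn ne.
  have close : `|f p - f q| <= 2^-1 ^+ m.
    apply: quo_close => //; apply: quo_bits; [exact: f01|exact: f01|].
    by move=> i im; apply: fbit; exact: eqn.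
  rewrite (le_trans close)// -ler_pdivrMl//.
  (* [4^-1 * 2^-1 ^+ m] is [2^-1 ^+ m.+2], the fourth root of the separation of the codes: this is
     the origin of the constant 4. *)
  rewrite (_ : 4^-1 * 2^-1 ^+ m = Num.sqrt (Num.sqrt (16^-1 ^+ m.+2))); last first.
    have -> : 16^-1 ^+ m.+2 = (2^-1 ^+ m.+2) ^+ 2 ^+ 2 :> R.
      by rewrite -!exprM mulnC exprM; congr (_ ^+ _); field.
    rewrite sqrtr_sqr ger0_norm ?sqr_ge0// sqrtr_sqr ger0_norm ?exprn_ge0 ?invr_ge0//.
    by rewrite 2!exprS; field.
  by rewrite ler_wsqrtr// ler_wsqrtr.
have [||d1 cd1 d1E] := @hoelder_extension R _ S (digit_code e) fst S0.
- by move=> p [/andP[]].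
- by move=> p q Sp Sq; apply: hoelder => // [z []//|n /eE[]].
have [||d2 cd2 d2E] := @hoelder_extension R _ S (digit_code e) snd S0.
- by move=> p [_ /andP[]].
- by move=> p q Sp Sq; apply: hoelder => // [z []//|n /eE[]].
exists (fun s t => digit_code e (s, t)), d1, d2; split => // s t s01 t01.
split; first exact: digit_code_itv.
- by rewrite d1E.
- by rewrite d2E.
Qed.

End interleaved_digits.

(** * Functionals on bounded measurable functions *)

Section bounded_functionals.
Context d {T : measurableType d} {R : realType}.
Implicit Types (D : set T) (f g : T -> R) (I J : (T -> R) -> R).

Definition bounded_measurable D f :=
  measurable_fun D f /\ exists B, forall x, D x -> `|f x| <= B.

(** Linear, and continuous for uniform convergence on [D]; on an empty [D] the bound [B] may be
    negative, hence its absolute value. *)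
Definition bounded_functional D I :=
  (forall a f g, bounded_measurable D f -> bounded_measurable D g ->
    I (fun x => a * f x + g x) = a * I f + I g) /\
  exists2 C, 0 <= C & forall f B, bounded_measurable D f ->
    (forall x, D x -> `|f x| <= B) -> `|I f| <= C * `|B|.

Lemma bounded_measurable_cst D c : bounded_measurable D (fun=> c).
Proof. by split; [exact: measurable_cst|exists `|c|]. Qed.

Lemma bounded_measurable_lin D a f g : bounded_measurable D f ->
  bounded_measurable D g -> bounded_measurable D (fun x => a * f x + g x).
Proof.
move=> [mf [B fB]] [mg [C gC]]; split.
  by apply: measurable_funD => //; apply: measurable_funM => //; exact: measurable_cst.
exists (`|a| * B + C) => x Dx.
rewrite (le_trans (ler_normD _ _))// normrM lerD ?gC//.
by rewrite ler_wpM2l// fB.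
Qed.

Lemma bounded_measurableM D f g : bounded_measurable D f ->
  bounded_measurable D g -> bounded_measurable D (fun x => f x * g x).
Proof.
move=> [mf [B fB]] [mg [C gC]]; split; first exact: measurable_funM.
by exists (B * C) => x Dx; rewrite normrM ler_pM// ?fB ?gC.
Qed.

Lemma bounded_measurableB D f g : bounded_measurable D f ->
  bounded_measurable D g -> bounded_measurable D (fun x => f x - g x).
Proof.
move=> bf bg; have := bounded_measurable_lin (-1) bg bf.
by congr bounded_measurable; apply/funext => x; rewrite mulN1r addrC.
Qed.

Lemma bounded_measurable_indic D (A : set T) : measurable A ->
  bounded_measurable D \1_A.
Proof.
move=> mA; split; first exact: measurable_indic.
by exists 1 => x _; rewrite indicE; case: (_ \in _); rewrite ?normr1 ?normr0.
Qed.

Lemma functional_lin D a I J : bounded_functional D I -> bounded_functional D J ->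
  bounded_functional D (fun f => a * I f + J f).
Proof.
move=> [Il [C C0 IC]] [Jl [C' C'0 JC]]; split.
  by move=> b f g bf bg; rewrite Il// Jl//; ring.
exists (`|a| * C + C'); first by rewrite addr_ge0// mulr_ge0.
move=> f B bf fB; rewrite (le_trans (ler_normD _ _))// mulrDl lerD ?JC//.
by rewrite normrM -mulrA ler_wpM2l// IC.
Qed.

Lemma functional_eq0 D J : measurable D -> bounded_functional D J ->
  (forall A, measurable A -> A `<=` D -> J \1_A = 0) ->
  forall f, bounded_measurable D f -> J f = 0.
Proof.
move=> mD [Jl [C C0 JC]] J1.
have Jeq f g : bounded_measurable D f -> bounded_measurable D g ->
    (forall x, D x -> f x = g x) -> J f = J g.
  move=> bf bg fg; apply/eqP; rewrite -subr_eq0 -normr_le0.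
  have := Jl (-1) _ _ bg bf; rewrite mulN1r addrC => <-.
  rewrite (le_trans (JC _ 0 _ _)) ?normr0 ?mulr0//.
    exact: bounded_measurable_lin.
  by move=> x Dx; rewrite fg// mulN1r addNr normr0.
(* The layers of height [e] of [f] are peeled off one at a time. *)
have small N e f : 0 < e -> bounded_measurable D f ->
    (forall x, D x -> 0 <= f x <= e *+ N.+1) -> `|J f| <= C * e.
  move=> e0; elim: N f => [|N ih] f bf f0.
    rewrite -(gtr0_norm e0); apply: JC => // x /f0/andP[f0x fe].
    by rewrite ger0_norm// gtr0_norm.
  pose E := D `&` f @^-1` `[e, +oo[.
  have mE : measurable E by apply: bf.1 => //; exact: measurable_itv.
  pose g x := - e * \1_E x + f x.
  have bE := bounded_measurable_indic D mE.
  have -> : J f = J g.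
    rewrite Jl// J1// ?mulr0 ?add0r//; exact: subIsetl.
  apply: ih; first exact: bounded_measurable_lin.
  move=> x Dx; have /andP[f0x fe] := f0 _ Dx.
  rewrite /g indicE; have [xE|xE] := boolP (x \in E).
    have : E x by rewrite inE in xE.
    move=> [_ /=]; rewrite in_itv/= andbT => ex.
    by rewrite mulr1 addrC subr_ge0 ex/= lerBlDr -mulrSr.
  rewrite mulr0 add0r f0x/= mulrS (@le_trans _ _ e)//; last first.
    by rewrite lerDl mulrn_wge0// ltW.
  rewrite leNgt; apply/negP => /ltW ef.
  by move: xE; rewrite notin_setE; apply; split => //=; rewrite in_itv/= ef.
have one : J (fun=> 1) = 0.
  rewrite -(J1 D)//; apply: Jeq.
  - exact: bounded_measurable_cst.
  - exact: bounded_measurable_indic.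
  - by move=> x Dx; rewrite indicE mem_set.
move=> f bf; have [mf [B fB]] := bf.
(* Shifting by the bound [B] makes the function nonnegative, as the layers require, without changing
   its value under [J]. *)
have Jf : J f = J (fun x => B * 1 + f x).
  by rewrite Jl ?one ?mulr0 ?add0r//; exact: bounded_measurable_cst.
apply/eqP; rewrite -normr_le0; apply/ler_addgt0Pr => e e0; rewrite add0r.
have C1 : 0 < C + 1 by rewrite ltr_wpDl.
have e'0 : 0 < e / (C + 1) by rewrite divr_gt0.
rewrite (@le_trans _ _ (C * (e / (C + 1))))//; last first.
  by rewrite mulrCA ger_pMr// ler_pdivrMr// mul1r lerDl.
rewrite Jf; apply: (small (Num.bound ((`|B| + `|B|) / (e / (C + 1))))) => //.
  by apply: bounded_measurable_lin => //; exact: bounded_measurable_cst.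
move=> x Dx; have := fB _ Dx; rewrite mulr1 ler_norml => /andP[h1 h2].
rewrite -lerBlDl sub0r h1/= (@le_trans _ _ (`|B| + `|B|))//.
  by rewrite lerD ?ler_norm// (le_trans h2)// ler_norm.
rewrite -mulr_natr mulrC -ler_pdivrMr// ltW// (lt_le_trans (archi_boundP _))//.
  by rewrite divr_ge0 ?addr_ge0// ltW.
by rewrite ler_nat.
Qed.

(** Reduces identities between integrals to indicators. Signed measures enter on the same footing as
    positive ones, although their integrals are defined through a chosen Hahn decomposition. *)
Lemma functional_ext D I J : measurable D ->
  bounded_functional D I -> bounded_functional D J ->
  (forall A, measurable A -> A `<=` D -> I \1_A = J \1_A) ->
  forall f, bounded_measurable D f -> I f = J f.
Proof.
move=> mD bI bJ IJ f bf.
have := @functional_eq0 D _ mD (functional_lin (-1) bI bJ) _ f bf.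
rewrite mulN1r addrC => /(_ _)/eqP; rewrite subr_eq0 => H.
apply/esym/eqP/H => A mA AD; by rewrite IJ// mulN1r addNr.
Qed.

Section integrals.
Variables (mu : {measure set T -> \bar R}) (D : set T).
Hypotheses (mD : measurable D) (muD : (mu D < +oo)%E).

Lemma bounded_measurable_integrable f : bounded_measurable D f ->
  mu.-integrable D (EFin \o f).
Proof.
move=> [mf [B fB]]; apply: measurable_bounded_integrable => //.
exists B; split; first exact: num_real.
by move=> M /ltW BM x Dx; exact: le_trans (fB _ Dx) BM.
Qed.

Lemma functional_Rintegral : bounded_functional D (fun f => \int[mu]_(x in D) f x).
Proof.
split=> [a f g bf bg|].
  have ba := bounded_measurable_cst D a.
  have bM := bounded_measurableM ba bf.
  rewrite (RintegralD mD (bounded_measurable_integrable bM))//; last first.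
    exact: bounded_measurable_integrable.
  by rewrite RintegralZl//; exact: bounded_measurable_integrable.
exists (fine (mu D)) => [|f B bf fB]; first exact: fine_ge0.
have iB c := bounded_measurable_integrable (bounded_measurable_cst D c).
have if_ := bounded_measurable_integrable bf.
rewrite (le_trans (le_normr_Rintegral _ if_))//.
rewrite mulrC -(Rintegral_cst mu mD)//; apply: le_Rintegral => //.
  exact: (integrable_norm if_).
by move=> x /fB /le_trans; apply; exact: ler_norm.
Qed.

Lemma Rintegral_indicE A : measurable A -> A `<=` D ->
  \int[mu]_(x in D) \1_A x = fine (mu A).
Proof.
by move=> mA AD; rewrite /Rintegral integral_indic// setIidl.
Qed.

End integrals.
End bounded_functionals.

Section transported_functionals.
Context d d' {T : measurableType d} {T' : measurableType d'} {R : realType}.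

Lemma functional_comp (D : set T) (D' : set T') (U : (T -> R) -> T' -> R) M I :
  (forall f, bounded_measurable D f -> bounded_measurable D' (U f)) ->
  (forall a f g, U (fun x => a * f x + g x) = (fun y => a * U f y + U g y)) ->
  0 <= M -> (forall f B, (forall x, D x -> `|f x| <= B) ->
    forall y, D' y -> `|U f y| <= M * `|B|) ->
  bounded_functional D' I -> bounded_functional D (fun f => I (U f)).
Proof.
move=> bU lU M0 UM [Il [C C0 IC]]; split.
  by move=> a f g bf bg; rewrite lU Il//; exact: bU.
exists (C * M); first exact: mulr_ge0.
move=> f B bf fB; have := IC (U f) (M * `|B|) (bU _ bf) (UM _ _ fB).
by rewrite normrM normr_id (ger0_norm M0) mulrA.
Qed.

End transported_functionals.

Lemma finite_measure_lty d (T : measurableType d) (R : realType)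
  (m : {finite_measure set T -> \bar R}) (D : set T) : measurable D -> (m D < +oo)%E.
Proof. by move=> mD; rewrite ltey_eq fin_num_measure. Qed.

Section charges.
Context d {T : measurableType d} {R : realType}.
Variables (nu : {charge set T -> \bar R}) (D : set T).
Hypothesis mD : measurable D.

Lemma functional_charge_integral : bounded_functional D (charge_integral nu D).
Proof.
pose H := projT2 (cid (projT2 (cid (Hahn_decomposition nu)))).
have := functional_lin (-1)
  (functional_Rintegral mD (finite_measure_lty (jordan_neg H) mD))
  (functional_Rintegral mD (finite_measure_lty (jordan_pos H) mD)).
by congr bounded_functional; apply/funext => f; rewrite mulN1r addrC.
Qed.

Lemma charge_integral_indic A : measurable A -> A `<=` D ->
  charge_integral nu D \1_A = fine (nu A).
Proof.
move=> mA AD; rewrite /charge_integral.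
pose H := projT2 (cid (projT2 (cid (Hahn_decomposition nu)))).
rewrite (jordan_decomp H mA) !Rintegral_indicE// -/H fineD//.
- by rewrite /= /cscale/= mulN1e fineN.
- by rewrite fin_num_measure.
- by rewrite fin_num_measure.
Qed.

End charges.

Section functional_sums.
Context d {T : measurableType d} {R : realType} (D : set T).
Variables (J : Type) (F : J -> T -> R).
Hypothesis bF : forall j, bounded_measurable D (F j).

Lemma bounded_measurable_sum (r : seq J) :
  bounded_measurable D (fun x => \sum_(j <- r) F j x).
Proof.
elim: r => [|j r ih].
  by under eq_fun do rewrite big_nil; exact: bounded_measurable_cst.
under eq_fun do rewrite big_cons -[F j _]mul1r.
exact: bounded_measurable_lin.
Qed.

Lemma functional_sum I (r : seq J) : bounded_functional D I ->
  I (fun x => \sum_(j <- r) F j x) = \sum_(j <- r) I (F j).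
Proof.
move=> [Il _]; elim: r => [|j r ih].
  under eq_fun do rewrite big_nil; rewrite big_nil.
  have b0 := bounded_measurable_cst D (0 : R).
  transitivity (I (fun=> -1 * 0 + 0)); first by rewrite mulr0 addr0.
  by rewrite Il// mulN1r addNr.
under eq_fun do rewrite big_cons -[F j _]mul1r.
rewrite Il//; last exact: bounded_measurable_sum.
by rewrite ih mul1r big_cons.
Qed.

End functional_sums.

Section transported_measures.
Context d d' {X : measurableType d} {T : measurableType d'} {R : realType}.

(** The measure is the sum of the images under [phi i] of [la] restricted to [D i]; in its use there
    is one summand for each pair of components. *)
Lemma sum_pushforward_measure (la : {measure set X -> \bar R}) (n : nat)
    (D : nat -> set X) (phi : nat -> X -> T) :
  (forall i, measurable (D i)) -> (forall i, (la (D i) < +oo)%E) ->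
  (forall i, measurable_fun setT (phi i)) ->
  exists mu : {finite_measure set T -> \bar R},
    (forall A, measurable A ->
      mu A = (\sum_(i < n) la (phi i @^-1` A `&` D i))%E) /\
    forall f, bounded_measurable setT f ->
      \int[mu]_(p in setT) f p = \sum_(i < n) \int[la]_(u in D i) f (phi i u).
Proof.
move=> mD laD mphi.
pose m i : {measure set T -> \bar R} :=
  @measure_function_pushforward__canonical__measure_function_Measure
    _ _ _ _ _ (mrestr la (mD i)) (phi i) (mphi i).
have mE A : msum m n A = (\sum_(i < n) la (phi i @^-1` A `&` D i))%E by [].
have mpre i A : measurable A -> measurable (phi i @^-1` A).
  by move=> mA; rewrite -[X in measurable X]setTI; exact: (mphi i measurableT _ mA).
have fin_num i A : measurable A -> la (phi i @^-1` A `&` D i) \is a fin_num.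
  move=> mA; rewrite ge0_fin_numE// (le_lt_trans _ (laD i))// le_measure// ?inE//.
  by apply: measurableI => //; exact: mpre.
have mT : (msum m n setT < +oo)%E.
  by rewrite mE; apply/lte_sum_pinfty => i _; rewrite -ge0_fin_numE// fin_num.
exists (mfrestr measurableT mT).
have muE A : mfrestr measurableT mT A = (\sum_(i < n) la (phi i @^-1` A `&` D i))%E.
  by rewrite /mfrestr /mrestr setIT.
split=> [A _|f bf]; first exact: muE.
apply: (@functional_ext _ _ _ setT
  (fun f => \int[mfrestr measurableT mT]_(p in setT) f p)
  (fun f => \sum_(i < n) \int[la]_(u in D i) f (phi i u))) bf => //.
- by apply: functional_Rintegral => //; exact: finite_measure_lty.
- elim: (n) => [|N ih].
    split=> [a g h _ _|]; first by rewrite !big_ord0 mulr0 addr0.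
    by exists 0 => // g B _ _; rewrite big_ord0 normr0 mul0r.
  have step : bounded_functional (@setT T) (fun g : T -> R =>
      \int[la]_(u in D N) (fun g u => g (phi N u)) g u).
    apply: (@functional_comp _ _ _ _ _ _ (D N) (fun g u => g (phi N u)) 1).
    + move=> g [mg [B gB]]; split.
        by apply: measurableT_comp => //; exact: measurable_funTS.
      by exists B => u _; exact: gB.
    + by [].
    + by [].
    + by move=> g B gB u _; rewrite mul1r (le_trans (gB _ _))// ler_norm.
    + by apply: functional_Rintegral.
  have := functional_lin 1 step ih; congr bounded_functional; apply/funext => g.
  by rewrite big_ord_recr/= mul1r addrC.
- move=> A mA _; rewrite Rintegral_indicE// [X in fine X](_ : _ = (\sum_(i < n) la (phi i @^-1` A `&` D i))%E);
    last exact: muE.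
  rewrite -sum_fine => [|i _]; last exact: fin_num.
  apply: eq_bigr => i _.
  transitivity (\int[la]_(u in D i) \1_(phi i @^-1` A `&` D i) u).
    apply/esym; apply: Rintegral_indicE => //.
    by apply: measurableI => //; exact: mpre.
  apply: eq_Rintegral => u uD; rewrite !indicE in_setI uD andbT.
  by congr (_%:R); congr nat_of_bool; apply/idP/idP; rewrite !inE.
Qed.

End transported_measures.

(** * The measure on the struts and its force *)

Section component_measurability.
Context {R : realType} {k : nat}.

Lemma measurable_ord_family d d' (T : measurableType d) (T' : measurableType d')
    (g : T -> 'I_k.+1) (F : 'I_k.+1 -> T -> T') :
  measurable_fun setT g -> (forall i, measurable_fun setT (F i)) ->
  measurable_fun setT (fun x => F (g x) x).
Proof.
move=> mg mF _ B mB; rewrite setTI.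
have -> : (fun x => F (g x) x) @^-1` B =
    \bigcup_(i in [set: 'I_k.+1]) (g @^-1` [set i] `&` F i @^-1` B).
  apply/seteqP; split=> [x Bx|x [i _ [/= <-]]//].
  by exists (g x).
apply: fin_bigcup_measurable => [|i _]; first exact: finite_finset.
have h1 := mg measurableT [set i] I; rewrite setTI in h1.
have h2 := mF i measurableT B mB; rewrite setTI in h2.
exact: measurableI.
Qed.

Lemma measurable_lpoint_fun d (T : measurableType d) (g : T -> lpoint R k)
    (h : 'I_k.+1 -> R -> R) :
  measurable_fun setT g -> (forall i, measurable_fun setT (h i)) ->
  measurable_fun setT (fun x => h (g x).1 (g x).2).
Proof.
move=> mg mh.
apply: (@measurable_ord_family _ _ _ _ (fst \o g) (fun i x => h i (g x).2)).
  by apply: measurableT_comp => //; exact: measurable_fst.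
move=> i; apply: (measurableT_comp (mh i)).
by apply: measurableT_comp => //; exact: measurable_snd.
Qed.

Lemma measurable_ord_rel d (T : measurableType d) (g h : T -> 'I_k.+1)
    (r : rel 'I_k.+1) : measurable_fun setT g -> measurable_fun setT h ->
  measurable [set x | r (g x) (h x)].
Proof.
move=> mg mh.
have -> : [set x | r (g x) (h x)] =
    \bigcup_(e in [set e : 'I_k.+1 * 'I_k.+1 | r e.1 e.2])
      (g @^-1` [set e.1] `&` h @^-1` [set e.2]).
  apply/seteqP; split=> [x rx|x [e re [/= -> ->]]//].
  by exists (g x, h x).
apply: fin_bigcup_measurable => [|e _]; first exact: finite_finset.
have h1 := mg measurableT [set e.1] I; rewrite setTI in h1.
have h2 := mh measurableT [set e.2] I; rewrite setTI in h2.
exact: measurableI.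
Qed.

Lemma measurable_points (L : link R k) : measurable (points L).
Proof.
have -> : points L = snd @^-1` `[0, +oo[ `&`
    (fun x : lpoint R k => x.2 - period L x.1) @^-1` `]-oo, 0[.
  apply/seteqP; split=> x /=; rewrite /points/= !in_itv/= andbT subr_lt0.
    by move=> /andP[].
  by move=> [-> ->].
apply: measurableI.
  rewrite -[X in measurable X]setTI; exact: measurable_snd.
have m : measurable_fun setT (fun x : lpoint R k => x.2 - period L x.1).
  apply: (@measurable_lpoint_fun _ _ id (fun i s => s - period L i)) => [//|i].
  by apply: measurable_funB.
by rewrite -[X in measurable X]setTI; exact: m.
Qed.

End component_measurability.

Section strut_measure.
Context {R : realType} {k : nat} (L : link R k).
Notation l := (period L).
Notation pair := (lpoint R k * lpoint R k)%type.
Notation leb := (@lebesgue_measure R).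
Implicit Types (f : pair -> R).

Let l0 i : 0 < l i. Proof. exact: period_gt0. Qed.

Lemma measurable_rmod (a : R) : 0 < a -> measurable_fun [set: R] (rmod a).
Proof.
move=> a0; rewrite /rmod; apply: measurable_funB; first exact: measurable_id.
apply: measurable_funM; first exact: measurable_cst.
apply: nondecreasing_measurable => // x y xy.
by rewrite ler_int le_floor// ler_pM2r// invr_gt0.
Qed.

(** Pairs as in [Strut] but without the distance condition: decoded quantiles fall here, not
    necessarily on struts. *)
Definition chamber : set pair :=
  [set p | [/\ points L p.1, points L p.2 & (p.1.1 < p.2.1)%N]].

Lemma measurable_increasing_pairs : measurable [set p : pair | (p.1.1 < p.2.1)%N].
Proof.
apply: (@measurable_ord_rel k _ _ (fun p : pair => p.1.1) (fun p : pair => p.2.1)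
    (fun i j : 'I_k.+1 => (i < j)%N)).
- exact: (measurableT_comp measurable_fst measurable_fst).
- exact: (measurableT_comp measurable_fst measurable_snd).
Qed.

Lemma measurable_chamber : measurable chamber.
Proof.
have -> : chamber = fst @^-1` points L `&` snd @^-1` points L `&`
    [set p : pair | (p.1.1 < p.2.1)%N].
  by apply/seteqP; split=> p; [move=> []|move=> [[]]].
apply: measurableI; first apply: measurableI.
- rewrite -[X in measurable X]setTI; apply: measurable_fst => //;
  exact: measurable_points.
- rewrite -[X in measurable X]setTI; apply: measurable_snd => //;
  exact: measurable_points.
- exact: measurable_increasing_pairs.
Qed.

(** What transport through the code demands: continuity along continuous parameters, because the
    inverse of the code is substituted, and invariance under [rmod], because decoded parameters are
    reduced to one period. *)
Definition chamber_fun f := [/\ bounded_measurable setT f,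
  forall (i j : 'I_k.+1) (a b : R -> R), (i < j)%N -> continuous a -> continuous b ->
    continuous (fun x : R => f ((i, a x), (j, b x)) : R) &
  forall (i j : 'I_k.+1) (s t : R), (i < j)%N ->
    f ((i, rmod (l i) s), (j, rmod (l j) t)) = f ((i, s), (j, t))].

Variable Lam : (pair -> R) -> R.
Hypothesis Lam_lin : forall a f g, bounded_on (Strut L) f ->
  bounded_on (Strut L) g -> Lam (fun x => a * f x + g x) = a * Lam f + Lam g.
Hypothesis Lam_pos : forall f, bounded_on (Strut L) f ->
  (forall x, Strut L x -> 0 <= f x) -> 0 <= Lam f.

Let on (e : 'I_k.+1 * 'I_k.+1) (p : pair) : R :=
  ((p.1.1 == e.1) && (p.2.1 == e.2))%:R.

Let bounded_on_on e : bounded_on (Strut L) (on e).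
Proof. by exists 1 => p _; rewrite /on; case: (_ && _); rewrite ?normr1 ?normr0. Qed.

Let chamber_bounded f : chamber_fun f -> bounded_on (Strut L) f.
Proof. by move=> [[_ [B fB]] _ _]; exists B => p _; exact: fB. Qed.

Let edges :=
  [seq e : 'I_k.+1 * 'I_k.+1 <- index_enum ('I_k.+1 * 'I_k.+1)%type | (e.1 < e.2)%N].

Let bounded_on_sum (s : seq ('I_k.+1 * 'I_k.+1)) :
  bounded_on (Strut L) (fun p => \sum_(e <- s) on e p).
Proof.
elim: s => [|e s ih]; first by exists 0 => p _; rewrite big_nil normr0.
have := bounded_on_lin 1 (bounded_on_on e) ih; congr bounded_on.
by apply/funext => p; rewrite big_cons mul1r.
Qed.

Let Lam_sum f (s : seq ('I_k.+1 * 'I_k.+1)) : bounded_on (Strut L) f ->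
  Lam (fun p => (\sum_(e <- s) on e p) * f p) = \sum_(e <- s) Lam (fun p => on e p * f p).
Proof.
move=> bf; elim: s => [|e s ih].
  rewrite [RHS]big_nil; transitivity (0 * Lam f); last by rewrite mul0r.
  rewrite -(LamZ Lam_lin)//; congr Lam.
  by apply/funext => p; rewrite big_nil.
rewrite big_cons -ih -[X in X + _]mul1r -Lam_lin; last 2 first.
- exact: bounded_onM.
- exact: bounded_onM.
by congr Lam; apply/funext => p; rewrite big_cons mul1r mulrDl.
Qed.

Let Lam_edges f : bounded_on (Strut L) f ->
  Lam f = \sum_(e <- edges) Lam (fun p => on e p * f p).
Proof.
move=> bf; rewrite -Lam_sum//; apply: (eq_Lam Lam_lin Lam_pos) => //.
  by apply: bounded_onM.
move=> p [_ _ pij _]; rewrite -[LHS]mul1r; congr (_ * _).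
rewrite big_filter/= (bigD1 (p.1.1, p.2.1))//= /on/= !eqxx/=.
rewrite big1 ?addr0// => -[i j] /=; rewrite xpair_eqE => /andP[_].
by rewrite [i == _]eq_sym [j == _]eq_sym => /negbTE ->.
Qed.

(* For each pair of components, the functional is carried to [0, 1] by the code of
   the square, represented there by a quantile function, and brought back by the
   continuous inverse of the code. *)
Theorem strut_measure_exists :
  exists mu : {finite_measure set pair -> \bar R}, mu (~` chamber) = 0%E /\
    forall f, chamber_fun f -> \int[mu]_(p in setT) f p = Lam f.
Proof.
have [c [d1 [d2 [cd1 cd2 cE]]]] := @square_code R.
(* Off the pair [e] of components the code takes the value 1, which lies in the range that
   [riesz_quantile] admits; the weight [on e] removes these pairs. *)
pose code (e : 'I_k.+1 * 'I_k.+1) (p : pair) : R :=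
  if (p.1.1 == e.1) && (p.2.1 == e.2) then c (p.1.2 / l e.1) (p.2.2 / l e.2) else 1.
have unit_itv i (s : R) : 0 <= s < l i -> 0 <= s / l i < 1.
  by move=> /andP[s0 sl]; rewrite divr_ge0 ?(ltW (l0 i))//= ltr_pdivrMr// mul1r.
have code01 e p : Strut L p -> 0 < code e p <= 1.
  move=> [/= p1 p2 _ _]; rewrite /code; case: ifP => [/andP[/eqP e1 /eqP e2]|_].
    by have [] := cE _ _ (unit_itv e.1 p.1.2 _) (unit_itv e.2 p.2.2 _);
      rewrite -?e1 -?e2.
  by rewrite ltr01 lexx.
have bon e f : bounded_on (Strut L) f -> bounded_on (Strut L) (fun p => on e p * f p).
  by move=> bf; exact: bounded_onM.
have quantile e : exists Q : R -> R, [/\ {homo Q : u v / u <= v}, forall u, 0 <= Q u <= 1 &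
    forall g : R -> R, continuous g ->
      \int[leb]_(u in `]0, Lam (fun p => on e p * 1)]) g (Q u) =
      Lam (fun p => on e p * g (code e p))].
  apply: (riesz_quantile (Lam := fun f => Lam (fun p => on e p * f p)) _ _ (code01 e)).
    move=> a f g bf bg; rewrite -Lam_lin; [|exact: bon..].
    by congr Lam; apply/funext => p; ring.
  move=> f bf f0; apply: Lam_pos; first exact: bon.
  by move=> p Sp; rewrite mulr_ge0 ?f0// /on ler0n.
have [Q HQ] := choice quantile.
(* The extensions [d1] and [d2] are not confined to [[0, 1[] off the range of the code; [rmod]
   brings the parameters back to [points]. *)
pose decode (e : 'I_k.+1 * 'I_k.+1) (x : R) : pair :=
  ((e.1, rmod (l e.1) (l e.1 * d1 x)), (e.2, rmod (l e.2) (l e.2 * d2 x))).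
have mcoord i (d : R -> R) e : continuous d ->
    measurable_fun setT (fun u => (i, rmod (l i) (l i * d (Q e u))) : lpoint R k).
  move=> cd; apply: measurable_fun_pair; first exact: measurable_cst.
  apply: (measurableT_comp (measurable_rmod (l0 i))).
  apply: measurable_funM; first exact: measurable_cst.
  apply: (measurableT_comp (continuous_measurable_fun cd)).
  by apply: nondecreasing_measurable => //; have [] := HQ e.
have leb_lty (b : R) : (leb (`]0%R, b]%classic : set R) < +oo)%E.
  by rewrite lebesgue_measure_itv/=; case: ifP => _; rewrite ?ltry// -EFinD ltry.
pose edge n := nth (ord0, ord0) edges n.
pose D n : set (measurableTypeR R) := `]0, Lam (fun p => on (edge n) p * 1)]%classic.
have := @sum_pushforward_measure _ _ (measurableTypeR R) _ R leb (size edges) D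
  (fun n u => decode (edge n) (Q (edge n) u)).
case.
- by move=> n; exact: measurable_itv.
- by move=> n; exact: leb_lty.
- by move=> n; apply: measurable_fun_pair; exact: mcoord.
move=> mu [muE intE]; exists mu; split.
  rewrite muE; last by apply: measurableC; exact: measurable_chamber.
  rewrite big1// => i _; rewrite (_ : _ `&` _ = set0) ?measure0//.
  apply/seteqP; split=> u // [] /= H _; apply: H.
  have := mem_nth (ord0, ord0) (ltn_ord i); rewrite -/(edge i) mem_filter => /andP[ei _].
  by split => //=; exact: rmod_itv.
move=> f ff; have [bf cf pf] := ff; have bLf := chamber_bounded ff.
rewrite intE// (Lam_edges bLf) (big_nth (ord0, ord0)) big_mkord; apply: eq_bigr => i _.
rewrite -/(edge i).
have lt_i : ((edge i).1 < (edge i).2)%N.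
  have := mem_nth (ord0, ord0) (ltn_ord i).
  by rewrite -/(edge i) mem_filter => /andP[].
rewrite /D; move: (edge i) lt_i => e lt_e; have [_ _ HQe] := HQ e.
pose g (x : R) : R := f ((e.1, l e.1 * d1 x), (e.2, l e.2 * d2 x)).
have cg : continuous g.
  by apply: cf => // x; apply: cvgMr; [exact: cd1|exact: cd2].
rewrite (_ : Lam (fun p => on e p * f p) = Lam (fun p => on e p * g (code e p))).
  rewrite -HQe//; apply: eq_Rintegral => u _.
  by rewrite /decode pf.
apply: (eq_Lam Lam_lin Lam_pos).
- exact: bon.
- have [B fB] := bf.2.
  by apply: bon; exists B => p _; exact: fB.
move=> p Sp; rewrite /on /g /code; case: ifP => [/andP[/eqP e1 /eqP e2]|]; last by rewrite !mul0r.
have [p1 p2 _ _] := Sp; rewrite -e1 -e2.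
have [_ -> ->] := cE _ _ (unit_itv p.1.1 p.1.2 p1) (unit_itv p.2.1 p.2.2 p2).
rewrite ![l _ * _]mulrC !divfK ?gt_eqF//.
by case: p {Sp e1 e2 p1 p2} => -[i' s] [j' t].
Qed.

End strut_measure.

(** * Forces and the adjoint of the rigidity operator *)

Section forces.
Context {R : realType} {k : nat} (L : link R k).
Notation pair := (lpoint R k * lpoint R k)%type.
Implicit Types xi : 'I_k.+1 -> R -> 'rV[R]_3.

Let dir (p : pair) : 'rV[R]_3 := L p.2.1 p.2.2 - L p.1.1 p.1.2.

Definition direction (c : 'I_3) (p : pair) : R := dir p ord0 c / enorm (dir p).

Lemma measurable_coord_field d (T : measurableType d) xi (g : T -> lpoint R k) c :
  VF L xi -> measurable_fun setT g ->
  measurable_fun setT (fun x => xi (g x).1 (g x).2 ord0 c).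
Proof.
move=> xiV mg; apply: (measurable_lpoint_fun (h := fun i s => xi i s ord0 c)) => // i.
apply: continuous_measurable_fun; apply: continuous_coord.
by have [] := xiV i.
Qed.

Let measurable_dir c : measurable_fun setT (fun p => dir p ord0 c).
Proof.
rewrite (_ : (fun p => _) = fun p : pair => L p.2.1 p.2.2 ord0 c - L p.1.1 p.1.2 ord0 c);
  last by apply/funext => p; rewrite !mxE.
apply: measurable_funB; apply: measurable_coord_field; try exact: VF_link.
- exact: measurable_snd.
- exact: measurable_fst.
Qed.

Lemma measurable_edge_length : measurable_fun setT (fun p : pair => enorm (dir p)).
Proof.
apply: (@measurableT_comp _ _ _ _ _ _ (Num.sqrt : R -> R)).
  by apply: continuous_measurable_fun; exact: sqrt_continuous.
apply: measurable_sum => c; apply: measurable_funM; exact: measurable_dir.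
Qed.

Lemma measurable_direction c : measurable_fun setT (direction c).
Proof.
rewrite (_ : direction c = fun p => dir p ord0 c * enorm (dir p) `^ (-1)); last first.
  by apply/funext => p; rewrite powR_inv1// enorm_ge0.
apply: measurable_funM; first exact: measurable_dir.
apply: (@measurableT_comp _ _ _ _ _ _ (fun x : R => x `^ (-1))).
  exact: measurable_powR.
exact: measurable_edge_length.
Qed.

Lemma ler_norm_direction c p : `|direction c p| <= 1.
Proof.
rewrite /direction normrM normfV (ger0_norm (enorm_ge0 _)).
have [->|p0] := eqVneq (enorm (dir p)) 0; first by rewrite invr0 mulr0.
rewrite ler_pdivrMr ?mul1r ?ler_coord_enorm//.
by rewrite lt_neqAle eq_sym p0 enorm_ge0.
Qed.

Lemma rigidityE xi p : rigidity L xi p =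
  \sum_(c < 3) (xi p.2.1 p.2.2 ord0 c - xi p.1.1 p.1.2 ord0 c) * direction c p.
Proof.
rewrite /rigidity /dot mulr_suml; apply: eq_bigr => c _.
by rewrite /direction /dir !mxE mulrA.
Qed.

Lemma measurable_Strut : measurable (Strut L).
Proof.
have -> : Strut L = chamber L `&` (fun p => enorm (dir p)) @^-1` [set LThi L].
  by apply/seteqP; split => p; [move=> []|move=> [[]]].
apply: measurableI; first exact: measurable_chamber.
rewrite -[X in measurable X]setTI; exact: measurable_edge_length.
Qed.

Lemma bounded_measurable_coord xi c : VF L xi ->
  bounded_measurable (points L) (fun x => xi x.1 x.2 ord0 c).
Proof.
move=> xiV; split.
  by apply: measurable_funTS; exact: (measurable_coord_field (g := id)).
have [B _ xiB] := VF_bounded xiV; exists B => x _.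
exact: le_trans (ler_coord_enorm _ _) (xiB _ _).
Qed.

Let bounded_measurable_gap (c : 'I_3) (f : lpoint R k -> R) :
  bounded_measurable (points L) f ->
  bounded_measurable (Strut L) (fun p => (f p.2 - f p.1) * direction c p).
Proof.
move=> [mf [B fB]].
have m1 : bounded_measurable (Strut L) (fun p => f p.1).
  split; last by exists B => p [p1 _ _ _]; exact: fB.
  apply: (@measurable_comp _ _ _ _ _ _ (points L)) => //.
  - exact: measurable_points.
  - by move=> _ [p [p1 _ _ _] <-].
  - exact: measurable_funTS measurable_fst.
have m2 : bounded_measurable (Strut L) (fun p => f p.2).
  split; last by exists B => p [_ p2 _ _]; exact: fB.
  apply: (@measurable_comp _ _ _ _ _ _ (points L)) => //.
  - exact: measurable_points.
  - by move=> _ [p [_ p2 _ _] <-].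
  - exact: measurable_funTS measurable_snd.
apply: bounded_measurableM; first exact: bounded_measurableB.
split; first by apply: measurable_funTS; exact: measurable_direction.
by exists 1 => p _; exact: ler_norm_direction.
Qed.

Lemma bounded_measurable_rigidity xi : VF L xi ->
  bounded_measurable (Strut L) (rigidity L xi).
Proof.
move=> xiV; rewrite (funext (rigidityE xi)).
apply: bounded_measurable_sum => c.
exact: (bounded_measurable_gap c (bounded_measurable_coord c xiV)).
Qed.

(** The Hahn decompositions behind the two integrals are chosen independently, so the integrals are
    compared on indicators. *)
Lemma charge_integralN (nu nu' : {charge set (lpoint R k) -> \bar R}) f :
  (forall B, measurable B -> B `<=` points L -> nu B = (- nu' B)%E) ->
  bounded_measurable (points L) f ->
  charge_integral nu (points L) f = - charge_integral nu' (points L) f.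
Proof.
move=> nuN bf; have mP := measurable_points L.
rewrite -mulN1r -[RHS]addr0.
apply: (functional_ext (J := fun f => -1 * charge_integral nu' (points L) f + 0)) bf => //.
- exact: functional_charge_integral.
- apply: functional_lin; first exact: functional_charge_integral.
  split; first by move=> *; rewrite mulr0 addr0.
  by exists 0 => // *; rewrite normr0 mul0r.
- move=> B mB BP; rewrite !charge_integral_indic// nuN// fineN.
  by rewrite mulN1r addr0.
Qed.

Lemma opposite_force_integral (F K : force R k) xi : opposite_forces L F K ->
  VF L xi -> force_integral L xi F = - force_integral L xi K.
Proof.
move=> FK xiV; rewrite /force_integral -sumrN; apply: eq_bigr => c _.
by apply: charge_integralN; [exact: FK|exact: bounded_measurable_coord].
Qed.

Section rigidity_adjoint.
Variable mu : {finite_measure set pair -> \bar R}.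

Let f0 c (p : pair) : \bar R := (direction c p * \1_(Strut L) p)%:E.

Let mS : measurable (Strut L). Proof. exact: measurable_Strut. Qed.

Let bf0 c : bounded_measurable setT (fun p => direction c p * \1_(Strut L) p).
Proof.
apply: bounded_measurableM; last exact: bounded_measurable_indic.
by split; [exact: measurable_direction|exists 1 => p _; exact: ler_norm_direction].
Qed.

Let if0 c : mu.-integrable setT (f0 c).
Proof.
apply: bounded_measurable_integrable => //; exact: finite_measure_lty.
Qed.

(** Component [c] of the unit strut vectors, weighted by [mu] on the struts and carried to the end
    point [e]. *)
Let pushed c (e : pair -> lpoint R k) (me : measurable_fun setT e) :
  {charge set (lpoint R k) -> \bar R} :=
  measure_function_pushforward__canonical__charge_Charge
    (induced_charge (if0 c)) me.

Let pushedE c e (me : measurable_fun setT e) B : measurable B ->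
  pushed c me B = (\int[mu]_(p in Strut L) (\1_B (e p) * direction c p))%R%:E.
Proof.
move=> mB; rewrite /pushed/= /pushforward /induced_charge.
have meB : measurable (e @^-1` B) by rewrite -[X in measurable X]setTI; exact: me.
rewrite -[LHS]fineK; last by apply: integrable_fin_num => //; exact: integrableS (if0 c).
congr EFin; rewrite -/(Rintegral _ _ (fun p => direction c p * \1_(Strut L) p)).
rewrite Rintegral_mkcond [RHS]Rintegral_mkcond; apply: eq_Rintegral => p _.
rewrite /patch !indicE [p \in e @^-1` B](_ : _ = (e p \in B)); last first.
  by apply/idP/idP; rewrite !inE.
by case: (e p \in B); case: (p \in Strut L); rewrite ?mulr1 ?mul1r ?mulr0 ?mul0r.
Qed.

(** A strut acts on its two ends by opposite unit forces: the adjoint is the image of the charge of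
    density [direction c] at the second end minus its image at the first. *)
Theorem rigidity_adjoint_exists : exists F : force R k, is_rigidity_adjoint L mu F.
Proof.
pose F c : {charge set (lpoint R k) -> \bar R} :=
  cadd (pushed c measurable_snd) (copp (pushed c measurable_fst)).
have mP := measurable_points L.
have FE c f : bounded_measurable (points L) f -> charge_integral (F c) (points L) f =
    \int[mu]_(p in Strut L) ((f p.2 - f p.1) * direction c p).
  apply: (functional_ext (J := fun f => \int[mu]_(p in Strut L) ((f p.2 - f p.1) * direction c p))) => //.
  - exact: functional_charge_integral.
  - apply: (functional_comp (D' := Strut L) (U := fun f p => (f p.2 - f p.1) * direction c p) (M := 2)).
    + exact: bounded_measurable_gap.
    + by move=> a g h; apply/funext => p; ring.
    + by [].
    + move=> g B gB p [p1 p2 _ _]; rewrite normrM -[leRHS]mulr1 ler_pM// ?ler_norm_direction//.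
      rewrite (le_trans (ler_normB _ _))// mulrDl mul1r lerD//.
        exact: le_trans (gB _ p2) (ler_norm _).
      exact: le_trans (gB _ p1) (ler_norm _).
    + by apply: functional_Rintegral => //; exact: finite_measure_lty.
  - move=> B mB BP; rewrite charge_integral_indic//.
    rewrite [F c B](_ : _ = pushed c measurable_snd B - pushed c measurable_fst B)%E//.
    have bi e : measurable_fun setT e ->
        bounded_measurable (Strut L) (fun p : pair => \1_B (e p) * direction c p).
      move=> me; apply: bounded_measurableM; last first.
        split; first by apply: measurable_funTS; exact: measurable_direction.
        by exists 1 => p _; exact: ler_norm_direction.
      have [mi [C iC]] := @bounded_measurable_indic _ _ R setT B mB.
      split; last by exists C => p _; exact: iC.
      by apply: measurable_funTS; exact: measurableT_comp.
    rewrite !pushedE//= -RintegralB//; last 2 first.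
    + exact: (bounded_measurable_integrable mS (finite_measure_lty mu mS) (bi _ measurable_snd)).
    + exact: (bounded_measurable_integrable mS (finite_measure_lty mu mS) (bi _ measurable_fst)).
    by apply: eq_Rintegral => p _; rewrite mulrBl.
exists F => xi xiV; rewrite /force_integral.
rewrite (funext (rigidityE xi)).
rewrite (@functional_sum _ _ _ (Strut L) _ _ _ (fun f => \int[mu]_(p in Strut L) f p)).
- by apply: eq_bigr => c _; rewrite FE//; exact: bounded_measurable_coord.
- by move=> c; exact: (bounded_measurable_gap c (bounded_measurable_coord c xiV)).
- by apply: functional_Rintegral => //; exact: finite_measure_lty.
Qed.

End rigidity_adjoint.
End forces.

(** * Strong criticality and the balance of forces *)

Section rigidity_operator.
Context {R : realType} {k : nat} (L : link R k).
Hypothesis hL : arclength_parametrized L.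
Notation pair := (lpoint R k * lpoint R k)%type.
Implicit Types xi : 'I_k.+1 -> R -> 'rV[R]_3.

Lemma rigidity_lin a xi eta :
  rigidity L (vf_lin a xi eta) = fun p => a * rigidity L xi p + rigidity L eta p.
Proof.
apply/funext => p; rewrite !rigidityE mulr_sumr -big_split/=.
by apply: eq_bigr => c _; rewrite /vf_lin !mxE; ring.
Qed.

Lemma ler_norm_rigidity xi B p : (forall i s, enorm (xi i s) <= B) ->
  `|rigidity L xi p| <= 2 * B.
Proof.
move=> xiB; have B0 : 0 <= B := le_trans (enorm_ge0 _) (xiB ord0 0).
rewrite /rigidity normrM normfV (ger0_norm (enorm_ge0 _)).
set u := xi _ _ - _; set v := L _ _ - _.
have [->|v0] := eqVneq (enorm v) 0; first by rewrite invr0 mulr0 mulr_ge0.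
rewrite ler_pdivrMr; last by rewrite lt_neqAle eq_sym v0 enorm_ge0.
rewrite (le_trans (ler_norm_dot _ _))// ler_wpM2r ?enorm_ge0//.
by rewrite /u (le_trans (ler_enormD _ _))// enormN mulrDl mul1r lerD.
Qed.

Section positive_bound.
Variables (M : R) (M0 : 0 <= M).
Hypothesis dLen_le : forall xi b, VFsmooth L xi -> 0 <= b ->
  (forall p, Strut L p -> rigidity L xi p <= b) -> dLen L xi <= M * b.

(** Applied to a field and to its opposite, the one-sided bound becomes two-sided. *)
Lemma finite_total_curvature_of_strut_bound : finite_total_curvature L.
Proof.
apply: (finite_total_curvature_of_bound hL (M := M * 2)); first by rewrite mulr_ge0.
move=> xi B xiS xiB; have B0 : 0 <= B := le_trans (enorm_ge0 _) (xiB ord0 0).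
have rB p := ler_norm_rigidity p xiB.
rewrite -mulrA ler_norml; apply/andP; split; last first.
  by apply: dLen_le; rewrite ?mulr_ge0// => p _; exact: le_trans (ler_norm _) (rB p).
have [nS nE] := VFsmooth_dLenZ hL (-1) xiS.
rewrite lerNl -mulN1r -nE; apply: dLen_le; rewrite ?mulr_ge0// => p _.
by rewrite rigidityZ mulN1r (le_trans _ (rB p))// -normrN ler_norm.
Qed.

Lemma strut_functional_exists : exists Lam : (pair -> R) -> R,
  [/\ forall a f g, bounded_on (Strut L) f -> bounded_on (Strut L) g ->
        Lam (fun x => a * f x + g x) = a * Lam f + Lam g,
      forall f, bounded_on (Strut L) f -> (forall x, Strut L x -> 0 <= f x) -> 0 <= Lam f &
      forall xi, VFsmooth L xi -> Lam (rigidity L xi) = dLen L xi].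
Proof.
pose S := Strut L.
pose E (f : pair -> R^o) := [set b : R | 0 <= b /\ forall p, S p -> f p <= b].
(* The maximum of 0 and the supremum of [f] over the struts; as an infimum of nonnegative bounds it
   also makes sense when there are no struts. *)
pose q (f : pair -> R^o) : R := inf (E f).
have Eq f b : E f b -> q f <= b.
  by move=> Efb; apply: ge_inf => //; exists 0 => x [].
have qE f : bounded_on S f -> E f (q f).
  move=> [B fB]; have E0 : E f !=set0.
    exists `|B|; split => // p Sp.
    exact: le_trans (ler_norm _) (le_trans (fB _ Sp) (ler_norm _)).
  split; first by apply: lb_le_inf => // x [].
  by move=> p Sp; apply: lb_le_inf => // x [_]; exact.
have q_sub f g : bounded_on S f -> bounded_on S g ->
    M * q (f + g) <= M * q f + M * q g.
  move=> /qE[f0 fq] /qE[g0 gq]; rewrite -mulrDr ler_wpM2l//; apply: Eq; split.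
    exact: addr_ge0.
  by move=> p Sp; rewrite lerD ?fq ?gq.
have q_le a f : 0 <= a -> bounded_on S f -> q (a *: f) <= a * q f.
  move=> a0 /qE[f0 fq]; apply: Eq; split; first exact: mulr_ge0.
  by move=> p Sp; rewrite ler_wpM2l// fq.
have bZ a (f : pair -> R^o) : bounded_on S f -> bounded_on S (a *: f).
  by move=> bf; apply: (bounded_onM (bounded_on_cst S a) bf).
have q_hom a f : 0 <= a -> bounded_on S f -> M * q (a *: f) = a * (M * q f).
  move=> a0 bf; rewrite mulrCA; congr (_ * _); apply/eqP.
  rewrite eq_le q_le//=; have [->|a1] := eqVneq a 0.
    by rewrite mul0r; have [] := qE _ (bZ 0 _ bf).
  have ap : 0 < a by rewrite lt_neqAle eq_sym a1.
  rewrite mulrC -ler_pdivlMr// mulrC -{1}[f]scale1r -(mulVf a1) -scalerA.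
  by apply: q_le; [rewrite invr_ge0|exact: bZ].
(* That [dLen] depends only on the rigidity of the field is implied by the domination of this
   graph. *)
pose G := [set z : (pair -> R^o) * R |
  exists2 xi, VFsmooth L xi & z = (rigidity L xi, dLen L xi)].
have b_rig xi : VFsmooth L xi -> bounded_on S (rigidity L xi).
  by move=> [/bounded_measurable_rigidity[_ [B h]] _]; exists B.
have [|||||Lam [Lam_lin Lam_le LamG]] :=
    @hahn_banach R _ (@bounded_on R _ S) (fun f => M * q f) _ _ q_sub q_hom G.
- exact: bounded_on_cst.
- by move=> a f g bf bg; exact: bounded_on_lin.
- have [s0 d0] := VFsmooth_dLenZ hL 0 (VFsmooth0 L).
  exists (fun _ _ => 0 *: 0) => //; rewrite d0 mul0r; congr (_, _).
  by apply/funext => p; rewrite rigidityZ mul0r.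
- move=> a f r g s [xi xiS [-> ->]] [eta etaS [-> ->]].
  exists (vf_lin a xi eta); first exact: VFsmooth_lin.
  by rewrite rigidity_lin dLen_lin.
- move=> f r [xi xiS [-> ->]]; split; first exact: b_rig.
  by have [q0 rq] := qE _ (b_rig _ xiS); exact: dLen_le.
have Lam_lin' a f g : bounded_on S f -> bounded_on S g ->
    Lam (fun x => a * f x + g x) = a * Lam f + Lam g := Lam_lin a f g.
exists Lam; split => //.
(* For nonnegative [f] the bound 0 is admissible for the opposite function, on which [Lam] is
   therefore at most 0. *)
- move=> f bf f0; have bNf := bounded_onM (bounded_on_cst S (-1)) bf.
  have := Lam_le (fun p => -1 * f p) bNf; rewrite (LamZ Lam_lin' _ bf) mulN1r => h.
  rewrite -oppr_le0 (le_trans h)// -(mulr0 M) ler_wpM2l//; apply: Eq; split => // p Sp.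
  by rewrite mulN1r oppr_le0 f0.
- by move=> xi xiS; apply: LamG; exists xi.
Qed.

End positive_bound.

(** Pairs on a single component may be closer than the thickness; this factor removes them, which
    keeps the product with [excess] nonnegative everywhere. *)
Let chamber_indic (p : pair) : R := (p.1.1 < p.2.1)%N%:R.

Let bounded_indic (f : pair -> R) : measurable_fun setT f ->
  (exists B, forall p : pair, (p.1.1 < p.2.1)%N -> `|f p| <= B) ->
  bounded_measurable setT (fun p => chamber_indic p * f p).
Proof.
move=> mf [B fB]; split; last first.
  exists `|B| => p _; rewrite /chamber_indic; have [ij|_] := boolP (_ < _)%N.
    by rewrite mul1r (le_trans (fB _ ij))// ler_norm.
  by rewrite mul0r normr0.
apply: measurable_funM => //.
rewrite (_ : chamber_indic = \1_[set p : pair | (p.1.1 < p.2.1)%N]).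
  by apply: measurable_indic; exact: measurable_increasing_pairs.
by apply/funext => p; rewrite indicE/= mem_setE.
Qed.

Let pair_continuous (F : R * R -> R) (a b : R -> R) : continuous F ->
  continuous a -> continuous b -> continuous (fun x => F (a x, b x)).
Proof.
move=> cF ca cb x; apply: (@continuous_comp _ _ _ (fun x => (a x, b x)) F).
  exact: (cvg_pair (ca x) (cb x)).
exact: cF.
Qed.

Let chamber_rigidity xi : VF L xi ->
  chamber_fun L (fun p => chamber_indic p * rigidity L xi p).
Proof.
move=> xiV; split.
- apply: bounded_indic.
    rewrite (funext (rigidityE L xi)); apply: measurable_sum => c.
    apply: measurable_funM; last exact: measurable_direction.
    apply: measurable_funB.
    + exact: (measurable_coord_field c xiV measurable_snd).
    + exact: (measurable_coord_field c xiV measurable_fst).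
  have [B _ xiB] := VF_bounded xiV; exists (2 * B) => p _.
  exact: ler_norm_rigidity.
- move=> i j a b ij ca cb; rewrite /chamber_indic/= ij.
  under eq_fun do rewrite mul1r rigidity_slope.
  by apply: pair_continuous => //; exact: continuous_slope.
- move=> i j s t ij; rewrite /chamber_indic/= !rigidity_slope.
  by rewrite slope_rmod.
Qed.

(* The strut functional vanishes on the excess of a pair over the thickness, a
   nonnegative function: this forces [mu] to be carried by the struts. *)
Let excess (p : pair) : R := enorm (gap L p.1.1 p.2.1 (p.1.2, p.2.2)) - LThi L.

Let chamber_excess : chamber_fun L (fun p => chamber_indic p * excess p).
Proof.
have [B _ LB] := VF_bounded (VF_link L).
split.
- apply: bounded_indic.
    by apply: measurable_funB; [exact: measurable_edge_length|exact: measurable_cst].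
  exists (2 * B + `|LThi L|) => p _.
  rewrite (le_trans (ler_normB _ _))// lerD// ger0_norm ?enorm_ge0//.
  by rewrite (le_trans (ler_enormD _ _))// enormN mulrDl mul1r lerD.
- move=> i j a b ij ca cb; rewrite /chamber_indic/= ij.
  under eq_fun do rewrite mul1r.
  apply: (pair_continuous (F := fun q => enorm (gap L i j q) - LThi L)) => // q.
  apply: cvgB; last exact: cvg_cst.
  by apply: continuous_enorm => c; apply: continuous_gap_coord; exact: VF_link.
- by move=> i j s t ij; rewrite /excess/= gap_rmod//; exact: VF_link.
Qed.

Theorem balanced_measure_exists : strongly_critical L ->
  exists mu : {finite_measure set pair -> \bar R}, forall xi, VFsmooth L xi ->
    \int[mu]_(p in Strut L) rigidity L xi p = dLen L xi.
Proof.
move=> /(strongly_critical_bound hL)[M M0 dLen_le].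
have [Lam [Lam_lin Lam_pos LamE]] := strut_functional_exists M0 dLen_le.
have [mu [muC muE]] := strut_measure_exists Lam_lin Lam_pos.
exists mu => xi xiS; have [xiV _] := xiS.
have mS := measurable_Strut L.
have bS f : chamber_fun L f -> bounded_on (Strut L) f.
  by move=> [[_ [B fB]] _ _]; exists B => p _; exact: fB.
have excess0 p : Strut L p -> excess p = 0.
  by move=> [_ _ _ e]; rewrite /excess /gap/= e subrr.
have int0 : \int[mu]_(p in setT) (chamber_indic p * excess p) = 0.
  rewrite muE//.
  have b0 : bounded_on (Strut L) (fun=> 0 : R) := bounded_on_cst _ 0.
  rewrite (eq_Lam Lam_lin Lam_pos (bS _ chamber_excess) (bounded_onM b0 b0)).
    by rewrite (LamZ Lam_lin) ?mul0r.
  by move=> p /excess0 ->; rewrite !mulr0.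
have ge0 p : 0 <= chamber_indic p * excess p.
  rewrite /chamber_indic; have [ij|_] := boolP (_ < _)%N; last by rewrite mul0r.
  by rewrite mul1r subr_ge0 LThi_le.
have [bE _ _] := chamber_excess.
(* The complement of the chamber is null by construction; inside it, a nonnegative function of
   integral 0 vanishes almost everywhere, and the zeros of [excess] there are the struts. *)
have muN : mu (~` Strut L) = 0%E.
  have /ae_eq_integral_abs : (\int[mu]_(p in setT) `|(chamber_indic p * excess p)%:E|)%E = 0%E.
    under eq_integral do rewrite gee0_abs ?lee_fin//.
    rewrite -[LHS]fineK; first by rewrite [fine _]int0.
    by apply: integrable_fin_num => //; apply: bounded_measurable_integrable bE;
      last exact: finite_measure_lty.
  have mE : measurable_fun setT (EFin \o (fun p => chamber_indic p * excess p)).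
    by apply/measurable_EFinP; exact: bE.1.
  move=> /(_ measurableT mE) neg.
  have mC := measurable_chamber L.
  apply/(negligibleP mu (measurableC mS)).
  have negC : mu.-negligible (~` chamber L).
    by apply/(negligibleP mu (measurableC mC)).
  apply: (negligibleS _ (negligibleU negC neg)).
  move=> p pS; have [pC|pC] := pselect (chamber L p); last by left.
  right => /(_ I) [e]; apply: pS; have [p1 p2 ij] := pC; split => //.
  move: e; rewrite /chamber_indic ij mul1r => /eqP; rewrite subr_eq0 => /eqP <-.
  by [].
rewrite -LamE//; have [bR _ _] := chamber_rigidity xiV.
rewrite -(eq_Lam Lam_lin Lam_pos (bS _ (chamber_rigidity xiV))); last 2 first.
- by have [_ [B rB]] := bounded_measurable_rigidity xiV; exists B.
- by move=> p [_ _ ij _]; rewrite /chamber_indic ij mul1r.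
rewrite -muE; last exact: chamber_rigidity.
transitivity (\int[mu]_(p in Strut L) (chamber_indic p * rigidity L xi p)).
  apply: eq_Rintegral => p; rewrite inE => -[_ _ ij _].
  by rewrite /chamber_indic ij mul1r.
congr fine; rewrite [RHS](negligible_integral (measurableC mS))//.
  by rewrite setTD setCK.
by apply: bounded_measurable_integrable bR; last exact: finite_measure_lty.
Qed.

End rigidity_operator.

Theorem corollary6p3 (R : realType) (k : nat) (L : link R k)
    (hL : arclength_parametrized L) :
  strongly_critical L <->
  (finite_total_curvature L /\
   exists mu : {finite_measure set (lpoint R k * lpoint R k)%type -> \bar R},
   exists F K : force R k,
     [/\ is_rigidity_adjoint L mu F,
         is_curvature_force L K &
         opposite_forces L F K]).
Proof.
split=> [cL|[_ [mu [F [K [FE KE FK]]]]]].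
  have [M M0 dLen_le] := strongly_critical_bound hL cL.
  split; first exact: (finite_total_curvature_of_strut_bound hL M0 dLen_le).
  have [mu muE] := balanced_measure_exists hL cL.
  have [F FE] := rigidity_adjoint_exists L mu.
  (* With the curvature force defined as the negative of the adjoint force, its characterization as
     the derivative of the tangent is the balance property of [mu]. *)
  pose K c : {charge set (lpoint R k) -> \bar R} := copp (F c).
  have FK : opposite_forces L F K.
    by move=> c B _ _; rewrite /K/= /copp oppeK.
  exists mu, F, K; split => // xi xiS.
  by rewrite -(opposite_force_integral FK (proj1 xiS)) FE ?muE//; case: xiS.
pose V := fine (mu (Strut L)).
have V0 : 0 <= V by exact: fine_ge0.
have mS := measurable_Strut L.
have muS := finite_measure_lty mu mS.
(* If the least rigidity exceeded [- (V + 1)^-1], its integral against a measure of mass [V] would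
   exceed -1; the added 1 covers [V = 0]. *)
exists (V + 1)^-1; first by rewrite invr_gt0 ltr_wpDl.
move=> xi xiS dxi; have [xiV _] := xiS.
have int1 : \int[mu]_(p in Strut L) rigidity L xi p = -1.
  by rewrite -FE// (opposite_force_integral FK xiV) -KE.
(* A single component has no struts, so the integral is 0 and contradicts [int1]. *)
have [k0|k_gt0] := posnP k.
  have S0 : Strut L = set0.
    apply/seteqP; split=> // p [_ _]; move: (ltn_ord p.2.1); rewrite [in X in (_ < X)%N]k0.
    by case: (nat_of_ord p.2.1).
  by move: int1; rewrite S0 Rintegral_set0 => /eqP; rewrite eq_sym oppr_eq0 oner_eq0.
have [p Sp pmin] := rigidity_min k_gt0 xiV.
rewrite (dLThi_min k_gt0 xiV Sp pmin) leNgt; apply/negP => lt_m.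
have : rigidity L xi p * V <= -1.
  rewrite -int1 -(Rintegral_cst mu mS); apply: le_Rintegral => //.
    exact/(bounded_measurable_integrable mS muS)/bounded_measurable_cst.
  exact/(bounded_measurable_integrable mS muS)/bounded_measurable_rigidity.
apply/negP; rewrite -ltNge (@lt_le_trans _ _ (- (V + 1)^-1 * V))//; last first.
  by rewrite ler_wpM2r// ltW.
rewrite mulNr ltrN2 mulrC ltr_pdivrMr ?mul1r ?ltrDl//.
by rewrite ltr_wpDl.
Qed.
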